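(* Let $\Omega\subset\mathbb{R}^N$ be a regular cone, let $Q:\mathbb{C}^M\times\mathbb{C}^M\to\mathbb{C}^N$ be an $\Omega$-positive Hermitian map, let $\mathcal{D}(\Omega,Q)$ be the associated Siegel domain of the second kind and let $G$ be the associated generalized Heisenberg group acting on $\mathcal{D}(\Omega,Q)$. Then for any $G$-equivariant holomorphic line bundle $L$ over $\mathcal{D}(\Omega,Q)$, the natural representation of $G$ on the space $\Gamma^{hol}(\mathcal{D}(\Omega,Q),L)$ of holomorphic sections of $L$ is multiplicity-free.
   Context: $N,M$ are positive integers. A regular cone $\Omega\subset\mathbb{R}^N$ is a nonempty open convex cone containing no entire straight line. A Hermitian map $Q:\mathbb{C}^M\times\mathbb{C}^M\to\mathbb{C}^N$ is a sesquilinear map (complex linear in the first variable, antilinear in the second) with $Q(v,u)=\overline{Q(u,v)}$; it is $\Omega$-positive if $Q(u,u)\in\overline{\Omega}\setminus\{0\}$ for all $u\neq 0$. Put $$\mathcal{D}(\Omega,Q)=\{(z,u)\in\mathbb{C}^N\times\mathbb{C}^M\mid \mathrm{Im}\,z-Q(u,u)\in\Omega\}.$$ For $x_0\in\mathbb{R}^N$, $u_0\in\mathbb{C}^M$ let $n(x_0,u_0)$ be the affine transformation $$(z,u)\mapsto(z+x_0+2iQ(u,u_0)+iQ(u_0,u_0),\,u+u_0)$$ of $\mathbb{C}^N\times\mathbb{C}^M$; it preserves $\mathcal{D}(\Omega,Q)$. The set $G=\{n(x_0,u_0)\mid x_0\in\mathbb{R}^N,u_0\in\mathbb{C}^M\}$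 is closed under composition and is a Lie group (the generalized Heisenberg group). For a $G$-equivariant holomorphic line bundle $L$, the natural representation on $\Gamma^{hol}(\mathcal{D}(\Omega,Q),L)$ is $(g\cdot s)(x)=g\,s(g^{-1}x)$, and $\Gamma^{hol}(\mathcal{D}(\Omega,Q),L)$ carries the compact-open topology. An irreducible $G$-invariant Hilbert subspace is a linear subspace $\mathcal{H}\subset\Gamma^{hol}(\mathcal{D}(\Omega,Q),L)$ equipped with a Hilbert space structure such that it is the image of an irreducible unitary representation of $G$ under an injective continuous $G$-intertwining operator (with the Hilbert structure transported by this operator). The representation is called multiplicity-free if any two irreducible $G$-invariant Hilbert subspaces either coincide as linear spaces and have proportional inner products, or yield inequivalent unitary representations of $G$. *)

(* Defs.v *)
From HB Require Import structures.
From mathcomp Require Import all_boot all_order all_algebra.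
From mathcomp Require Import complex ring lra.
From mathcomp Require Import all_classical all_reals all_analysis.

Set Implicit Arguments.
Unset Strict Implicit.
Unset Printing Implicit Defensive.

Import Order.TTheory GRing.Theory Num.Theory.
Import numFieldNormedType.Exports.

Local Open Scope classical_set_scope.
Local Open Scope ring_scope.

(* The standard normed topology of R[i]; MathComp-Analysis only declares it for
   abstract number fields. *)
#[non_forgetful_inheritance]
HB.instance Definition _ (R : realType) :=
  PseudoPointedMetric.copy R[i] (R[i] : numClosedFieldType)^o.
#[non_forgetful_inheritance]
HB.instance Definition _ (R : realType) := GRing.ComAlgebra.copy R[i] R[i]^o.
#[non_forgetful_inheritance]
HB.instance Definition _ (R : realType) := Vector.copy R[i] R[i]^o.
#[non_forgetful_inheritance]
HB.instance Definition _ (R : realType) :=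
  NormedModule.copy R[i] (R[i] : numClosedFieldType)^o.

Section ComplexVectors.
Context {R : realType} {n : nat}.

Definition toC (x : 'rV[R]_n) : 'rV[R[i]]_n := map_mx (real_complex R) x.
Definition ReV (z : 'rV[R[i]]_n) : 'rV[R]_n := map_mx (@complex.Re R) z.
Definition ImV (z : 'rV[R[i]]_n) : 'rV[R]_n := map_mx (@complex.Im R) z.
Definition conjV (z : 'rV[R[i]]_n) : 'rV[R[i]]_n := map_mx (@conjc R) z.

Lemma toC_inj : injective toC.
Proof.
move=> x y /matrixP e; apply/matrixP => i j.
by have := e i j; rewrite !mxE => -[].
Qed.

Lemma conjVK : involutive conjV.
Proof. by move=> z; apply/matrixP => i j; rewrite !mxE conjcK. Qed.

Lemma conjVD z w : conjV (z + w) = conjV z + conjV w.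
Proof. by apply/matrixP => i j; rewrite !mxE rmorphD. Qed.

End ComplexVectors.

Record regular_cone (R : realType) (N : nat) (Omega : set 'rV[R]_N) : Prop := {
  cone_nonempty : Omega !=set0;
  cone_open : open Omega;
  cone_convex : convex_set Omega;
  cone_scale : forall (t : R) (x : 'rV[R]_N), 0 < t -> Omega x -> Omega (t *: x);
  cone_no_line : forall x v : 'rV[R]_N,
    (forall t : R, Omega (x + t *: v)) -> v = 0 }.

Record hermitian_map (R : realType) (N M : nat) := HermitianMap {
  hmap :> 'rV[R[i]]_M -> 'rV[R[i]]_M -> 'rV[R[i]]_N;
  hmapPl : forall (a : R[i]) u v w, hmap (a *: u + v) w = a *: hmap u w + hmap v w;
  hmapPr : forall (a : R[i]) u v w,
    hmap u (a *: v + w) = (conjc a) *: hmap u v + hmap u w;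
  hmap_conj : forall u v, hmap v u = conjV (hmap u v) }.

Definition cone_positive (R : realType) (N M : nat) (Omega : set 'rV[R]_N)
    (Q : hermitian_map R N M) : Prop :=
  forall u, u != 0 -> (toC @` (closure Omega `\ 0)) (Q u u).

Section SiegelDomain.
Context {R : realType} {N M : nat}.
Variable (Q : hermitian_map R N M).
Local Notation C := R[i].

Definition siegel (Omega : set 'rV[R]_N) : set ('rV[C]_N * 'rV[C]_M) :=
  [set p | (toC @` Omega) (toC (ImV p.1) - Q p.2 p.2)].

(* Q fixes the group law of heis, hence appears as a phantom parameter. *)
Definition heis : Type := let _ := Q in ('rV[R]_N * 'rV[C]_M)%type.

HB.instance Definition _ :=
  Topological.copy heis ('rV[R]_N * 'rV[C]_M)%type.

Definition naff (g : heis) (p : 'rV[C]_N * 'rV[C]_M) : 'rV[C]_N * 'rV[C]_M :=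
  (p.1 + toC g.1 + (2 * 'i%C) *: Q p.2 g.2 + 'i%C *: Q g.2 g.2, p.2 + g.2).

(* The law induced by composition: see naff1, naffM and naff_inj. *)
Definition heis_one : heis := (0, 0).
Definition heis_mul (g h : heis) : heis :=
  (g.1 + h.1 + 2 *: ImV (Q g.2 h.2), g.2 + h.2).
Definition heis_inv (g : heis) : heis := (- g.1, - g.2).

Lemma hmapDl u v w : Q (u + v) w = Q u w + Q v w.
Proof. by have := hmapPl Q 1 u v w; rewrite !scale1r. Qed.

Lemma hmapDr u v w : Q u (v + w) = Q u v + Q u w.
Proof. by have := hmapPr Q 1 u v w; rewrite conjc1 !scale1r. Qed.

Lemma hmap0l w : Q 0 w = 0.
Proof. by apply: (addrI (Q 0 w)); rewrite -hmapDl !addr0. Qed.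

Lemma hmap0r u : Q u 0 = 0.
Proof. by apply: (addrI (Q u 0)); rewrite -hmapDr !addr0. Qed.

Lemma hmapNr u v : Q u (- v) = - Q u v.
Proof. by apply/eqP; rewrite -addr_eq0 -hmapDr addNr hmap0r. Qed.

Lemma hmapNl u v : Q (- u) v = - Q u v.
Proof. by apply/eqP; rewrite -addr_eq0 -hmapDl addNr hmap0l. Qed.

Lemma hmapxx u : conjV (Q u u) = Q u u.
Proof. by rewrite -hmap_conj. Qed.

Lemma naff_inj : injective naff.
Proof.
move=> [x u] [y v] e; have := congr1 (fun f => f (0, 0)) e.
rewrite /naff /= !hmap0l !scaler0 !add0r !addr0 => -[+ uv].
by rewrite uv => /addIr/toC_inj ->.
Qed.

Lemma naff1 p : naff heis_one p = p.
Proof.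
case: p => z u; rewrite /naff /= !hmap0r !scaler0 !addr0.
by congr (_, _); apply/matrixP => i j; rewrite !mxE addr0.
Qed.

Lemma naffM g h p : naff (heis_mul g h) p = naff g (naff h p).
Proof.
case: g h p => [x u] [y v] [z w]; rewrite /naff /=; congr (_, _); last first.
  by rewrite addrAC addrA.
rewrite !(hmapDl, hmapDr) (hmap_conj Q u v).
apply/matrixP => i j; rewrite !mxE.
move: (z i j) (Q u v i j) (Q w u i j) (Q w v i j) (Q u u i j) (Q v v i j).
move=> [z1 z2] [a1 a2] [b1 b2] [c1 c2] [d1 d2] [e1 e2].
by apply/eqP; rewrite eq_complex /=; apply/andP; split; apply/eqP; ring.
Qed.

Lemma naff_siegel Omega g p : siegel Omega p -> siegel Omega (naff g p).
Proof.
case: g p => [x u] [z w] [y Oy /= e]; exists y => //; rewrite e.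
rewrite !(hmapDl, hmapDr) (hmap_conj Q w u).
have := hmapxx u; move=> /matrixP fu; have := hmapxx w; move=> /matrixP fw.
apply/matrixP => i j; have := fu i j; have := fw i j; rewrite !mxE.
move: (z i j) (Q w u i j) (Q u u i j) (Q w w i j).
move=> [z1 z2] [a1 a2] [b1 b2] [c1 c2] /= [Ec] [Eb].
have {}Ec : c2 = 0 by lra.
have {}Eb : b2 = 0 by lra.
rewrite {}Ec {}Eb.
by apply/eqP; rewrite eq_complex /=; apply/andP; split; apply/eqP; ring.
Qed.

Fact heis_mulA : associative heis_mul.
Proof. by move=> g h k; apply: naff_inj; apply/funext => p; rewrite !naffM. Qed.

Fact heis_mul1g : left_id heis_one heis_mul.
Proof. by move=> g; apply: naff_inj; apply/funext => p; rewrite naffM naff1. Qed.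

Fact heis_mulg1 : right_id heis_one heis_mul.
Proof. by move=> g; apply: naff_inj; apply/funext => p; rewrite naffM naff1. Qed.

Let ImVQ u : ImV (Q u u) = 0.
Proof.
have /matrixP f := hmapxx u; apply/matrixP => i j; have := f i j; rewrite !mxE.
by case: (Q u u i j) => a b /= [e]; lra.
Qed.

Let ImVN (z : 'rV[C]_N) : ImV (- z) = - ImV z.
Proof. by apply/matrixP => i j; rewrite !mxE; case: (z i j). Qed.

Fact heis_mulVg : left_inverse heis_one heis_inv heis_mul.
Proof.
move=> [x u]; rewrite /heis_mul /heis_one /= hmapNl ImVN ImVQ.
by rewrite oppr0 scaler0 addr0 !addNr.
Qed.

Fact heis_mulgV : right_inverse heis_one heis_inv heis_mul.
Proof.
move=> [x u]; rewrite /heis_mul /heis_one /= hmapNr ImVN ImVQ.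
by rewrite oppr0 scaler0 addr0 !addrN.
Qed.

HB.instance Definition _ := Choice.on heis.
HB.instance Definition _ :=
  isGroup.Build heis heis_mulA heis_mul1g heis_mulg1 heis_mulVg heis_mulgV.

End SiegelDomain.

Section GroupAction.
Context {R : realType} {N M : nat} {Omega : set 'rV[R]_N}.
Variable (Q : hermitian_map R N M).
Local Notation D := (siegel Q Omega).

Definition nact (g : heis Q) (x : D) : D :=
  SigSub (mem_set (naff_siegel g (set_valP x))).

Lemma nactM g h x : nact (g * h)%g x = nact g (nact h x).
Proof. by apply: val_inj; rewrite /= naffM. Qed.

Lemma nact1 x : nact 1%g x = x.
Proof. by apply: val_inj; rewrite /= naff1. Qed.

Lemma nactVK g x : nact g (nact g^-1%g x) = x.
Proof. by rewrite -nactM mulgV nact1. Qed.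

(* The extension of f by 0 outside D is only a device: as D is open, its
   differentiability at a point of D depends only on f. *)
Definition holomorphic_on (W : set D) (f : D -> R[i]) : Prop :=
  forall x, W x -> differentiable ('valL_(0) f) (val x).

End GroupAction.

(* A family of fibres with an atlas of fibrewise linear trivializations having
   holomorphic transition functions t; only the triv i x with chart i x matter. *)
Record line_bundle (R : realType) (N M : nat) (Omega : set 'rV[R]_N)
    (Q : hermitian_map R N M) := LineBundle {
  fib :> siegel Q Omega -> lmodType R[i];
  atlas : Type;
  chart : atlas -> set (siegel Q Omega);
  triv : atlas -> forall x, {linear fib x -> R[i]^o};
  chart_open : forall i, open (chart i);
  chart_cover : forall x, exists i, chart i x;
  triv_bij : forall i x, chart i x -> bijective (triv i x);
  triv_holo : forall i j, exists2 t : siegel Q Omega -> R[i],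
    holomorphic_on (chart i `&` chart j) t &
    forall x, chart i x -> chart j x ->
      forall v, triv j x v = t x * triv i x v }.

Section TotalSpace.
Context {R : realType} {N M : nat} {Omega : set 'rV[R]_N}.
Context {Q : hermitian_map R N M}.
Variable (L : line_bundle Omega Q).
Local Notation D := (siegel Q Omega).

Record total := Total { tbase : D; tvec : L tbase }.

HB.instance Definition _ := gen_eqMixin total.
HB.instance Definition _ := gen_choiceMixin total.

(* The topology making each restriction L|_(chart i) -> chart i * C a
   homeomorphism onto an open piece. *)
Definition total_open : set (set total) :=
  [set O | forall i : atlas L, open [set p : D * R[i] | chart i p.1 /\
     exists2 v, triv i p.1 v = p.2 & O (Total v)]].

Fact total_openT : total_open setT.
Proof.
move=> i; rewrite (_ : [set _ | _] = fst @^-1` chart i).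
  by apply: open_comp; [move=> *; exact: cvg_fst | exact: chart_open].
apply/seteqP; split=> -[x c] /=; first by case.
move=> ix; split=> //; have [f _ fK] := triv_bij ix.
by exists (f c).
Qed.

Fact total_openI : setI_closed total_open.
Proof.
move=> A B oA oB i; have := openI (oA i) (oB i).
congr open; apply/seteqP; split=> -[x c] /=.
  move=> [[ix [v vc Av]] [_ [w wc Bw]]]; split=> //; exists v => //; split=> //.
  by have /bij_inj inj := triv_bij ix; rewrite (inj v w) // vc.
by move=> [ix [v vc [Av Bv]]]; split; split=> //; exists v.
Qed.

Fact total_open_bigU (I : Type) (f : I -> set total) :
  (forall i, total_open (f i)) -> total_open (\bigcup_i f i).
Proof.
move=> of_ i; have := bigcup_open (D := setT) (fun k _ => of_ k i).
congr open; apply/seteqP; split=> -[x c] /=.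
  by move=> [k _ /= [ix [v vc fv]]]; split=> //; exists v => //; exists k.
by move=> [ix [v vc [k _ fv]]]; exists k => //=; split=> //; exists v.
Qed.

HB.instance Definition _ :=
  isOpenTopological.Build total total_openT total_openI total_open_bigU.

Definition section : Type := forall x : D, L x.

Definition holomorphic_section : set section :=
  [set s | forall i : atlas L,
     holomorphic_on (chart i) (fun x => triv i x (s x))].

Definition graph (s : section) : {compact-open, D -> total} :=
  fun x => Total (s x).

End TotalSpace.

(* G acts continuously on the total space by holomorphic bundle automorphisms
   lifting nact (for a continuous action by holomorphic maps, smoothness is
   automatic).  nact (g * h) x and nact g (nact h x) are only propositionally
   equal, so the action axioms are equations in the total space. *)
Record equivariant_line_bundle (R : realType) (N M : nat)
    (Omega : set 'rV[R]_N) (Q : hermitian_map R N M) := EquivariantLineBundle {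
  bundle :> line_bundle Omega Q;
  bact : forall (g : heis Q) x, {linear bundle x -> bundle (nact g x)};
  bact1 : forall x (v : bundle x), Total (bact 1%g x v) = Total v;
  bactM : forall g h x (v : bundle x),
    Total (bact (g * h)%g x v) = Total (bact g (nact h x) (bact h x v));
  bact_continuous : continuous (fun p : heis Q * total bundle =>
    Total (bact p.1 (tbase p.2) (tvec p.2)));
  bact_holo : forall g (i j : atlas bundle), exists2 m : siegel Q Omega -> R[i],
    holomorphic_on (chart i `&` nact g @^-1` chart j) m &
    forall x, chart i x -> chart j (nact g x) ->
      forall v, triv j (nact g x) (bact g x v) = m x * triv i x v }.

Record hilbertType (R : realType) := HilbertType {
  hilbert_sort :> completeNormedModType R[i];
  inner : hilbert_sort -> hilbert_sort -> R[i];
  inner_linear : forall a u v w, inner (a *: u + v) w = a * inner u w + inner v w;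
  inner_conj : forall u v, inner v u = conjc (inner u v);
  inner_norm : forall v, inner v v = `|v| ^+ 2 }.

Section UnitaryRepresentations.
Context {R : realType} {N M : nat} (Q : hermitian_map R N M).

Record unitary_rep (V : hilbertType R) := UnitaryRep {
  rep :> heis Q -> V -> V;
  rep_linear : forall g a v w, rep g (a *: v + w) = a *: rep g v + rep g w;
  rep_inner : forall g v w, inner (rep g v) (rep g w) = inner v w;
  rep1 : forall v, rep 1%g v = v;
  repM : forall g h v, rep (g * h)%g v = rep g (rep h v);
  rep_continuous : forall v, continuous (rep ^~ v) }.

Definition irreducible_rep (V : hilbertType R) (pi : unitary_rep V) : Prop :=
  (exists v : V, v != 0) /\
  forall W : set V, closed W -> W 0 ->
    (forall (a : R[i]) v w, W v -> W w -> W (a *: v + w)) ->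
    (forall g v, W v -> W (pi g v)) ->
    W = [set 0] \/ W = setT.

End UnitaryRepresentations.

Section InvariantHilbertSubspaces.
Context {R : realType} {N M : nat} {Omega : set 'rV[R]_N}.
Context {Q : hermitian_map R N M}.
Variable (L : equivariant_line_bundle Omega Q).
Local Notation section := (section L).

(* (g s)(x) = g s(g^-1 x), transported to the fibre over x along
   nact g (nact g^-1 x) = x. *)
Definition sact (g : heis Q) (s : section) : section := fun x =>
  eq_rect _ (fun y => L y) (bact L g (nact g^-1%g x) (s (nact g^-1%g x)))
    x (nactVK g x).

Lemma sactE g s x :
  Total (sact g s x) = Total (bact L g (nact g^-1%g x) (s (nact g^-1%g x))).
Proof.
rewrite /sact; move: (bact L g _ _) (nactVK g x).
by move: (nact g _) => y v e; case: x / e.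
Qed.

(* H carries the inner product ip, of which only the values on H matter. *)
Definition irr_inv_hilbert_subspace (H : set section)
    (ip : section -> section -> R[i]) : Prop :=
  exists (V : hilbertType R) (pi : unitary_rep Q V) (T : V -> section),
    [/\ irreducible_rep pi,
        [/\ forall (a : R[i]) v w x, T (a *: v + w) x = a *: T v x + T w x,
            injective T,
            forall v, holomorphic_section (T v),
            continuous (fun v => graph (T v)) &
            forall g v, T (pi g v) = sact g (T v)],
        H = range T &
        forall v w, ip (T v) (T w) = inner v w].

Definition unitarily_equivalent (H1 : set section)
    (ip1 : section -> section -> R[i]) (H2 : set section)
    (ip2 : section -> section -> R[i]) : Prop :=
  exists A : section -> section,
    [/\ set_bij H1 H2 A,
        forall (a : R[i]) s t, H1 s -> H1 t ->
          A (fun x => a *: s x + t x) = (fun x => a *: A s x + A t x),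
        forall s t, H1 s -> H1 t -> ip2 (A s) (A t) = ip1 s t &
        forall g s, H1 s -> A (sact g s) = sact g (A s)].

Definition multiplicity_free : Prop :=
  forall (H1 : set section) (ip1 : section -> section -> R[i])
    (H2 : set section) (ip2 : section -> section -> R[i]),
  irr_inv_hilbert_subspace H1 ip1 -> irr_inv_hilbert_subspace H2 ip2 ->
  (H1 = H2 /\ exists2 c : R[i], 0 < c &
     forall s t, H1 s -> H1 t -> ip2 s t = c * ip1 s t) \/
  ~ unitarily_equivalent H1 ip1 H2 ip2.

End InvariantHilbertSubspaces.

(* Main.v *)
(* Let V be an irreducible unitary representation and T, S : V -> sections two
   intertwiners, T injective; the point is that S = c T.  By Schur's lemma the
   central elements n(a, 0) act on V by scalars, so the zero set of a section
   T v or S v is invariant under real translations of z, hence, by holomorphy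
   and convexity of Omega, under all displacements of z inside D(Omega, Q).
   Fix q0 = (i y0, 0) with y0 in Omega and let K, K' represent, in a
   trivialization at q0, the functionals v |-> T v(q0) and v |-> S v(q0).
   For u in C^M put p_w = q0 + w (0, u) and h(w) = S K(p_w) / T K(p_w).  Then
   (S - h(w) T) K vanishes at p_w; translating by g = n(0, - w u) gives
   <g K, K' - conj(h(w)) K> = 0, that is, T (K' - conj(h(w)) K) vanishes above
   - w u, and so conj(h(w)) = T K'(p_{-w}) / T K(p_{-w}) is holomorphic in w
   along with h(w).  Hence h is a constant c, the section (S - c T) K vanishes
   near q0 and therefore everywhere, and the kernel of S - c T is a nonzero
   closed invariant subspace of V.
   Unique continuation in one variable comes from a maximum principle: if F is
   a primitive (Goursat), |F|^2 exp(l / |w|^2) has no positive local maximum. *)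

Require Import Defs.
From mathcomp Require Import all_boot all_order all_algebra.
From mathcomp Require Import complex ring lra.
From mathcomp Require Import all_classical all_reals all_analysis.

Set Implicit Arguments.
Unset Strict Implicit.
Unset Printing Implicit Defensive.

Import Order.TTheory GRing.Theory Num.Theory.
Import numFieldNormedType.Exports.

Local Open Scope classical_set_scope.
Local Open Scope ring_scope.

(** Fibres over different points cannot be compared, so the action is used through zero sets: [g s]
    vanishes at [g x] exactly when [s] vanishes at [x]. This is why [h(w)] is met as the value that
    makes a section vanish, and why the transport lemmas speak of vanishing only. The passage from
    [w] to [-w] comes from unitarity, which moves [g] to the other side of the inner product as its
    inverse; the conjugate comes from the antilinear second argument. Complex differentiability at
    every point says nothing about continuity of the derivative, so Cauchy's theorem is proved by
    bisection, for pairs of real functions of two real variables. Unique continuation avoids power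
    series: passing to a primitive gains one order of differentiability, which gives the maximum
    principle its second derivatives. In Schur's lemma an operator square root takes the place of
    spectral projections: it decides the sign of a self-adjoint intertwiner. *)

Local Notation "x %:C" := (real_complex _ x) : ring_scope.

(** * Derivatives, antiderivatives and mean value bounds on the real line *)

Section OneVariable.
Context {R : realType}.
Implicit Types (f g : R -> R) (a b x y : R).

Lemma is_deriveP f x (l : R) : is_derive x (1 : R) f l <->
  forall e : R, 0 < e -> exists2 d : R, 0 < d & forall y, `|y - x| < d ->
    `|f y - f x - l * (y - x)| <= e * `|y - x|.
Proof.
split=> [[df dv] e e0|H].
  have : (fun h => h^-1 *: (f (h *: 1 + x) - f x)) @ 0^' --> l.
    by rewrite -dv; exact: df.
  move/cvgrPdist_le => /(_ e e0); rewrite /prop_near1 /= => -[d /= d0 Hd].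
  exists d => // y yd; have [->|yx] := eqVneq y x; first by rewrite !subrr !(mulr0,subr0,normr0).
  have yx0 : y - x != 0 by rewrite subr_eq0.
  have := Hd (y - x); rewrite /ball_ /= sub0r normrN => /(_ yd yx0).
  rewrite [_ *: 1]mulr1 subrK => H.
  have -> : f y - f x - l * (y - x) = - (l - (y - x)^-1 * (f y - f x)) * (y - x).
    by field.
  by rewrite normrM normrN ler_wpM2r.
have cv : (fun h => h^-1 *: (f (h *: 1 + x) - f x)) @ 0^' --> l.
  apply/cvgrPdist_le => e e0; have [d d0 Hd] := H e e0.
  exists d => // h; rewrite /ball_ /= sub0r normrN => hd h0.
  have := Hd (h + x); rewrite addrK => /(_ hd) Hh.
  rewrite [_ *: 1]mulr1.
  have -> : l - h^-1 *: (f (h + x) - f x) = - (h^-1 * (f (h + x) - f x - l * h)).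
    by rewrite /GRing.scale /=; field.
  rewrite normrN normrM normfV ler_pdivrMl ?normr_gt0//.
  by rewrite [leRHS]mulrC.
split; first by apply/cvg_ex; exists l.
exact: cvg_lim cv.
Qed.

Lemma antiderivative f a b : (forall x, a <= x <= b -> {for x, continuous f}) ->
  exists F : R -> R, forall x, a < x < b -> is_derive x (1 : R) F (f x).
Proof.
move=> cf.
exists (fun x => (\int[lebesgue_measure]_(t in [set` `[a, x]]) (f t))%R) => x /andP[ax xb].
have int : (@lebesgue_measure R).-integrable `[a, b] (EFin \o f).
  apply: continuous_compact_integrable; first exact: segment_compact.
  apply: continuous_in_subspaceT => y; rewrite inE /= in_itv /= => yab.
  exact: cf.
have [|d1 d2] := continuous_FTC1_closed xb int ax.
  by apply: cf; rewrite !ltW.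
by split; [exact: d1|rewrite -derive1E; exact: d2].
Qed.

(** The [min] and [max] spare the callers a case split: segments such as those from [w * s] to
    [w * (s + q)] reverse when [w < 0]. *)
Lemma mean_value_bound f df a b k :
  (forall x, Num.min a b <= x <= Num.max a b -> is_derive x (1 : R) f (df x)) ->
  (forall x, Num.min a b <= x <= Num.max a b -> `|df x| <= k) ->
  `|f b - f a| <= k * `|b - a|.
Proof.
wlog ab : a b / a <= b.
  move=> H; case: (leP a b) => [ab|/ltW ba].
    by move: (H a b ab); rewrite min_l// max_r.
  move: (H b a ba); rewrite min_l// max_r// => {}H; rewrite distrC [`|b - a|]distrC.
  exact: H.
rewrite min_l// max_r// => d bd.
have [x xab| |c cab ->] := MVT_segment ab (f := f) (df := df).
- by apply: d; move: xab; rewrite in_itv/= => /andP[/ltW-> /ltW->].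
- apply: continuous_in_subspaceT => y; rewrite inE /= in_itv /= => yab.
  apply: differentiable_continuous; apply/derivable1_diffP.
  by have [] := d _ yab.
- rewrite normrM ler_wpM2r//; apply: bd; by move: cab; rewrite in_itv.
Qed.

End OneVariable.

(** * Bisection of a square and Goursat's theorem for rectangles *)

Section Goursat.
Context {R : realType}.

(** The common point is the supremum of the left ends, which every right end bounds. *)
Lemma nested_segments (l e : nat -> R) : (forall n, 0 <= e n) ->
  (forall n, l n <= l n.+1) -> (forall n, l n.+1 + e n.+1 <= l n + e n) ->
  exists x, forall n, l n <= x <= l n + e n.
Proof.
move=> e0 li ui.
have lm n m : l n <= l (n + m)%N.
  by elim: m => [|m IH]; rewrite ?addn0// addnS (le_trans IH).
have um n m : l (n + m)%N + e (n + m)%N <= l n + e n.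
  by elim: m => [|m IH]; rewrite ?addn0// addnS (le_trans _ IH).
have lu n m : l m <= l n + e n.
  have := lm m n; have := um n m; rewrite addnC => h1 h2.
  by have := e0 (m + n)%N; lra.
exists (sup (range l)) => n; apply/andP; split.
  apply: ub_le_sup; last by exists n.
  by exists (l 0%N + e 0%N) => _ [m _ <-].
apply: ge_sup; first by exists (l 0%N); exists 0%N.
by move=> _ [m _ <-].
Qed.

(** [Bad n s t] concerns the square of side [2^-n] with lower left corner [(s, t)], and the booleans
    select one of its quarters. Confinement to the unit square keeps later estimates inside the
    domain. *)
Lemma bisection (Bad : nat -> R -> R -> Prop) :
  (forall n s t, Bad n s t -> exists i j : bool,
     Bad n.+1 (s + i%:R * 2^-1 ^+ n.+1) (t + j%:R * 2^-1 ^+ n.+1)) ->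
  Bad 0%N 0 0 ->
  exists s t, forall n, exists s' t', [/\ Bad n s' t',
    0 <= s' /\ s' + 2^-1 ^+ n <= 1, 0 <= t' /\ t' + 2^-1 ^+ n <= 1,
    s' <= s <= s' + 2^-1 ^+ n & t' <= t <= t' + 2^-1 ^+ n].
Proof.
move=> step bad0.
have /choice[f Hf] : forall np : nat * (R * R), exists q : R * R,
    Bad np.1 np.2.1 np.2.2 -> Bad np.1.+1 q.1 q.2 /\
    ((np.2.1 <= q.1 /\ q.1 + 2^-1 ^+ np.1.+1 <= np.2.1 + 2^-1 ^+ np.1) /\
     (np.2.2 <= q.2 /\ q.2 + 2^-1 ^+ np.1.+1 <= np.2.2 + 2^-1 ^+ np.1)).
  (* The default [(0, 0)] is harmless: the sequence starts from a bad square and stays among bad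
     squares. *)
  move=> [n [s t]] /=; have [b|nb] := pselect (Bad n s t); last by exists (0, 0).
  have [i [j b']] := step _ _ _ b.
  exists (s + i%:R * 2^-1 ^+ n.+1, t + j%:R * 2^-1 ^+ n.+1) => _; split=> //=.
  have : 0 <= (2^-1 : R) ^+ n by rewrite exprn_ge0.
  rewrite exprS; set q := _ ^+ n => q0.
  by case: {b'} i; case: j; rewrite ?mul1r ?mul0r; repeat split; lra.
pose u n := iteri n (fun n p => f (n, p)) (0, 0).
have bad n : Bad n (u n).1 (u n).2.
  by elim: n => // n IH; have [] := Hf (n, u n) IH.
have mono n := (Hf (n, u n) (bad n)).2.
have pos n : 0 <= (2^-1 : R) ^+ n by rewrite exprn_ge0.
have [s Hs] := nested_segments pos (fun n => (mono n).1.1) (fun n => (mono n).1.2).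
have [t Ht] := nested_segments pos (fun n => (mono n).2.1) (fun n => (mono n).2.2).
have in01 n : (0 <= (u n).1 /\ (u n).1 + 2^-1 ^+ n <= 1) /\
              (0 <= (u n).2 /\ (u n).2 + 2^-1 ^+ n <= 1).
  elim: n => [|n IH]; first by rewrite /= expr0 !add0r !lexx.
  by have [[] [] [] []] := (mono n, IH); rewrite /= => *; repeat split; lra.
exists s, t => n; exists (u n).1, (u n).2.
by have [? ?] := in01 n; split => //; [exact: Hs | exact: Ht].
Qed.

(** Frechet differentiability at one point, with gradient [(A, B)] and distances in the l1 norm. *)
Definition has_differential (P : R -> R -> R) (a b A B : R) : Prop :=
  forall e : R, 0 < e -> exists2 d : R, 0 < d & forall x y,
    `|x - a| < d -> `|y - b| < d ->
    `|P x y - P a b - A * (x - a) - B * (y - b)| <= e * (`|x - a| + `|y - b|).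

Lemma ler_norm_subr (x y k : R) : `|x| <= k -> `|y| <= k -> `|x - y| <= 2 * k.
Proof.
by move=> xk yk; rewrite mulr_natl mulr2n (le_trans (ler_normB _ _))// lerD.
Qed.

Lemma ler_norm_segment (x y r : R) : `|x| < r -> `|y| < r ->
  forall z, Num.min x y <= z <= Num.max x y -> `|z| < r.
Proof.
rewrite !ltr_norml => /andP[? ?] /andP[? ?] z.
rewrite ge_min le_max => /andP[/orP z1 /orP z2].
by rewrite ltr_norml; case: z1; case: z2 => ? ?; apply/andP; split; lra.
Qed.

Lemma scaled_segment_dist (v p0 p q : R) : 0 <= q -> p0 <= p -> p <= p0 + q ->
  forall x, Num.min (v * p0) (v * (p0 + q)) <= x <= Num.max (v * p0) (v * (p0 + q)) ->
  `|x - v * p| <= `|v| * q.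
Proof.
move=> q0 pp1 pp2 x; have pq : p0 <= p0 + q by rewrite lerDl.
have [v0|/ltW v0] := leP 0 v.
  have := ler_wpM2l v0 pq; have := ler_wpM2l v0 pp1; have := ler_wpM2l v0 pp2.
  move=> h1 h2 h3; rewrite min_l// max_r// (ger0_norm v0) ler_norml.
  move: h1; rewrite mulrDr => h1 /andP[h4 h5].
  by apply/andP; split; lra.
have := ler_wnM2l v0 pq; have := ler_wnM2l v0 pp1; have := ler_wnM2l v0 pp2.
move=> h1 h2 h3; rewrite min_r// max_l// (ler0_norm v0) ler_norml.
move: h1; rewrite mulrDr => h1 /andP[h4 h5].
by apply/andP; split; lra.
Qed.

(** The shared number [B] says that [P dx + Q dy] is closed at each point, and the conclusion
    equates its integrals along two sides of a rectangle and along the other two. A nonzero boundary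
    integral would keep at least a quarter of its size on some quarter; near the limit point the
    linear part of the form integrates to 0 and the remainder is too small. *)
Lemma goursat (P Q F G : R -> R -> R) (r : R) :
  (forall a b, `|a| < r -> `|b| < r -> exists A B D,
     has_differential P a b A B /\ has_differential Q a b B D) ->
  (forall x y : R, `|x| < r -> `|y| < r -> is_derive x (1 : R) (F^~ y) (P x y)) ->
  (forall x y : R, `|x| < r -> `|y| < r -> is_derive y (1 : R) (G x) (Q x y)) ->
  forall w h, `|w| < r -> `|h| < r ->
  F w h - F 0 h + G 0 h - G 0 0 = F w 0 - F 0 0 + G w h - G w 0.
Proof.
move=> dPQ dF dG w h wr hr.
(* [I a b c d] is the integral of [P dx + Q dy] along the boundary of
   [[a, b] x [c, d]]. *)
pose I a b c d := F b c - F a c + G b d - G b c - (F b d - F a d) - (G a d - G a c).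
suff : I 0 w 0 h = 0 by rewrite /I; lra.
(* Squares of the unit square are scaled by [w] and [h], so reversed and degenerate rectangles need
   no separate treatment. *)
pose J n s t := I (w * s) (w * (s + 2^-1 ^+ n)) (h * t) (h * (t + 2^-1 ^+ n)).
pose k := `|I 0 w 0 h|.
pose Bad n s t := k * (2^-1 ^+ n) ^+ 2 <= `|J n s t|.
have k0 : 0 <= k by exact: normr_ge0.
have [n s t bad||s [t st]] := @bisection Bad.
- suff : exists i j : bool,
    k * (2^-1 ^+ n.+1) ^+ 2 <= `|J n.+1 (s + i%:R * 2^-1 ^+ n.+1) (t + j%:R * 2^-1 ^+ n.+1)| by [].
  move: bad; rewrite /Bad.
  have -> : J n s t = J n.+1 s t + J n.+1 (s + 2^-1 ^+ n.+1) t
     + J n.+1 s (t + 2^-1 ^+ n.+1) + J n.+1 (s + 2^-1 ^+ n.+1) (t + 2^-1 ^+ n.+1).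
    rewrite /J; have -> : 2^-1 ^+ n = 2^-1 ^+ n.+1 + 2^-1 ^+ n.+1 :> R.
      by rewrite exprS; lra.
    by rewrite !addrA /I; ring.
  have -> : (2^-1 ^+ n) ^+ 2 = 4 * (2^-1 ^+ n.+1) ^+ 2 :> R by rewrite (exprS _ n); field.
  set K := k * _ ^+ 2; rewrite mulrCA -/K => b4.
  apply: contrapT => H.
  have small (i j : bool) : `|J n.+1 (s + i%:R * 2^-1 ^+ n.+1) (t + j%:R * 2^-1 ^+ n.+1)| < K.
    by rewrite ltNge; apply/negP => h'; apply: H; exists i, j.
  have := small false false; have := small true false; have := small false true.
  have := small true true; rewrite !mul1r !mul0r !addr0 => h1 h2 h3 h4.
  move: b4; apply/negP; rewrite -ltNge.
  apply: le_lt_trans (ler_normD _ _) _.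
  set x4 := `|J _ (_ + _) (_ + _)| in h1 *.
  have : `|J n.+1 s t + J n.+1 (s + 2^-1 ^+ n.+1) t + J n.+1 s (t + 2^-1 ^+ n.+1)| <=
    `|J n.+1 s t| + `|J n.+1 (s + 2^-1 ^+ n.+1) t| + `|J n.+1 s (t + 2^-1 ^+ n.+1)|.
    by apply: le_trans (ler_normD _ _) _; rewrite lerD2r ler_normD.
  lra.
- by rewrite /Bad /J expr0 !mulr0 !add0r !mulr1 expr1n mulr1 /k.
(* The constant is independent of [e], so [k <= m * e] for every [e] forces [k = 0]. *)
have [m Hm] : exists m, forall e : R, 0 < e -> k <= m * e.
  exists (2 * (`|w| + `|h|) ^+ 2) => e e0.
  have [s0 [t0 [_ [s01 s02] [t01 t02] /andP[s1 s2] /andP[t1 t2]]]] := st 0%N.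
  move: s02 t02 s2 t2; rewrite expr0 => s02 t02 s2 t2.
  have in_r (v q : R) : `|v| < r -> 0 <= q <= 1 -> `|v * q| < r.
    move=> vr /andP[q0 q1]; rewrite normrM (ger0_norm q0).
    by apply: le_lt_trans vr; rewrite ler_piMr.
  have s_in : 0 <= s <= 1 by apply/andP; split; lra.
  have t_in : 0 <= t <= 1 by apply/andP; split; lra.
  have [A [B [D [dP dQ]]]] := dPQ _ _ (in_r _ _ wr s_in) (in_r _ _ hr t_in).
  have [d1 d10 Hd1] := dP e e0; have [d2 d20 Hd2] := dQ e e0.
  pose d := Num.min d1 d2.
  have d0 : 0 < d by rewrite /d lt_min d10.
  have [n Hn] : exists n, (`|w| + `|h|) * 2^-1 ^+ n < d.
    have : (fun n => (`|w| + `|h|) * 2^-1 ^+ n) @ \oo --> (0 : R).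
      rewrite -[X in _ --> X](mulr0 (`|w| + `|h|)); apply: cvgMr.
      by apply: cvg_expr; rewrite ger0_norm; lra.
    move/cvgrPdist_lt => /(_ _ d0) [n _ /(_ n (leqnn n))].
    rewrite sub0r normrN ger0_norm; first by exists n.
    by rewrite mulr_ge0 ?addr_ge0 ?exprn_ge0.
  have [s' [t' [bad [s'0 s'1] [t'0 t'1] /andP[s's ss'] /andP[t't tt']]]] := st n.
  move: bad; rewrite /Bad /J; set q := 2^-1 ^+ n in s'1 t'1 ss' tt' Hn *.
  have q0 : 0 < q by rewrite exprn_gt0.
  set X0 := w * s'; set X1 := w * (s' + q); set Y0 := h * t'; set Y1 := h * (t' + q).
  have cx := @scaled_segment_dist w s' s q (ltW q0) s's ss'.
  have cy := @scaled_segment_dist h t' t q (ltW q0) t't tt'.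
  have minin (x y z : R) : (z = x) \/ (z = y) -> Num.min x y <= z <= Num.max x y.
    by case=> ->; rewrite ge_min le_max !lexx ?orbT.
  have q1 (v : R) : 0 <= v -> v + q <= 1 -> (0 <= v <= 1) /\ (0 <= v + q <= 1).
    by move: q0; clear => *; split; apply/andP; split; lra.
  have [s'i s'qi] := q1 _ s'0 s'1; have [t'i t'qi] := q1 _ t'0 t'1.
  have inx := ler_norm_segment (in_r _ _ wr s'i) (in_r _ _ wr s'qi).
  have iny := ler_norm_segment (in_r _ _ hr t'i) (in_r _ _ hr t'qi).
  have w0 : 0 <= `|w| * q by rewrite mulr_ge0// ltW.
  have h0 : 0 <= `|h| * q by rewrite mulr_ge0// ltW.
  have [wq1 wq2 hq1 hq2] : [/\ `|w| * q < d1, `|w| * q < d2, `|h| * q < d1 & `|h| * q < d2].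
    by move: Hn w0 h0; rewrite mulrDl /d lt_min; clear => /andP[? ?] *; split; lra.
  have bP (x y : R) : Num.min X0 X1 <= x <= Num.max X0 X1 -> Num.min Y0 Y1 <= y <= Num.max Y0 Y1 ->
    `|P x y - P (w * s) (h * t) - A * (x - w * s) - B * (y - h * t)| <= e * ((`|w| + `|h|) * q).
    move=> /cx xx /cy yy; apply: le_trans (Hd1 _ _ _ _) _.
    + exact: le_lt_trans xx _.
    + exact: le_lt_trans yy _.
    + by rewrite ler_pM2l// mulrDl lerD.
  have bQ (x y : R) : Num.min X0 X1 <= x <= Num.max X0 X1 -> Num.min Y0 Y1 <= y <= Num.max Y0 Y1 ->
    `|Q x y - Q (w * s) (h * t) - B * (x - w * s) - D * (y - h * t)| <= e * ((`|w| + `|h|) * q).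
    move=> /cx xx /cy yy; apply: le_trans (Hd2 _ _ _ _) _.
    + exact: le_lt_trans xx _.
    + exact: le_lt_trans yy _.
    + by rewrite ler_pM2l// mulrDl lerD.
  have X0in : Num.min X0 X1 <= X0 <= Num.max X0 X1 by apply: minin; left.
  have X1in : Num.min X0 X1 <= X1 <= Num.max X0 X1 by apply: minin; right.
  have Y0in : Num.min Y0 Y1 <= Y0 <= Num.max Y0 Y1 by apply: minin; left.
  have Y1in : Num.min Y0 Y1 <= Y1 <= Num.max Y0 Y1 by apply: minin; right.
  set m := (`|w| + `|h|) * q in bP bQ Hn.
  (* Subtracting [B * (Y1 - Y0) * x] removes the linear part of [P x Y1 - P x Y0], leaving two
     remainders. The correction in [est2] is also [B * (X1 - X0) * (Y1 - Y0)], so the two cancel in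
     [I]. *)
  have est1 : `|(F X1 Y1 - F X1 Y0 - B * (Y1 - Y0) * X1) - (F X0 Y1 - F X0 Y0 - B * (Y1 - Y0) * X0)|
     <= 2 * e * m * `|X1 - X0|.
    apply: (@mean_value_bound _ (fun x => F x Y1 - F x Y0 - B * (Y1 - Y0) * x)
       (fun x => P x Y1 - P x Y0 - B * (Y1 - Y0))) => x xx.
      have dF1 := dF x Y1 (inx _ xx) (iny _ Y1in).
      have dF0 := dF x Y0 (inx _ xx) (iny _ Y0in).
      apply: is_derive_eq; first by rewrite /GRing.scale /=; ring.
    rewrite -mulrA; apply: le_trans (ler_norm_subr (bP x Y1 xx Y1in) (bP x Y0 xx Y0in)).
    by rewrite le_eqVlt; apply/orP; left; apply/eqP; congr `|_|; ring.
  have est2 : `|(G X1 Y1 - G X0 Y1 - B * (X1 - X0) * Y1) - (G X1 Y0 - G X0 Y0 - B * (X1 - X0) * Y0)|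
     <= 2 * e * m * `|Y1 - Y0|.
    apply: (@mean_value_bound _ (fun y => G X1 y - G X0 y - B * (X1 - X0) * y)
       (fun y => Q X1 y - Q X0 y - B * (X1 - X0))) => y yy.
      have dG1 := dG X1 y (inx _ X1in) (iny _ yy).
      have dG0 := dG X0 y (inx _ X0in) (iny _ yy).
      apply: is_derive_eq; first by rewrite /GRing.scale /=; ring.
    rewrite -mulrA; apply: le_trans (ler_norm_subr (bQ X1 y X1in yy) (bQ X0 y X0in yy)).
    by rewrite le_eqVlt; apply/orP; left; apply/eqP; congr `|_|; ring.
  have lX : `|X1 - X0| = `|w| * q by rewrite /X1 /X0 -mulrBr addrC addKr normrM (gtr0_norm q0).
  have lY : `|Y1 - Y0| = `|h| * q by rewrite /Y1 /Y0 -mulrBr addrC addKr normrM (gtr0_norm q0).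
  rewrite lX in est1; rewrite lY in est2 => bad.
  have : `|I X0 X1 Y0 Y1| <= 2 * e * m * m.
    have -> : 2 * e * m * m = 2 * e * m * (`|h| * q) + 2 * e * m * (`|w| * q).
      by rewrite -mulrDr -mulrDl addrC.
    have -> : I X0 X1 Y0 Y1 = (G X1 Y1 - G X0 Y1 - B * (X1 - X0) * Y1 - (G X1 Y0 - G X0 Y0 - B * (X1 - X0) * Y0)) - (F X1 Y1 - F X1 Y0 - B * (Y1 - Y0) * X1 - (F X0 Y1 - F X0 Y0 - B * (Y1 - Y0) * X0)).
      by rewrite /I; ring.
    exact: le_trans (ler_normB _ _) (lerD est2 est1).
  move/(le_trans bad); rewrite /m.
  have -> : 2 * e * ((`|w| + `|h|) * q) * ((`|w| + `|h|) * q) = (2 * (`|w| + `|h|) ^+ 2 * e) * q ^+ 2 by ring.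
  by rewrite ler_pM2r// exprn_gt0.
apply/eqP; rewrite -normr_le0 -/k leNgt; apply/negP => kpos.
have m0 : 0 < m by have := Hm 1 ltr01; lra.
have := Hm (k / (2 * m)); rewrite divr_gt0 ?mulr_gt0// => /(_ isT).
have -> : m * (k / (2 * m)) = k / 2 by field; rewrite gt_eqF.
lra.
Qed.

End Goursat.

(** * First and second order conditions at a maximum *)

Section MaximumPrinciple.
Context {R : realType}.

Lemma is_derive_near (f g : R -> R) (x l d : R) : 0 < d ->
  (forall y, `|y - x| < d -> f y = g y) ->
  is_derive x (1 : R) f l -> is_derive x (1 : R) g l.
Proof.
move=> d0 fg /is_deriveP H; apply/is_deriveP => e e0.
have [d' d'0 H'] := H e e0; exists (Num.min d d'); first by rewrite lt_min d0.
move=> y; rewrite lt_min => /andP[yd yd']; rewrite -!fg ?H'//.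
by rewrite subrr normr0.
Qed.

Lemma is_derive_unique (f : R -> R) (x l l' : R) :
  is_derive x (1 : R) f l -> is_derive x (1 : R) f l' -> l = l'.
Proof. by move=> [_ <-] [_ <-]. Qed.

(** If [h > 0], then [g], which is 0 at [a], is positive just to the right of [a], and the mean
    value theorem lifts [f] above [f a]. *)
Lemma second_derivative_max (f g : R -> R) (a h d : R) : 0 < d ->
  (forall x : R, `|x - a| < d -> is_derive x (1 : R) f (g x)) ->
  is_derive a (1 : R) g h -> (forall x, `|x - a| < d -> f x <= f a) ->
  g a = 0 /\ h <= 0.
Proof.
move=> d0 df dg fmax.
have itvE t : (t \in `]a - d, a + d[) = (`|t - a| < d).
  by rewrite in_itv /= ltr_distl.
have ga : g a = 0.
  apply: (@is_derive_unique f a); first by apply: df; rewrite subrr normr0.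
  apply: (@derive1_at_max _ f (a - d) (a + d)).
  - lra.
  - by move=> t; rewrite itvE => /df[].
  - by rewrite itvE subrr normr0.
  - by move=> t; rewrite itvE; exact: fmax.
split=> //; rewrite leNgt; apply/negP => h0.
(* Precision [h / 2] still gives [g c >= h * (c - a) / 2 > 0] for [c] slightly above [a]. *)
move/is_deriveP : dg => /(_ (h / 2)); rewrite divr_gt0// => /(_ isT)[d' d'0 Hd'].
pose y := a + Num.min d d' / 2.
have m0 : 0 < Num.min d d' by rewrite lt_min d0.
have ay : a < y by rewrite /y; lra.
have small c : a < c <= y -> `|c - a| < d /\ `|c - a| < d'.
  move=> /andP[ac cy]; rewrite ger0_norm; last lra.
  have : c - a < Num.min d d' by move: cy; rewrite /y; lra.
  by rewrite lt_min => /andP[].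
have [c cay||c] := @MVT R f g a y ay.
- apply: df; move: cay; rewrite in_itv /= => /andP[ac cy].
  by have [] := small c; rewrite // ac ltW.
- apply: continuous_in_subspaceT => c; rewrite inE /= in_itv /= => /andP[ac cy].
  apply: differentiable_continuous; apply/derivable1_diffP.
  suff : `|c - a| < d by move=> /df[].
  move: ac; rewrite le_eqVlt => /predU1P[<-|ac]; first by rewrite subrr normr0.
  by have [] := small c; rewrite // ac.
- rewrite in_itv /= => /andP[ac cy] fE.
  have [cd cd'] : `|c - a| < d /\ `|c - a| < d' by apply: small; rewrite ac ltW.
  have [yd _] : `|y - a| < d /\ `|y - a| < d' by apply: small; rewrite ay lexx.
  have := Hd' c cd'; rewrite ga subr0 ler_norml => /andP[+ _].
  rewrite ger0_norm; last lra.
  have := fmax y yd => fy g1.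
  have hc : 0 < h * (c - a) by rewrite mulr_gt0 ?subr_gt0.
  have gc : 0 < g c by lra.
  have : 0 < g c * (y - a) by rewrite mulr_gt0 ?subr_gt0.
  lra.
Qed.

(** Both conditions have the positive factor [expR (t a)] divided out, and the second is shortened
    by means of the first. *)
Lemma weighted_max (n n1 t t1 : R -> R) (n2 t2 a d : R) : 0 < d ->
  (forall x : R, `|x - a| < d -> is_derive x (1 : R) n (n1 x)) ->
  is_derive a (1 : R) n1 n2 ->
  (forall x : R, `|x - a| < d -> is_derive x (1 : R) t (t1 x)) ->
  is_derive a (1 : R) t1 t2 ->
  (forall x, `|x - a| < d -> n x * expR (t x) <= n a * expR (t a)) ->
  n1 a + n a * t1 a = 0 /\ n2 + n1 a * t1 a + n a * t2 <= 0.
Proof.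
move=> d0 dn dn1 dt dt1 fmax.
have dE x : `|x - a| < d -> is_derive x (1 : R) (fun x => expR (t x)) (t1 x * expR (t x)).
  move=> xa; have dtx := dt x xa.
  by apply: is_derive_eq; rewrite mulrC.
have dm x : `|x - a| < d -> is_derive x (1 : R) (fun x => n x * expR (t x))
    ((n1 x + n x * t1 x) * expR (t x)).
  move=> xa; have dnx := dn x xa; have dEx := dE x xa.
  by apply: is_derive_eq; rewrite /GRing.scale /=; ring.
have aa : `|a - a| < d by rewrite subrr normr0.
have dna := dn a aa; have dEa := dE a aa.
have dm1 : is_derive a (1 : R) (fun x => (n1 x + n x * t1 x) * expR (t x))
    ((n2 + (n1 a * t1 a + n a * t2) + (n1 a + n a * t1 a) * t1 a) * expR (t a)).
  by apply: is_derive_eq; rewrite /GRing.scale /=; ring.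
have [m1 m2] := second_derivative_max d0 dm dm1 fmax.
have Epos := expR_gt0 (t a).
have E1 : n1 a + n a * t1 a = 0.
  by move/eqP : m1; rewrite mulf_eq0 (gt_eqF Epos) orbF => /eqP.
split=> //; move: m2; rewrite E1 mul0r addr0 pmulr_lle0//.
by rewrite addrA.
Qed.

Lemma inv_sqr_derive (l b x : R) : x ^+ 2 + b ^+ 2 != 0 ->
  is_derive x (1 : R) (fun x => l * (x ^+ 2 + b ^+ 2)^-1)
    (- (2 * l * x) * (x ^+ 2 + b ^+ 2) ^- 2) /\
  is_derive x (1 : R) (fun x => - (2 * l * x) * (x ^+ 2 + b ^+ 2) ^- 2)
    (- (2 * l) * (x ^+ 2 + b ^+ 2) ^- 2 + 8 * l * x ^+ 2 * (x ^+ 2 + b ^+ 2) ^- 3).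
Proof.
move=> k0.
have dk : is_derive x (1 : R) (fun x => x ^+ 2 + b ^+ 2) (2 * x).
  by apply: is_derive_eq; rewrite /GRing.scale /=; ring.
have dk2 : is_derive x (1 : R) (fun x => (x ^+ 2 + b ^+ 2) ^+ 2) (2 * (x ^+ 2 + b ^+ 2) * (2 * x)).
  by apply: is_derive_eq; rewrite /GRing.scale /=; ring.
have dV := @is_deriveV R (fun x => x ^+ 2 + b ^+ 2) x _ 1 k0 dk.
have k20 : (x ^+ 2 + b ^+ 2) ^+ 2 != 0 by rewrite expf_neq0.
have dV2 := @is_deriveV R (fun x => (x ^+ 2 + b ^+ 2) ^+ 2) x _ 1 k20 dk2.
split.
  by apply: is_derive_eq; rewrite /GRing.scale /=; field.
apply: is_derive_eq; rewrite /GRing.scale /=; field.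
exact: k0.
Qed.

End MaximumPrinciple.

(** * Real and imaginary parts of holomorphic functions, and their primitives *)

Section HolomorphicPairs.
Context {R : realType}.

Lemma has_differential_continuous (P : R -> R -> R) a b A B :
  has_differential P a b A B -> forall e : R, 0 < e ->
  exists2 d : R, 0 < d & forall x y, `|x - a| < d -> `|y - b| < d ->
  `|P x y - P a b| < e.
Proof.
move=> dP e e0; have [d d0 Hd] := dP 1 ltr01.
pose k := 1 + `|A| + `|B|.
have k0 : 0 < k by rewrite /k -addrA ltr_pwDl ?addr_ge0.
pose d' := Num.min d (e / (2 * k)).
exists d'; first by rewrite lt_min d0 divr_gt0 ?mulr_gt0.
move=> x y; rewrite !lt_min => /andP[xd xe] /andP[yd ye].
have := Hd x y xd yd; rewrite mul1r => H.
have -> : P x y - P a b = (P x y - P a b - A * (x - a) - B * (y - b)) + (A * (x - a) + B * (y - b)).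
  by ring.
apply: le_lt_trans (ler_normD _ _) _.
have h1 : `|A * (x - a) + B * (y - b)| <= `|A| * `|x - a| + `|B| * `|y - b|.
  by rewrite -!normrM ler_normD.
apply: (@le_lt_trans _ _ (k * (`|x - a| + `|y - b|))).
  rewrite /k; have := normr_ge0 A; have := normr_ge0 B.
  have := normr_ge0 (x - a); have := normr_ge0 (y - b).
  move: H h1; set p := `|A|; set q := `|B|; set s := `|x - a|; set t := `|y - b|.
  clear => *; have : 0 <= p * t by rewrite mulr_ge0.
  have : 0 <= q * s by rewrite mulr_ge0.
  lra.
have -> : e = k * (2 * (e / (2 * k))) by field; rewrite gt_eqF.
by rewrite ltr_pM2l// mulr_natl mulr2n ltrD.
Qed.

Lemma has_differential_derive (P : R -> R -> R) a b A B :
  has_differential P a b A B ->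
  is_derive a (1 : R) (P^~ b) A /\ is_derive b (1 : R) (P a) B.
Proof.
move=> dP; split; apply/is_deriveP => e e0; have [d d0 Hd] := dP e e0; exists d => // y yd.
  by have := Hd y b yd; rewrite !subrr normr0 mulr0 subr0 addr0 => /(_ d0).
by have := Hd a y; rewrite !subrr normr0 mulr0 subr0 add0r => /(_ d0 yd).
Qed.

Lemma is_derive_continuous (f : R -> R) (x l : R) :
  is_derive x (1 : R) f l -> {for x, continuous f}.
Proof. by move=> [d _]; apply: differentiable_continuous; apply/derivable1_diffP. Qed.

(** [U] integrates along the horizontal axis and then vertically; by [goursat] the other order gives
    the same value. Each partial derivative is read from the path whose last leg has that direction.
    The loss from [r] to [s] gives continuity on the closed segments that [antiderivative]
    requires. *)
Lemma closed_form_primitive (P Q : R -> R -> R) (r s : R) : s < r ->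
  (forall a b, `|a| < r -> `|b| < r -> exists A B D,
     has_differential P a b A B /\ has_differential Q a b B D) ->
  exists U : R -> R -> R, [/\ U 0 0 = 0,
    forall x y : R, `|x| < s -> `|y| < s -> is_derive x (1 : R) (U^~ y) (P x y) &
    forall x y : R, `|x| < s -> `|y| < s -> is_derive y (1 : R) (U x) (Q x y)].
Proof.
move=> sr dPQ.
have sI (x : R) : - s <= x <= s -> `|x| < r by rewrite -ler_norml => /le_lt_trans; apply.
have /choice[F HF] : forall y : R, exists F : R -> R, `|y| < s ->
    forall x : R, `|x| < s -> is_derive x (1 : R) F (P x y).
  move=> y; have [ys|] := boolP (`|y| < s); last by exists (fun=> 0).
  have [|F HF] := @antiderivative _ (P^~ y) (- s) s.
    move=> x /sI xr; have [A [B [D [dP _]]]] := dPQ x y xr (lt_trans ys sr).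
    exact: is_derive_continuous (has_differential_derive dP).1.
  by exists F => _ x; rewrite ltr_norml; exact: HF.
have /choice[G HG] : forall x : R, exists G : R -> R, `|x| < s ->
    forall y : R, `|y| < s -> is_derive y (1 : R) G (Q x y).
  move=> x; have [xs|] := boolP (`|x| < s); last by exists (fun=> 0).
  have [|G HG] := @antiderivative _ (Q x) (- s) s.
    move=> y /sI yr; have [A [B [D [_ dQ]]]] := dPQ x y (lt_trans xs sr) yr.
    exact: is_derive_continuous (has_differential_derive dQ).2.
  by exists G => _ y; rewrite ltr_norml; exact: HG.
pose U x y := F 0 x - F 0 0 + G x y - G x 0.
have UE x y : `|x| < s -> `|y| < s -> U x y = F y x - F y 0 + G 0 y - G 0 0.
  move=> xs ys; rewrite /U.
  symmetry; apply: (@goursat _ P Q (fun x y => F y x) G s) => //.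
  - by move=> a b a_s b_s; apply: dPQ; apply: lt_trans sr.
  - by move=> *; exact: HF.
  - by move=> *; exact: HG.
exists U; split.
- by rewrite /U !subrr add0r subrr.
- move=> x y xs ys.
  apply: (@is_derive_near _ (fun x => F y x - F y 0 + G 0 y - G 0 0) _ _ _ (s - `|x|)).
  + by rewrite subr_gt0.
  + move=> z zx; rewrite UE//.
    by have := ler_normD (z - x) x; rewrite subrK; lra.
  + have dF := HF y ys x xs.
    by apply: is_derive_eq; rewrite ?subr0 ?addr0.
- move=> x y xs ys; have dG := HG x xs y ys.
  move/is_deriveP : dG => dG; apply/is_deriveP => e /dG[d d0 H]; exists d => // z /H.
  by congr (`|_| <= _); rewrite /U; ring.
Qed.

(* [holo_at u v a b A B]: the function [u + i v] of [x + i y] has the complex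
   derivative [A + i B] at [a + i b]. *)
Definition holo_at (u v : R -> R -> R) (a b A B : R) : Prop :=
  has_differential u a b A (- B) /\ has_differential v a b B A.

Definition holo_on_square (u v : R -> R -> R) (r : R) : Prop :=
  forall a b, `|a| < r -> `|b| < r -> exists A B, holo_at u v a b A B.

(** With [f = u + i v], [f dz] is [(u dx - v dy) + i (v dx + u dy)], and the Cauchy-Riemann
    equations close both real forms. *)
Lemma holo_primitive (u v : R -> R -> R) (r s : R) : s < r ->
  holo_on_square u v r ->
  exists U V : R -> R -> R, [/\ U 0 0 = 0 /\ V 0 0 = 0,
    forall x y : R, `|x| < s -> `|y| < s -> is_derive x (1 : R) (U^~ y) (u x y) /\
      is_derive x (1 : R) (V^~ y) (v x y) &
    forall x y : R, `|x| < s -> `|y| < s -> is_derive y (1 : R) (U x) (- v x y) /\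
      is_derive y (1 : R) (V x) (u x y)].
Proof.
move=> sr huv.
have [a b ar br|U [U0 Ux Uy]] := @closed_form_primitive u (fun x y => - v x y) r s sr.
  have [A [B [du dv]]] := huv a b ar br; exists A, (- B), (- A); split=> //.
  move=> e e0; have [d d0 Hd] := dv e e0; exists d => // x y xa yb.
  apply: le_trans (Hd x y xa yb).
  by rewrite -normrN le_eqVlt; apply/orP; left; apply/eqP; congr `|_|; ring.
have [a b ar br|V [V0 Vx Vy]] := @closed_form_primitive v u r s sr.
  have [A [B [du dv]]] := huv a b ar br; exists B, A, (- B); split=> //.
by exists U, V; split=> // x y xs ys; split; [apply: Ux|apply: Vx|apply: Uy|apply: Vy].
Qed.

(** Partial derivatives alone do not give joint continuity; here [P] and [Q] are continuous at
    [(a, b)], hence bounded nearby, and [U] satisfies a Lipschitz estimate around that point. *)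
Lemma line_derivatives_continuous (U P Q : R -> R -> R) (s a b A B A' B' : R) :
  `|a| < s -> `|b| < s ->
  (forall x y : R, `|x| < s -> `|y| < s -> is_derive x (1 : R) (U^~ y) (P x y)) ->
  (forall x y : R, `|x| < s -> `|y| < s -> is_derive y (1 : R) (U x) (Q x y)) ->
  has_differential P a b A B -> has_differential Q a b A' B' ->
  {for (a, b), continuous (fun p : R * R => U p.1 p.2)}.
Proof.
move=> a_s b_s Ux Uy dP dQ.
have [d1 d10 H1] := has_differential_continuous dP ltr01.
have [d2 d20 H2] := has_differential_continuous dQ ltr01.
pose k := 1 + `|P a b| + `|Q a b|.
have k0 : 0 < k by rewrite /k -addrA ltr_pwDl ?addr_ge0.
apply/cvgrPdist_lt => e e0.
pose d := Num.min (Num.min d1 d2) (Num.min (Num.min (s - `|a|) (s - `|b|)) (e / (2 * k))).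
have d0 : 0 < d.
  by rewrite /d !lt_min d10 d20 !subr_gt0 a_s b_s /= divr_gt0 ?mulr_gt0.
exists (ball a d, ball b d); first by split; exact: nbhsx_ballx.
move=> [x y] [/= xa yb].
have {}xa : `|x - a| < d by rewrite distrC.
have {}yb : `|y - b| < d by rewrite distrC.
have seg (c z w d' : R) : `|z - c| < d' -> Num.min c z <= w <= Num.max c z -> `|w - c| < d'.
  move=> zc; rewrite ge_min le_max => /andP[/orP w1 /orP w2].
  by move: zc; clear -w1 w2; rewrite !ltr_distl => /andP[? ?]; case: w1; case: w2 => ? ?; apply/andP; split; lra.
have dd (w c : R) : `|w - c| < d -> [/\ `|w - c| < d1, `|w - c| < d2,
    `|w - c| < s - `|a|, `|w - c| < s - `|b| & `|w - c| < e / (2 * k)].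
  by rewrite /d !lt_min => /andP[/andP[? ?] /andP[/andP[? ?] ?]].
have [x1 x2 x3 _ x5] := dd _ _ xa; have [y1 y2 _ y4 y5] := dd _ _ yb.
have nD (w c t : R) : `|w - c| < t - `|c| -> `|w| < t.
  by have := ler_normD (w - c) c; rewrite subrK; lra.
have b1 : `|U x y - U a y| <= k * `|x - a|.
  apply: (@mean_value_bound _ (U^~ y) (P^~ y)) => w wI.
    have [_ _ w3 _ _] := dd _ _ (seg _ _ _ _ xa wI).
    by apply: Ux; [exact: nD w3|exact: nD y4].
  have [w1 _ _ _ _] := dd _ _ (seg _ _ _ _ xa wI).
  have := H1 w y w1 y1; have := ler_normD (P w y - P a b) (P a b); rewrite subrK /k.
  by have := normr_ge0 (Q a b); clear => *; lra.
have b2 : `|U a y - U a b| <= k * `|y - b|.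
  apply: (@mean_value_bound _ (U a) (Q a)) => w wI.
    have [_ _ _ w4 _] := dd _ _ (seg _ _ _ _ yb wI).
    by apply: Uy => //; exact: nD w4.
  have [_ w2 _ _ _] := dd _ _ (seg _ _ _ _ yb wI).
  have := H2 a w; rewrite subrr normr0 => /(_ d20 w2).
  have := ler_normD (Q a w - Q a b) (Q a b); rewrite subrK /k.
  by have := normr_ge0 (P a b); clear => *; lra.
rewrite distrC /= -(subrKA (U a y)).
apply: le_lt_trans (ler_normD _ _) _.
apply: le_lt_trans (lerD b1 b2) _; rewrite -mulrDr.
have -> : e = k * (2 * (e / (2 * k))) by field; rewrite gt_eqF.
by rewrite ltr_pM2l// mulr_natl mulr2n ltrD.
Qed.

End HolomorphicPairs.

(** * Unique continuation on a disc by a weighted maximum principle *)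

Section UniqueContinuation.
Context {R : realType}.

(* [|F|^2 exp (l / |w|^2)] has no positive local maximum: the logarithm of
   [|F|^2] is harmonic, while the Laplacian of [1 / |w|^2] is positive. *)
Lemma no_weighted_max (U V u v : R -> R -> R) (a b A B d l : R) : 0 < d -> 0 < l ->
  (forall x : R, `|x - a| < d -> is_derive x (1 : R) (U^~ b) (u x b) /\
     is_derive x (1 : R) (V^~ b) (v x b)) ->
  (forall y : R, `|y - b| < d -> is_derive y (1 : R) (U a) (- v a y) /\
     is_derive y (1 : R) (V a) (u a y)) ->
  holo_at u v a b A B ->
  (forall x, `|x - a| < d -> x ^+ 2 + b ^+ 2 != 0) ->
  (forall y, `|y - b| < d -> y ^+ 2 + a ^+ 2 != 0) ->
  (forall x, `|x - a| < d -> (U x b ^+ 2 + V x b ^+ 2) * expR (l * (x ^+ 2 + b ^+ 2)^-1) <=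
     (U a b ^+ 2 + V a b ^+ 2) * expR (l * (a ^+ 2 + b ^+ 2)^-1)) ->
  (forall y, `|y - b| < d -> (U a y ^+ 2 + V a y ^+ 2) * expR (l * (y ^+ 2 + a ^+ 2)^-1) <=
     (U a b ^+ 2 + V a b ^+ 2) * expR (l * (b ^+ 2 + a ^+ 2)^-1)) ->
  U a b ^+ 2 + V a b ^+ 2 <= 0.
Proof.
move=> d0 l0 dx dy [du dv] kx ky mx my.
have aa : `|a - a| < d by rewrite subrr normr0.
have bb : `|b - b| < d by rewrite subrr normr0.
have [ux uy] := has_differential_derive du; have [vx vy] := has_differential_derive dv.
have [Uxa Vxa] := dx a aa; have [Uyb Vyb] := dy b bb.
have [||||//|hx1 hx2] := @weighted_max _ (fun x => U x b ^+ 2 + V x b ^+ 2)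
  (fun x => 2 * (U x b * u x b + V x b * v x b))
  (fun x => l * (x ^+ 2 + b ^+ 2)^-1) (fun x => - (2 * l * x) * (x ^+ 2 + b ^+ 2) ^- 2)
  (2 * (u a b ^+ 2 + U a b * A + v a b ^+ 2 + V a b * B))
  (- (2 * l) * (a ^+ 2 + b ^+ 2) ^- 2 + 8 * l * a ^+ 2 * (a ^+ 2 + b ^+ 2) ^- 3) a d d0.
- move=> x xa; have [Ux Vx] := dx x xa.
  by apply: is_derive_eq; rewrite /GRing.scale /=; ring.
- by apply: is_derive_eq; rewrite /GRing.scale /=; ring.
- by move=> x /kx k0; exact: (inv_sqr_derive l k0).1.
- exact: (inv_sqr_derive l (kx a aa)).2.
have [||||//|hy1 hy2] := @weighted_max _ (fun y => U a y ^+ 2 + V a y ^+ 2)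
  (fun y => 2 * (V a y * u a y - U a y * v a y))
  (fun y => l * (y ^+ 2 + a ^+ 2)^-1) (fun y => - (2 * l * y) * (y ^+ 2 + a ^+ 2) ^- 2)
  (2 * (u a b ^+ 2 - V a b * B + v a b ^+ 2 - U a b * A))
  (- (2 * l) * (b ^+ 2 + a ^+ 2) ^- 2 + 8 * l * b ^+ 2 * (b ^+ 2 + a ^+ 2) ^- 3) b d d0.
- move=> y yb; have [Uy Vy] := dy y yb.
  by apply: is_derive_eq; rewrite /GRing.scale /=; ring.
- by apply: is_derive_eq; rewrite /GRing.scale /=; ring.
- by move=> y /ky k0; exact: (inv_sqr_derive l k0).1.
- exact: (inv_sqr_derive l (ky b bb)).2.
have k0 := kx a aa.
have kp : 0 < a ^+ 2 + b ^+ 2 by rewrite lt_neqAle eq_sym k0 addr_ge0 ?sqr_ge0.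
move: hx1 hx2 hy1 hy2; rewrite [b ^+ 2 + a ^+ 2]addrC.
set k := a ^+ 2 + b ^+ 2 in k0 kp *.
(* With the terms [-2 l k^-2] of the two axes this makes the Laplacian of the weight exponent
   [4 l k^-2 > 0]. *)
have kE : 8 * l * a ^+ 2 * k ^- 3 + 8 * l * b ^+ 2 * k ^- 3 = 8 * l * k ^- 2.
  by rewrite -mulrDl -mulrDr -/k; field.
move: kE; set ka := _ * k ^- 3; set kb := _ * k ^- 3 => kE.
set N := U a b ^+ 2 + V a b ^+ 2.
set p := U a b * u a b + V a b * v a b; set q := V a b * u a b - U a b * v a b.
set tx := - (2 * l * a) * k ^- 2; set ty := - (2 * l * b) * k ^- 2.
(* With [F = U + i V] and [f = F'], [p] and [-q] are the real and imaginary parts of [conj(F) f].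
   The first order conditions then give [4 |f|^2 = N (tx^2 + ty^2)], which cancels everything but
   the Laplacian term in the sum of the second order conditions. *)
have NS : N * (u a b ^+ 2 + v a b ^+ 2) = p ^+ 2 + q ^+ 2 by rewrite /N /p /q; ring.
move=> hx1 hx2 hy1 hy2; rewrite leNgt; apply/negP => N0.
have px : 2 * p = - (N * tx) by lra.
have qy : 2 * q = - (N * ty) by lra.
have NS4 : 4 * (u a b ^+ 2 + v a b ^+ 2) = N * (tx ^+ 2 + ty ^+ 2).
  apply: (mulfI (lt0r_neq0 N0)); rewrite mulrCA NS.
  have -> : 4 * (p ^+ 2 + q ^+ 2) = (2 * p) ^+ 2 + (2 * q) ^+ 2 by ring.
  by rewrite px qy; ring.
have : N * (4 * l * k ^- 2) <= 0.
  move: hx2 hy2; rewrite px qy => hx2 hy2.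
  have := lerD hx2 hy2; rewrite addr0; apply: le_trans.
  rewrite le_eqVlt; apply/orP; left; apply/eqP.
  transitivity (4 * (u a b ^+ 2 + v a b ^+ 2) - N * (tx ^+ 2 + ty ^+ 2)
    + N * (ka + kb - 4 * l * k ^- 2)); last by ring.
  by rewrite NS4 kE; ring.
rewrite leNgt; apply/negP/negPn.
by rewrite !mulr_gt0// invr_gt0 exprn_gt0.
Qed.

(** A large [l] lets a positive value at squared radius [k1] beat the bound [M] at the larger
    squared radius [k2]. *)
Lemma weighted_sup_bound (k1 k2 M n : R) : 0 < k1 -> k1 < k2 -> 0 < n ->
  exists l, 0 < l /\ M * expR (l * k2^-1) < n * expR (l * k1^-1).
Proof.
move=> k10 k12 n0.
pose c := k1^-1 - k2^-1.
have c0 : 0 < c by rewrite subr_gt0 ltf_pV2// posrE; lra.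
(* This [l] makes [n * (1 + l * c)] equal to [n + |M| + 1], and [expR] dominates [1 + x]. *)
exists ((`|M| + 1) / (n * c)); set l' := _ / _.
have l'0 : 0 < l' by rewrite divr_gt0 ?mulr_gt0// ltr_wpDl.
split=> //.
have -> : l' * k1^-1 = l' * k2^-1 + l' * c by rewrite /c; ring.
rewrite expRD mulrCA mulrC ltr_pM2l ?expR_gt0//.
apply: (@lt_le_trans _ _ (n * (1 + l' * c))); last by rewrite ler_pM2l// expR_ge1Dx.
have -> : n * (1 + l' * c) = n + (`|M| + 1) by rewrite /l'; field; rewrite !gt_eqF.
by have := ler_norm M; lra.
Qed.

(** Let [N = |F|^2] for a primitive [F] normalised at 0, so that [N] vanishes near 0. If [N] were
    positive somewhere in the disc of radius [s], a large [l] would force the weighted function to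
    reach its maximum over the closed square at an interior point with [N > 0], against
    [no_weighted_max]. *)
Lemma holo_unique_continuation (u v : R -> R -> R) (r e : R) : 0 < e ->
  holo_on_square u v r ->
  (forall x y, `|x| < e -> `|y| < e -> u x y = 0 /\ v x y = 0) ->
  forall x y : R, 0 < r -> x ^+ 2 + y ^+ 2 < r ^+ 2 -> u x y = 0 /\ v x y = 0.
Proof.
move=> e0 huv zuv x0 y0 r0 xyr.
have [s [s0 sr xys]] : exists s, [/\ 0 < s, s < r & x0 ^+ 2 + y0 ^+ 2 < s ^+ 2].
  have k0 : 0 <= x0 ^+ 2 + y0 ^+ 2 by rewrite addr_ge0 ?sqr_ge0.
  pose q := Num.sqrt (x0 ^+ 2 + y0 ^+ 2).
  have q0 : 0 <= q by rewrite sqrtr_ge0.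
  have qE : q ^+ 2 = x0 ^+ 2 + y0 ^+ 2 by rewrite sqr_sqrtr.
  have qr : q < r by rewrite -(@ltr_pXn2r _ 2%N isT) ?nnegrE ?qE// ltW.
  exists ((q + r) / 2); split; [lra|lra|].
  by rewrite -qE (@ltr_pXn2r _ 2%N isT) ?nnegrE; lra.
(* The primitive must exist on an open square around the closed square of half side [s], where the
   maximum is taken. *)
pose s' := (s + r) / 2.
have ss' : s < s' by rewrite /s'; lra.
have s'r : s' < r by rewrite /s'; lra.
have [U [V [[U0 V0] dx dy]]] := holo_primitive s'r huv.
pose e' := Num.min e s.
have e'0 : 0 < e' by rewrite lt_min e0.
have e'e (x : R) : `|x| < e' -> `|x| < e /\ `|x| < s' by rewrite lt_min => /andP[? xs]; split=> //; exact: lt_trans xs ss'.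
have seg (x y : R) : `|y| < e' -> Num.min 0 y <= x <= Num.max 0 y -> `|x| < e'.
  by move=> ye; apply: ler_norm_segment => //; rewrite normr0.
have zUV (x y : R) : `|x| < e' -> `|y| < e' -> U x y = 0 /\ V x y = 0.
  move=> xe ye; have [ye1 ye2] := e'e _ ye; have [xe1 xe2] := e'e _ xe.
  have z0 : `|0 : R| < e' by rewrite normr0.
  have [z1 z2] := e'e _ z0.
  have cst (W w : R -> R) (z : R) : `|z| < e' ->
      (forall x : R, `|x| < e' -> is_derive x (1 : R) W (w x)) ->
      (forall x : R, `|x| < e' -> w x = 0) -> W z = W 0.
    move=> ze dW w0; apply/eqP; rewrite -subr_eq0 -normr_le0.
    suff : `|W z - W 0| <= 0 * `|z - 0| by rewrite mul0r.
    apply: (@mean_value_bound _ W w) => t /(seg _ _ ze) te.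
      exact: dW.
    by rewrite w0// normr0.
  have cUx : U x y = U 0 y.
    apply: (cst (U^~ y) (u^~ y)) => // t /e'e[? ?]; first exact: (dx _ _ _ _).1.
    exact: (zuv _ _ _ _).1.
  have cVx : V x y = V 0 y.
    apply: (cst (V^~ y) (v^~ y)) => // t /e'e[? ?]; first exact: (dx _ _ _ _).2.
    exact: (zuv _ _ _ _).2.
  have cUy : U 0 y = U 0 0.
    apply: (cst (U 0) (fun y => - v 0 y)) => // t /e'e[? ?]; first exact: (dy _ _ _ _).1.
    by rewrite (zuv _ _ _ _).2 ?oppr0.
  have cVy : V 0 y = V 0 0.
    apply: (cst (V 0) (u 0)) => // t /e'e[? ?]; first exact: (dy _ _ _ _).2.
    exact: (zuv _ _ _ _).1.
  by rewrite cUx cVx cUy cVy U0 V0.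
pose N (x y : R) := U x y ^+ 2 + V x y ^+ 2.
have N0 x y : 0 <= N x y by rewrite addr_ge0 ?sqr_ge0.
have Nz x y : `|x| < e' -> `|y| < e' -> N x y = 0.
  by move=> xe ye; have [Uz Vz] := zUV _ _ xe ye; rewrite /N Uz Vz expr0n addr0.
have cN x y : `|x| < s' -> `|y| < s' -> {for (x, y), continuous (fun p => N p.1 p.2)}.
  move=> xs ys; have [A [B [du dv]]] := huv x y (lt_trans xs s'r) (lt_trans ys s'r).
  have cU : {for (x, y), continuous (fun p : R * R => U p.1 p.2)}.
    apply: (@line_derivatives_continuous _ U u (fun x y => - v x y) s' x y _ _ (- B) (- A) xs ys _ _ du).
    - by move=> *; exact: (dx _ _ _ _).1.
    - by move=> *; exact: (dy _ _ _ _).1.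
    - move=> e1 e10; have [d d0 Hd] := dv e1 e10; exists d => // x1 y1 x1d y1d.
      apply: le_trans (Hd x1 y1 x1d y1d).
      by rewrite -normrN le_eqVlt; apply/orP; left; apply/eqP; congr `|_|; ring.
  have cV : {for (x, y), continuous (fun p : R * R => V p.1 p.2)}.
    apply: (@line_derivatives_continuous _ V v u s' x y _ _ _ _ xs ys _ _ dv du).
    - by move=> *; exact: (dx _ _ _ _).2.
    - by move=> *; exact: (dy _ _ _ _).2.
  apply: cvgD; first by apply: cvgM.
  by apply: cvgM.
have box (x : R) : x \in `[- s, s] -> `|x| < s'.
  by rewrite in_itv /= -ler_norml => /le_lt_trans; apply.
pose K := `[- s, s]%classic `*` `[- s, s]%classic : set (R * R).
have cK : compact K by apply: compact_setX; exact: segment_compact.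
have K0 : K !=set0 by exists (0, 0); split; rewrite /= in_itv /= oppr_le0 ltW.
have [M HM] : exists M, forall x y, `|x| <= s -> `|y| <= s -> N x y <= M.
  have [|c _ Hc] := compact_EVT_max (f := fun p : R * R => N p.1 p.2) K0 cK.
    by apply: continuous_in_subspaceT => -[x y]; rewrite inE => -[/box xs /box ys]; exact: cN.
  exists (N c.1 c.2) => x y xs ys; apply: (Hc (x, y)).
  by rewrite inE; split; rewrite /= in_itv /= -ler_norml.
have zN (x y : R) : x ^+ 2 + y ^+ 2 < s ^+ 2 -> N x y = 0.
  move=> xys1; apply/eqP; rewrite eq_le N0 andbT leNgt; apply/negP => Npos.
  have k0 : 0 < x ^+ 2 + y ^+ 2.
    rewrite lt_neqAle addr_ge0 ?sqr_ge0// andbT eq_sym; apply/negP.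
    rewrite paddr_eq0 ?sqr_ge0// !sqrf_eq0 => /andP[/eqP x00 /eqP y00].
    by move: Npos; rewrite Nz ?x00 ?y00 ?normr0// ltxx.
  have [l [l0 Hl]] := @weighted_sup_bound _ _ M _ k0 xys1 Npos.
  pose m (p : R * R) := N p.1 p.2 * expR (l * (p.1 ^+ 2 + p.2 ^+ 2)^-1).
  have cm : {within K, continuous m}.
    apply: continuous_in_subspaceT => -[x1 y1]; rewrite inE => -[/box xs /box ys].
    (* The weight is singular at the origin, but [m] is 0 in a neighbourhood of it because [N]
       is. *)
    have [z1|nz1] := eqVneq (x1 ^+ 2 + y1 ^+ 2) 0.
      move/eqP : z1; rewrite paddr_eq0 ?sqr_ge0// !sqrf_eq0 => /andP[/eqP -> /eqP ->].
      have m0 : m (0, 0) = 0 by rewrite /m Nz ?mul0r ?normr0.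
      apply/cvgrPdist_lt => eps eps0; exists (ball 0 e', ball 0 e'); first by split; exact: nbhsx_ballx.
      move=> [x2 y2] [/= xa yb]; rewrite m0 /m Nz ?mul0r ?subr0 ?normr0//=.
        by move: xa; rewrite /ball /= sub0r normrN.
      by move: yb; rewrite /ball /= sub0r normrN.
    apply: cvgM; first exact: cN.
    apply: continuous_comp; last exact: continuous_expR.
    apply: cvgM; first exact: cvg_cst.
    apply: cvgV => //; apply: cvgD; (apply: cvgM; (exact: cvg_fst || exact: cvg_snd)).
  have [[a b]] := compact_EVT_max K0 cK cm.
  rewrite inE => -[/= /[dup] aI /box a_s /[dup] bI /box b_s] Hab.
  have inK (x1 y1 : R) : `|x1| <= s -> `|y1| <= s -> m (x1, y1) <= m (a, b).
    by move=> *; apply: Hab; rewrite inE; split; rewrite /= in_itv /= -ler_norml.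
  have le_s (p q : R) : p ^+ 2 + q ^+ 2 < s ^+ 2 -> `|p| <= s.
    move=> pq; rewrite -(@ler_pXn2r _ 2%N isT) ?nnegrE// ?(ltW s0)// real_normK ?num_real//.
    by move: pq; have := sqr_ge0 q; clear; lra.
  have mpos : 0 < m (a, b).
    apply: lt_le_trans (inK x y (le_s _ _ xys1) _); first by rewrite mulr_gt0// expR_gt0.
    by apply: (@le_s y x); rewrite addrC.
  (* On the boundary of the square the squared radius is at least [s ^+ 2], so [m (a, b)] is at most
     [M * expR (l * s ^- 2)], which the choice of [l] puts below the value at [(x, y)]. *)
  have [ins|] := boolP ((`|a| < s) && (`|b| < s)); last first.
    move=> nin; have kab : s ^+ 2 <= a ^+ 2 + b ^+ 2.
      move: nin; rewrite negb_and -!leNgt => /orP[|] sa.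
        have : s ^+ 2 <= `|a| ^+ 2 by rewrite (@ler_pXn2r _ 2%N isT) ?nnegrE// ltW.
        by rewrite real_normK ?num_real//; have := sqr_ge0 b; clear; lra.
      have : s ^+ 2 <= `|b| ^+ 2 by rewrite (@ler_pXn2r _ 2%N isT) ?nnegrE// ltW.
      by rewrite real_normK ?num_real//; have := sqr_ge0 a; clear; lra.
    have sp : 0 < s ^+ 2 by rewrite exprn_gt0.
    have := inK x y (le_s _ _ xys1); rewrite {1}/m /= => /(_ _) H.
    have {}H : N x y * expR (l * (x ^+ 2 + y ^+ 2)^-1) <= m (a, b).
      by apply: H; apply: (@le_s y x); rewrite addrC.
    move: (lt_le_trans Hl H); rewrite ltNge => /negP; apply.
    have [aK bK] : `|a| <= s /\ `|b| <= s.
      by move: aI bI; rewrite !in_itv /= -!ler_norml.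
    rewrite /m /=; apply: ler_pM; [exact: N0|exact: expR_ge0|exact: HM|].
    rewrite ler_expR ler_pM2l// lef_pV2 ?posrE//; exact: lt_le_trans sp kab.
  have /andP[as_ bs_] := ins.
  have Nab : 0 < N a b.
    by move: mpos; rewrite /m /= pmulr_lgt0 ?expR_gt0.
  have kab : a ^+ 2 + b ^+ 2 != 0.
    apply/negP; rewrite paddr_eq0 ?sqr_ge0// !sqrf_eq0 => /andP[/eqP a0 /eqP b0].
    by move: Nab; rewrite Nz ?a0 ?b0 ?normr0// ltxx.
  have [A [B hab]] := huv a b (lt_trans as_ sr) (lt_trans bs_ sr).
  have [d [d0 das dbs dka dkb]] : exists d, [/\ 0 < d, d <= s - `|a|, d <= s - `|b|,
      forall x, `|x - a| < d -> x ^+ 2 + b ^+ 2 != 0 &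
      forall y, `|y - b| < d -> y ^+ 2 + a ^+ 2 != 0].
    have nz (p q : R) : p ^+ 2 + q ^+ 2 != 0 -> exists2 d, 0 < d &
        forall x, `|x - p| < d -> x ^+ 2 + q ^+ 2 != 0.
      move=> pq; have [q0|q0] := eqVneq q 0.
        have p0 : p != 0 by apply: contraNneq pq => ->; rewrite q0 expr0n addr0.
        exists `|p|; first by rewrite normr_gt0.
        move=> z zp; rewrite paddr_eq0 ?sqr_ge0// sqrf_eq0 negb_and.
        apply/orP; left; apply: contraTneq zp => ->.
        by rewrite sub0r normrN ltxx.
      exists 1 => // z _; rewrite paddr_eq0 ?sqr_ge0// negb_and.
      by apply/orP; right; rewrite sqrf_eq0.
    have [d1 d10 H1] := nz a b kab.
    have [|d2 d20 H2] := nz b a; first by rewrite addrC.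
    exists (Num.min (Num.min d1 d2) (Num.min (s - `|a|) (s - `|b|))); split.
    - by rewrite !lt_min d10 d20 !subr_gt0 as_ bs_.
    - by rewrite !ge_min lexx !orbT.
    - by rewrite !ge_min lexx !orbT.
    - by move=> z; rewrite !lt_min => /andP[/andP[? _] _]; exact: H1.
    - by move=> z; rewrite !lt_min => /andP[/andP[_ ?] _]; exact: H2.
  have near_s (z c : R) : `|z - c| < d -> d <= s - `|c| -> `|z| < s.
    by have := ler_normD (z - c) c; rewrite subrK; clear; lra.
  have near_s' (z c : R) : `|z - c| < d -> d <= s - `|c| -> `|z| < s'.
    by move=> zc dc; apply: lt_trans ss'; exact: near_s zc dc.
  have as' := lt_trans as_ ss'; have bs' := lt_trans bs_ ss'.
  suff : N a b <= 0 by rewrite leNgt Nab.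
  apply: (@no_weighted_max U V u v a b A B d l d0 l0) => //.
  - move=> z za; have zs := near_s' _ _ za das; exact: dx.
  - move=> z zb; have zs := near_s' _ _ zb dbs; exact: dy.
  - by move=> z za; apply: inK; rewrite ltW// (near_s z a).
  - move=> z zb; rewrite [z ^+ 2 + _]addrC [b ^+ 2 + _]addrC.
    by apply: (inK a z); rewrite ltW// (near_s z b).
(* The vanishing of the primitive on a disc is now differentiated, to return to [u] and [v]. *)
have zd (W : R -> R -> R) (w : R) : (forall x y, x ^+ 2 + y ^+ 2 < s ^+ 2 -> W x y = 0) ->
    is_derive x0 (1 : R) (W^~ y0) w -> w = 0.
  move=> W0 dW; apply: (is_derive_unique dW).
  have : {for x0, continuous (fun x : R => x ^+ 2 + y0 ^+ 2)}.
    by apply: cvgD; [apply: cvgM; exact: cvg_id|exact: cvg_cst].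
  move/cvgrPdist_lt => /(_ (s ^+ 2 - (x0 ^+ 2 + y0 ^+ 2))); rewrite subr_gt0 => /(_ xys).
  move=> [d /= d0 Hd]; apply: (@is_derive_near _ (fun=> 0) _ _ _ d) => // z zx.
  rewrite W0//; have := Hd z; rewrite /ball_ /= distrC => /(_ zx).
  by rewrite ltr_distl => /andP[]; lra.
have UV0 x y : x ^+ 2 + y ^+ 2 < s ^+ 2 -> U x y = 0 /\ V x y = 0.
  move/zN/eqP; rewrite paddr_eq0 ?sqr_ge0// !sqrf_eq0 => /andP[/eqP-> /eqP->].
  by [].
have in_s' (p q : R) : p ^+ 2 + q ^+ 2 < s ^+ 2 -> `|p| < s'.
  move=> pq; apply: lt_trans ss'; rewrite -(@ltr_pXn2r _ 2%N isT) ?nnegrE// ?(ltW s0)//.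
  by rewrite real_normK ?num_real//; move: pq; have := sqr_ge0 q; clear; lra.
have [Ux Vx] : is_derive x0 (1 : R) (U^~ y0) (u x0 y0) /\ is_derive x0 (1 : R) (V^~ y0) (v x0 y0).
  by apply: dx; [exact: in_s' xys|apply: (@in_s' y0 x0); rewrite addrC].
split; first by apply: (zd U) Ux => x y /UV0[].
by apply: (zd V) Vx => x y /UV0[].
Qed.

End UniqueContinuation.

(** * From zeros on the real axis to zeros on the imaginary axis *)

Section ReflectionLine.
Context {R : realType}.

Lemma has_differential_near (P P' : R -> R -> R) (a b A B d : R) : 0 < d ->
  (forall x y, `|x - a| < d -> `|y - b| < d -> P x y = P' x y) ->
  has_differential P a b A B -> has_differential P' a b A B.
Proof.
move=> d0 PP' dP e e0; have [d' d'0 Hd'] := dP e e0.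
exists (Num.min d d'); first by rewrite lt_min d0.
move=> x y; rewrite !lt_min => /andP[xd xd'] /andP[yd yd'].
by rewrite -!PP' ?subrr ?normr0//; exact: Hd'.
Qed.

Lemma has_differential_affine (P : R -> R -> R) (a b A B p q m : R) : `|m| = 1 ->
  has_differential P (m * a + p) (m * b + q) A B ->
  has_differential (fun x y => P (m * x + p) (m * y + q)) a b (m * A) (m * B).
Proof.
move=> m1 dP e e0; have [d d0 Hd] := dP e e0; exists d => // x y xd yd.
have E (z c k : R) : m * z + k - (m * c + k) = m * (z - c) by ring.
have := Hd (m * x + p) (m * y + q); rewrite !E !normrM m1 !mul1r => /(_ xd yd).
by congr (_ <= _); congr `|_|; ring.
Qed.

Lemma has_differential_zero a b : has_differential (fun _ _ : R => 0 : R) a b 0 0.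
Proof.
move=> e e0; exists 1 => // x y _ _.
by rewrite !mul0r !subr0 normr0 mulr_ge0 ?addr_ge0// ltW.
Qed.

(** On the axis both value and gradient of [P] are 0, so [P] meets the zero function to first order
    there. The equation on pairs fixes the gradients of [u] and [v] by the same test, which keeps
    the Cauchy-Riemann equations. *)
Lemma has_differential_glue (P : R -> R -> R) (a b A B : R) :
  has_differential P a b A B -> (b = 0 -> A = 0 /\ B = 0) -> (b = 0 -> P a 0 = 0) ->
  exists C D : R, has_differential (fun x y => if y < 0 then 0 else P x y) a b C D /\
    (C, D) = if b < 0 then (0, 0) else (A, B).
Proof.
move=> dP AB0 P0; have [b0|b0|b0] := ltgtP b 0.
- exists 0, 0; split=> //; apply: (@has_differential_near (fun _ _ => 0) _ _ _ _ _ (- b)).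
  + by rewrite oppr_gt0.
  + move=> x y _; rewrite ltr_distl => /andP[_].
    by rewrite subrr => ->.
  + exact: has_differential_zero.
- exists A, B; split=> //; apply: (has_differential_near b0 _ dP) => x y _.
  by rewrite ltr_distl subrr => /andP[y0 _]; rewrite ltNge ltW.
- have [A0 B0] := AB0 b0; exists A, B; split=> //.
  move=> e e0; have [d d0 Hd] := dP e e0; exists d => // x y xd yd.
  have := Hd x y xd yd; rewrite A0 B0 b0 !mul0r !subr0 P0// ltxx !subr0.
  case: ifP => // _ _; rewrite normr0 mulr_ge0 ?addr_ge0//; exact: ltW.
Qed.

(* Extended by [0] below the axis the function stays holomorphic, and then
   [holo_unique_continuation] applies to a disc centred at [- i r / 3]. *)
Lemma holo_vanish_above (u v : R -> R -> R) (r t : R) : 0 < r ->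
  holo_on_square u v r -> (forall x, `|x| < r -> u x 0 = 0 /\ v x 0 = 0) ->
  0 <= t -> t < r / 3 -> u 0 t = 0 /\ v 0 t = 0.
Proof.
move=> r0 huv z t0 tr.
pose g (w : R -> R -> R) x y := if y < 0 then 0 else w x y.
have glue : forall a b, `|a| < r -> `|b| < r -> exists A B, holo_at (g u) (g v) a b A B.
  move=> a b ar br; have [A [B [du dv]]] := huv a b ar br.
  (* Zeros along the axis kill the derivative in the direction [x], and this is already the whole
     complex derivative. *)
  have AB0 : b = 0 -> A = 0 /\ B = 0.
    move=> b0; move: (has_differential_derive du).1 (has_differential_derive dv).1.
    have ra : 0 < r - `|a| by rewrite subr_gt0.
    have nz (w : R -> R -> R) (l : R) : (forall x, `|x| < r -> w x 0 = 0) ->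
        is_derive a (1 : R) (w^~ b) l -> l = 0.
      move=> w0 dw; apply: (is_derive_unique dw).
      apply: (@is_derive_near _ (fun=> 0) _ _ _ _ ra) => // y ya.
      rewrite b0 w0//; have := ler_normD (y - a) a; rewrite subrK.
      by move: ya; clear; lra.
    by move=> /(nz u _ (fun x xr => (z x xr).1)) -> /(nz v _ (fun x xr => (z x xr).2)) ->.
  have [C [D [du' CD]]] := has_differential_glue du
     (fun b0 => conj (AB0 b0).1 (etrans (congr1 -%R (AB0 b0).2) (oppr0 _))) (fun _ => (z a ar).1).
  have [C' [D' [dv' CD']]] := has_differential_glue dv
     (fun b0 => conj (AB0 b0).2 (AB0 b0).1) (fun _ => (z a ar).2).
  move: CD CD' du' dv'; case: ifP => _ [-> ->] [-> ->] du' dv'.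
    by exists 0, 0; split=> //; rewrite oppr0.
  by exists A, B.
pose sh (w : R -> R -> R) x y := g w (1 * x + 0) (1 * y + - (r / 3)).
(* About the centre [- i r / 3], the square of half side [r / 3] lies below the axis, where the
   function is 0; that of half side [2 r / 3] stays in the original square, and its disc reaches up
   to height [r / 3]. *)
have [|||||uz vz] := @holo_unique_continuation R (sh u) (sh v) (2 * r / 3) (r / 3) _ _ _ 0 (t + r / 3).
- by rewrite divr_gt0.
- move=> a b ar br.
  have [||A [B [dA dB]]] := glue (1 * a + 0) (1 * b + - (r / 3)).
  + by move: ar; rewrite mul1r addr0; lra.
  + by move: br; rewrite mul1r !ltr_norml => /andP[? ?]; apply/andP; split; lra.
  exists (1 * A), (1 * B); split; last exact: has_differential_affine (normr1 R) dB.
  by rewrite -mulrN; exact: has_differential_affine (normr1 R) dA.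
- move=> x y xr; rewrite ltr_norml => /andP[_ yr].
  by rewrite /sh /g mul1r subr_lt0 yr.
- by rewrite divr_gt0 ?mulr_gt0.
- by rewrite expr0n add0r (@ltr_pXn2r _ 2%N isT) ?nnegrE; lra.
by move: uz vz; rewrite /sh /g !mul1r addr0 addrK ltNge t0.
Qed.

(** Negative [t] is reached by the half turn [w -> - w], which preserves both the axis and
    holomorphy. *)
Lemma holo_vanish_axis (u v : R -> R -> R) (r t : R) : 0 < r ->
  holo_on_square u v r -> (forall x, `|x| < r -> u x 0 = 0 /\ v x 0 = 0) ->
  `|t| < r / 3 -> u 0 t = 0 /\ v 0 t = 0.
Proof.
move=> r0 huv z; rewrite ltr_norml => /andP[t1 t2].
have [t0|/ltW t0] := leP 0 t; first exact: holo_vanish_above huv z t0 t2.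
pose f (w : R -> R -> R) x y := w (-1 * x + 0) (-1 * y + 0).
have [||||uz vz] := @holo_vanish_above (f u) (f v) r (- t) r0.
- move=> a b ar br; have [||A [B [dA dB]]] := huv (-1 * a + 0) (-1 * b + 0).
  + by rewrite mulN1r addr0 normrN.
  + by rewrite mulN1r addr0 normrN.
  exists (-1 * A), (-1 * B); split; rewrite -?mulrN;
    by apply: has_differential_affine; rewrite ?normrN1.
- by move=> x xr; rewrite /f mulr0 !addr0; apply: z; rewrite mulN1r normrN.
- by rewrite oppr_ge0.
- by lra.
by move: uz vz; rewrite /f mulr0 !addr0 mulN1r opprK.
Qed.

End ReflectionLine.

(** * From differentiability over [R[i]] to pairs of real functions *)

Section ComplexDifferentiable.
Context {R : realType}.
Local Notation C := R[i].

Definition ReP (f : C -> C) (x y : R) : R := complex.Re (f (Complex x y)).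
Definition ImP (f : C -> C) (x y : R) : R := complex.Im (f (Complex x y)).

Local Notation normc := Normc.normc.

Lemma Re_le_normc (z : C) : `|complex.Re z| <= normc z.
Proof.
case: z => a b /=.
by rewrite -sqrtr_sqr ler_sqrt ?addr_ge0 ?sqr_ge0// lerDl sqr_ge0.
Qed.

Lemma Im_le_normc (z : C) : `|complex.Im z| <= normc z.
Proof.
case: z => a b /=.
by rewrite -sqrtr_sqr ler_sqrt ?addr_ge0 ?sqr_ge0// lerDr sqr_ge0.
Qed.

Lemma normc_le_sum (a b : R) : normc (Complex a b) <= `|a| + `|b|.
Proof.
rewrite /=.
rewrite -(@ler_pXn2r _ 2%N isT) ?nnegrE ?sqrtr_ge0 ?addr_ge0// sqr_sqrtr ?addr_ge0 ?sqr_ge0//.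
rewrite sqrrD !real_normK ?num_real//.
by rewrite -addrA [_ *+ 2 + _]addrC addrA lerDl mulrn_wge0// mulr_ge0.
Qed.

(** Norms over [R[i]] are elements of [R[i]]; this identity moves estimates to [R]. *)
Lemma normcE (z : C) : `|z| = (normc z)%:C.
Proof. by []. Qed.

Lemma derivable_holo_at (f : C -> C) (a b : R) :
  differentiable f (Complex a b) -> exists A B, holo_at (ReP f) (ImP f) a b A B.
Proof.
move=> /derivable1_diffP df.
have /cvg_ex[[A B]] := df.
move/cvgrPdist_le => Hl; exists A, B.
have key (e : R) : 0 < e -> exists2 d : R, 0 < d & forall x y,
    `|x - a| < d -> `|y - b| < d ->
    normc (f (Complex x y) - f (Complex a b) - Complex A B * Complex (x - a) (y - b))
      <= e * (`|x - a| + `|y - b|).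
  move=> e0; have eC : 0 < e%:C by rewrite ltcR.
  have := Hl _ eC; rewrite /prop_near1 /= => -[[d d'] /= d0 Hd].
  (* A positive element of [R[i]] is real, so the radius has imaginary part 0. It is halved because
     two coordinate bounds add up. *)
  move: d0; rewrite ltcE /= => /andP[/eqP d'0 d0].
  exists (d / 2); first by rewrite divr_gt0.
  move=> x y xd yd.
  set h := Complex (x - a) (y - b).
  have hE : Complex x y = h + Complex a b.
    by apply/eqP; rewrite eq_complex /= !subrK !eqxx.
  have hn : normc h <= `|x - a| + `|y - b| := normc_le_sum _ _.
  have [h0|h0] := eqVneq h 0.
    by rewrite hE h0 add0r !subrr mulr0 subr0 Normc.normc0 mulr_ge0 ?addr_ge0// ltW.
  have hd : ball_ [eta Num.norm] 0 (Complex d d') h.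
    change (`|0 - h| < Complex d d').
    rewrite sub0r normrN normcE ltcE /= d'0 eqxx /=.
    by apply: le_lt_trans hn _; lra.
  have := Hd h hd h0.
  rewrite [_ *: 1]mulr1 -hE => H.
  have -> : f (Complex x y) - f (Complex a b) - Complex A B * h =
     - (Complex A B - h^-1 * (f (Complex x y) - f (Complex a b))) * h.
    by field.
  have : `|- (Complex A B - h^-1 * (f (Complex x y) - f (Complex a b))) * h| <= e%:C * `|h|.
    by rewrite normrM normrN ler_wpM2r.
  rewrite !normcE -rmorphM lecR => /le_trans; apply.
  by rewrite ler_pM2l.
split=> e e0; have [d d0 Hd] := key e e0; exists d => // x y xd yd;
  apply: le_trans (Hd x y xd yd).
- apply: le_trans (Re_le_normc _); rewrite le_eqVlt; apply/orP; left; apply/eqP.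
  rewrite /ReP; case: (f _) => f1 f2; case: (f _) => f3 f4 /=.
  by congr `|_|; ring.
- apply: le_trans (Im_le_normc _); rewrite le_eqVlt; apply/orP; left; apply/eqP.
  rewrite /ImP; case: (f _) => f1 f2; case: (f _) => f3 f4 /=.
  by congr `|_|; ring.
Qed.

End ComplexDifferentiable.

(** * Unique continuation and conjugate-holomorphic quotients over [R[i]] *)

Section ComplexUniqueContinuation.
Context {R : realType}.
Local Notation C := R[i].

Definition square (r : R) (w : C) : Prop :=
  `|complex.Re w| < r /\ `|complex.Im w| < r.

Lemma squareN (r : R) w : square r w -> square r (- w).
Proof. by case: w => a b []; rewrite /square /= !normrN. Qed.

Lemma square0 (r : R) : 0 < r -> square r 0.
Proof. by rewrite /square /= normr0. Qed.

Lemma square_le (r r' : R) w : r <= r' -> square r w -> square r' w.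
Proof. by move=> rr' [? ?]; split; exact: lt_le_trans rr'. Qed.

Lemma holo_on_square_shift (f : C -> C) (c : C) (r : R) :
  (forall w, square r (w - c) -> differentiable f w) ->
  holo_on_square (ReP (fun w => f (w + c))) (ImP (fun w => f (w + c))) r.
Proof.
move=> df a b ar br; apply: derivable_holo_at.
apply: (@differentiable_comp _ _ _ _ (fun w : C => w + c) f).
  by apply: differentiableD; [exact: ex_diff|exact: differentiable_cst].
by apply: df; rewrite addrK.
Qed.

Lemma ReImP0 (f : C -> C) (x y : R) :
  f (Complex x y) = 0 <-> ReP f x y = 0 /\ ImP f x y = 0.
Proof. by rewrite /ReP /ImP; case: (f _) => a b /=; split=> [[-> ->]//|[-> ->]]. Qed.

Lemma differentiable_unique_continuation (f : C -> C) (c : C) (r e : R) : 0 < r -> 0 < e ->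
  (forall w, square r (w - c) -> differentiable f w) ->
  (forall w, square e (w - c) -> f w = 0) ->
  forall w, complex.Re (w - c) ^+ 2 + complex.Im (w - c) ^+ 2 < r ^+ 2 -> f w = 0.
Proof.
move=> r0 e0 /holo_on_square_shift hf f0 w wr.
have [|u0 v0] := holo_unique_continuation e0 hf _ r0 wr.
  by move=> x y xe ye; apply/ReImP0; apply: f0; rewrite addrK.
have /ReImP0 : ReP (fun w => f (w + c)) (complex.Re (w - c)) (complex.Im (w - c)) = 0 /\
  ImP (fun w => f (w + c)) (complex.Re (w - c)) (complex.Im (w - c)) = 0 by [].
rewrite (_ : Complex _ _ = w - c) ?subrK//.
by case: (w - c).
Qed.

Lemma differentiable_vanish_axis (f : C -> C) (c : C) (r : R) : 0 < r ->
  (forall w, square r (w - c) -> differentiable f w) ->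
  (forall x, `|x| < r -> f (Complex x 0 + c) = 0) ->
  forall t, `|t| < r / 3 -> f (Complex 0 t + c) = 0.
Proof.
move=> r0 /holo_on_square_shift hf f0 t tr.
suff : ReP (fun w => f (w + c)) 0 t = 0 /\ ImP (fun w => f (w + c)) 0 t = 0 by move/ReImP0.
apply: (holo_vanish_axis r0 hf _ tr) => x xr.
by apply/ReImP0; exact: f0.
Qed.

(** The Cauchy-Riemann equations of a function and of its conjugate differ in sign, so [A = - A] and
    [B = - B]. *)
Lemma holo_conj_derive0 (u v u' v' : R -> R -> R) (a b d : R) : 0 < d ->
  (exists A B, holo_at u v a b A B) -> (exists A B, holo_at u' v' a b A B) ->
  (forall x y, `|x - a| < d -> `|y - b| < d -> u' x y = u x y /\ v' x y = - v x y) ->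
  holo_at u v a b 0 0.
Proof.
move=> d0 [A [B [du dv]]] [A' [B' [du' dv']]] E.
have [ux uy] := has_differential_derive du; have [vx vy] := has_differential_derive dv.
have du2 : has_differential u a b A' (- B').
  by apply: has_differential_near d0 _ du' => x y xa yb; have [] := E x y xa yb.
have dv2 : has_differential (fun x y => - v x y) a b B' A'.
  by apply: has_differential_near d0 _ dv' => x y xa yb; have [] := E x y xa yb.
have [ux2 uy2] := has_differential_derive du2; have [vx2 vy2] := has_differential_derive dv2.
have AA := is_derive_unique ux ux2; have BB := is_derive_unique uy uy2.
have nvx : is_derive a (1 : R) (fun x => - v x b) (- B).
  exact: (is_deriveN vx).
have nvy : is_derive b (1 : R) (fun y => - v a y) (- A).
  exact: (is_deriveN vy).
have BN := is_derive_unique nvx vx2; have AN := is_derive_unique nvy vy2.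
have A0 : A = 0 by lra.
have B0 : B = 0 by lra.
by move: du dv; rewrite A0 B0 oppr0 /holo_at oppr0.
Qed.

Lemma derivative0_constant (u v : R -> R -> R) (r : R) :
  (forall a b, `|a| < r -> `|b| < r -> holo_at u v a b 0 0) ->
  forall a b, `|a| < r -> `|b| < r -> u a b = u 0 0 /\ v a b = v 0 0.
Proof.
move=> H a b ar br.
have r0 : 0 < r by exact: le_lt_trans ar.
have z0 : `|0 : R| < r by rewrite normr0.
have cst (W : R -> R) (z : R) : `|z| < r ->
    (forall x : R, `|x| < r -> is_derive x (1 : R) W 0) -> W z = W 0.
  move=> zr dW; apply/eqP; rewrite -subr_eq0 -normr_le0.
  suff : `|W z - W 0| <= 0 * `|z - 0| by rewrite mul0r.
  apply: (@mean_value_bound _ W (fun=> 0)) => t.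
    by move/(ler_norm_segment z0 zr)/dW.
  by rewrite normr0.
have D (x y : R) : `|x| < r -> `|y| < r -> [/\ is_derive x (1 : R) (u^~ y) 0,
    is_derive y (1 : R) (u x) 0, is_derive x (1 : R) (v^~ y) 0 & is_derive y (1 : R) (v x) 0].
  move=> xr yr; have [du dv] := H x y xr yr.
  have [ux uy] := has_differential_derive du; have [vx vy] := has_differential_derive dv.
  by split => //; move: uy; rewrite oppr0.
split.
  transitivity (u 0 b); first by apply: (cst (u^~ b)) => // x xr; have [] := D x b xr br.
  by apply: (cst (u 0)) => // y yr; have [] := D 0 y z0 yr.
transitivity (v 0 b); first by apply: (cst (v^~ b)) => // x xr; have [] := D x b xr br.
by apply: (cst (v 0)) => // y yr; have [] := D 0 y z0 yr.
Qed.

Lemma differentiable_nonzero_square (g : C -> C) : differentiable g 0 -> g 0 != 0 ->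
  exists2 r : R, 0 < r & forall w, square r w -> g w != 0.
Proof.
move=> dg g0; have [A [B [du dv]]] := derivable_holo_at dg.
have n0 : 0 < Normc.normc (g 0).
  have : 0 < `|g 0| by rewrite normr_gt0.
  by rewrite normcE ltcR.
pose e := Normc.normc (g 0) / 2.
have e0 : 0 < e by rewrite divr_gt0.
have [d1 d10 H1] := has_differential_continuous du e0.
have [d2 d20 H2] := has_differential_continuous dv e0.
exists (Num.min d1 d2); first by rewrite lt_min d10.
move=> [x y] [/=]; rewrite !lt_min => /andP[x1 x2] /andP[y1 y2].
apply/eqP => /ReImP0[ux vx].
have := H1 x y; rewrite !subr0 => /(_ x1 y1); rewrite ux sub0r normrN => h1.
have := H2 x y; rewrite !subr0 => /(_ x2 y2); rewrite vx sub0r normrN => h2.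
have : Normc.normc (g 0) <= `|ReP g 0 0| + `|ImP g 0 0|.
  by have := normc_le_sum (ReP g 0 0) (ImP g 0 0); rewrite /ReP /ImP; case: (g 0).
by rewrite leNgt; apply/negP; rewrite negbK; move: h1 h2; rewrite /e; clear; lra.
Qed.

(* The last hypothesis makes the conjugate of [f / g] holomorphic as well. *)
Lemma conj_quotient_constant (f g h : C -> C) (r : R) : 0 < r ->
  (forall w, square r w -> [/\ differentiable f w, differentiable g w & differentiable h w]) ->
  g 0 != 0 ->
  (forall w, square r w -> g w != 0 -> g (- w) != 0 ->
     conjc (f w / g w) = h (- w) / g (- w)) ->
  exists2 r' : R, 0 < r' & forall w, square r' w -> f w = f 0 / g 0 * g w.
Proof.
move=> r0 d g0 E; have s0 := square0 r0.
have [_ dg0 _] := d 0 s0.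
have [r1 r10 gn0] := differentiable_nonzero_square dg0 g0.
pose r' := Num.min r r1.
have r'0 : 0 < r' by rewrite lt_min r0.
have r'E w : square r' w -> square r w /\ square r1 w.
  by rewrite /square !lt_min => -[/andP[? ?] /andP[? ?]].
pose k w := f w / g w; pose k' w := h (- w) / g (- w).
have dk (p q : C -> C) w : differentiable p w -> differentiable q w -> q w != 0 ->
    differentiable (fun w => p w / q w) w.
  move=> dp dq qw; apply: (@differentiableM C _ p (fun w => (q w)^-1)); first exact: dp.
  exact: (@differentiableV C _ q w dq qw).
have dN (p : C -> C) w : differentiable p (- w) -> differentiable (fun w => p (- w)) w.
  move=> dp; apply: (@differentiable_comp _ _ _ _ (fun w : C => - w) p); last exact: dp.
  by apply: (@differentiableN C C C (fun w : C => w)); exact: ex_diff.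
exists r' => // w wr'.
have [|kR kI] := @derivative0_constant (ReP k) (ImP k) r' _ (complex.Re w) (complex.Im w) wr'.1 wr'.2.
  move=> a b ar br.
  have sq : square r' (Complex a b) by [].
  have [sqr sq1] := r'E _ sq; have [sqrN sqN1] := (squareN sqr, squareN sq1).
  have [df dg _] := d _ sqr; have [_ dgN dhN] := d _ sqrN.
  apply: (@holo_conj_derive0 _ _ (ReP k') (ImP k') _ _ (Num.min (r' - `|a|) (r' - `|b|))).
  - by rewrite lt_min !subr_gt0 ar br.
  - exact: (derivable_holo_at (dk f g _ df dg (gn0 _ sq1))).
  - exact: (derivable_holo_at (dk _ _ _ (dN h _ dhN) (dN g _ dgN) (gn0 _ sqN1))).
  - move=> x y; rewrite !lt_min => /andP[xa _] /andP[_ yb].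
    have /r'E[sr sr1] : square r' (Complex x y).
      have nD (z c : R) : `|z - c| < r' - `|c| -> `|z| < r'.
        by have := ler_normD (z - c) c; rewrite subrK; clear; lra.
      by split; [exact: nD xa|exact: nD yb].
    have := E _ sr (gn0 _ sr1) (gn0 _ (squareN sr1)).
    by rewrite /ReP /ImP /k /k' => <-; case: (_ / _).
have [swr sw1] := r'E _ wr'.
have : k w = k 0.
  move: kR kI; rewrite /ReP /ImP -/(0 : C); case: w {wr' swr sw1} => a b /=.
  by case: (k _) => p q; case: (k _) => p' q' /= -> ->.
rewrite /k => <-; rewrite divfK//; exact: gn0.
Qed.

End ComplexUniqueContinuation.

(** * Hilbert space calculus and the Riesz representation theorem *)

Section HilbertBasics.
Context {R : realType} (V : hilbertType R).
Local Notation C := R[i].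
Implicit Types (u v w : V) (a : C).

(** Real form of a norm that takes its values in [R[i]], so that order arguments run over [R]. *)
Definition hnorm v : R := complex.Re `|v|.

Lemma hnormE v : `|v| = (hnorm v)%:C.
Proof.
have : (0 : C) <= `|v| by [].
by rewrite /hnorm lecE; case: `|v| => p q /= /andP[/eqP-> _].
Qed.

Lemma hnorm_ge0 v : 0 <= hnorm v.
Proof. by have : (0 : C) <= `|v| by []; rewrite hnormE lecR. Qed.

Lemma hnorm0 : hnorm 0 = 0.
Proof. by rewrite /hnorm normr0. Qed.

Lemma hnorm_eq0 v : hnorm v = 0 -> v = 0.
Proof. by move=> v0; apply/eqP; rewrite -normr_eq0 hnormE v0. Qed.

Lemma hnormD u v : hnorm (u + v) <= hnorm u + hnorm v.
Proof. by have := ler_normD u v; rewrite !hnormE -rmorphD lecR. Qed.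

Lemma hnormN v : hnorm (- v) = hnorm v.
Proof. by rewrite /hnorm normrN. Qed.

Lemma hnormB u v : hnorm (u - v) <= hnorm u + hnorm v.
Proof. by rewrite -[hnorm v]hnormN hnormD. Qed.

Lemma hnormZ a v : hnorm (a *: v) = Normc.normc a * hnorm v.
Proof. by have := normrZ a v; rewrite !hnormE normcE -rmorphM => /complexI. Qed.

Lemma hnormZR (k : R) v : 0 <= k -> hnorm (k%:C *: v) = k * hnorm v.
Proof. by move=> k0; rewrite hnormZ /= expr0n addr0 sqrtr_sqr ger0_norm. Qed.

Lemma innerE v : inner v v = (hnorm v ^+ 2)%:C.
Proof. by rewrite inner_norm hnormE rmorphXn. Qed.

Lemma innerDl u v w : inner (u + v) w = inner u w + inner v w.
Proof. by have := inner_linear 1 u v w; rewrite scale1r mul1r. Qed.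

Lemma inner0l w : inner 0 w = 0.
Proof. by apply: (addrI (inner 0 w)); rewrite -innerDl !addr0. Qed.

Lemma innerZl a u w : inner (a *: u) w = a * inner u w.
Proof. by have := inner_linear a u 0 w; rewrite inner0l !addr0. Qed.

Lemma innerNl u w : inner (- u) w = - inner u w.
Proof. by rewrite -scaleN1r innerZl mulN1r. Qed.

Lemma innerDr u v w : inner w (u + v) = inner w u + inner w v.
Proof. by rewrite inner_conj innerDl (inner_conj u w) (inner_conj v w) rmorphD. Qed.

Lemma innerZr a u w : inner w (a *: u) = conjc a * inner w u.
Proof. by rewrite inner_conj innerZl (inner_conj u w) rmorphM. Qed.

Lemma innerNr u w : inner w (- u) = - inner w u.
Proof. by rewrite inner_conj innerNl (inner_conj u w) rmorphN. Qed.

Lemma inner0r w : inner w 0 = 0.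
Proof. by rewrite inner_conj inner0l rmorph0. Qed.

Lemma Re_inner_sym u v : complex.Re (inner v u) = complex.Re (inner u v).
Proof. by rewrite inner_conj; case: (inner u v). Qed.

Lemma hnorm_sqrD u v :
  hnorm (u + v) ^+ 2 = hnorm u ^+ 2 + hnorm v ^+ 2 + 2 * complex.Re (inner u v).
Proof.
have /(congr1 (@complex.Re R)) /= -> : (hnorm (u + v) ^+ 2)%:C =
   (hnorm u ^+ 2)%:C + (hnorm v ^+ 2)%:C + (inner u v + inner v u).
  by rewrite -!innerE innerDl !innerDr; ring.
move: (Re_inner_sym u v); rewrite /=; case: (inner u v) => ? ?; case: (inner v u) => ? ? /= ->.
by rewrite mulr_natl mulr2n.
Qed.

Lemma Re_inner_le u v : complex.Re (inner u v) <= hnorm u * hnorm v.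
Proof.
have := hnorm_sqrD u v.
have : hnorm (u + v) ^+ 2 <= (hnorm u + hnorm v) ^+ 2.
  by rewrite (@ler_pXn2r _ 2%N isT) ?nnegrE ?addr_ge0 ?hnorm_ge0// hnormD.
rewrite sqrrD => h1 h2; move: h1; rewrite h2; lra.
Qed.

Definition linear_map (A : V -> V) : Prop :=
  forall a v w, A (a *: v + w) = a *: A v + A w.

Lemma linear_mapD A : linear_map A -> forall v w, A (v + w) = A v + A w.
Proof. by move=> lA v w; have := lA 1 v w; rewrite !scale1r. Qed.

Lemma linear_map0 A : linear_map A -> A 0 = 0.
Proof. by move=> lA; apply: (addrI (A 0)); rewrite -(linear_mapD lA) !addr0. Qed.

Lemma linear_mapZ A : linear_map A -> forall a v, A (a *: v) = a *: A v.
Proof. by move=> lA a v; have := lA a v 0; rewrite (linear_map0 lA) !addr0. Qed.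

Lemma linear_mapN A : linear_map A -> forall v, A (- v) = - A v.
Proof. by move=> lA v; rewrite -scaleN1r (linear_mapZ lA) scaleN1r. Qed.

Lemma linear_mapB A : linear_map A -> forall v w, A (v - w) = A v - A w.
Proof. by move=> lA v w; rewrite (linear_mapD lA) (linear_mapN lA). Qed.

Lemma hilbert_complete (u : nat -> V) :
  (forall e : R, 0 < e -> exists n, forall i j, (n <= i)%N -> (n <= j)%N ->
     hnorm (u i - u j) < e) ->
  exists l, forall e : R, 0 < e -> exists n, forall i, (n <= i)%N -> hnorm (u i - l) < e.
Proof.
move=> cu.
have /cvg_ex[l ul] : cvg (u @ \oo).
  apply/cauchy_cvgP/cauchy_exP => e e0.
  have eE : e = (complex.Re e)%:C.
    by move: e0; rewrite ltcE; case: e => p q /= /andP[/eqP->].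
  have e0' : 0 < complex.Re e by move: e0; rewrite {1}eE ltcR.
  have [n Hn] := cu _ e0'; exists (u n); exists n => // i /= ni.
  by rewrite -ball_normE /= eE hnormE ltcR Hn.
exists l => e e0; move/cvgrPdist_lt : ul => /(_ e%:C); rewrite ltcR => /(_ e0).
move=> [n _ Hn]; exists n => i ni; have := Hn i ni.
by rewrite hnormE ltcR -opprB hnormN.
Qed.

(* [k] minimises [|v|^2 - 2 Re (l v)]. *)
Lemma riesz_representation (l : V -> C) (K : R) :
  (forall a v w, l (a *: v + w) = a * l v + l w) ->
  (forall v, Normc.normc (l v) <= K * hnorm v) -> exists k, forall v, l v = inner v k.
Proof.
move=> ll lK.
have lD v w : l (v + w) = l v + l w by have := ll 1 v w; rewrite scale1r mul1r.
have l0 : l 0 = 0 by apply: (addrI (l 0)); rewrite -lD !addr0.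
have lZ a v : l (a *: v) = a * l v by have := ll a v 0; rewrite l0 !addr0.
pose rl v := complex.Re (l v).
have rlD v w : rl (v + w) = rl v + rl w by rewrite /rl lD; case: (l v); case: (l w).
have rlZ (t : R) v : rl (t%:C *: v) = t * rl v.
  by rewrite /rl lZ; case: (l v) => p q /=; rewrite mul0r subr0.
have rlK v : `|rl v| <= K * hnorm v by apply: le_trans (lK v); exact: Re_le_normc.
pose J v := hnorm v ^+ 2 - 2 * rl v.
have JK v : - K ^+ 2 <= J v.
  have := rlK v; rewrite ler_norml => /andP[_ h].
  have : 0 <= (hnorm v - K) ^+ 2 by rewrite sqr_ge0.
  by rewrite /J sqrrB; clear -h; lra.
pose m := inf (range J).
have hJ : has_inf (range J).
  by split; [exists (J 0), 0|exists (- K ^+ 2) => _ [v _ <-]].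
have mJ v : m <= J v by apply: ge_inf; [exact: hJ.2|exists v].
have /choice[u Hu] : forall n : nat, exists v, J v < m + n.+1%:R^-1.
  move=> n; have n0 : 0 < n.+1%:R^-1 :> R by rewrite invr_gt0.
  by have [_ [v _ <-] vm] := inf_adherent n0 hJ; exists v.
(* The parallelogram law: two almost minimisers of [J] are close, since [J] at their midpoint is at
   least [m]. *)
have Jpar v w : hnorm (v - w) ^+ 2 = 2 * (J v + J w - 2 * J ((2^-1)%:C *: (v + w))).
  have h1 := hnorm_sqrD v w; have h2 := hnorm_sqrD v (- w).
  rewrite innerNr hnormN in h2; rewrite h2 /J hnormZR// rlZ rlD exprMn h1.
  by case: (inner v w) => p q /=; field.
have small (e : R) : 0 < e -> exists n : nat, n.+1%:R^-1 < e.
  move=> e0; have [n Hn] : exists n : nat, e^-1 < n%:R.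
    by exists (Num.bound e^-1); rewrite archi_boundP// invr_ge0 ltW.
  exists n; rewrite invf_plt ?posrE//; apply: lt_trans Hn _.
  by rewrite ltr_nat.
have [e e0|k Hk] := @hilbert_complete u.
  have e4 : 0 < e ^+ 2 / 4 by rewrite divr_gt0// exprn_gt0.
  have [n Hn] := small _ e4.
  exists n => i j ni nj.
  rewrite -(@ltr_pXn2r _ 2%N isT) ?nnegrE ?hnorm_ge0 ?ltW// Jpar.
  have := mJ ((2^-1)%:C *: (u i + u j)).
  have le_n p : (n <= p)%N -> p.+1%:R^-1 <= n.+1%:R^-1 :> R.
    by move=> np; rewrite lef_pV2 ?posrE// ler_nat ltnS.
  have := Hu i; have := Hu j; have := le_n _ ni; have := le_n _ nj; move: Hn.
  move: (J (u i)) (J (u j)) (J _) (n.+1%:R^-1 : R) (i.+1%:R^-1 : R) (j.+1%:R^-1 : R).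
  by clear => *; lra.
have Jk : J k <= m.
  rewrite leNgt; apply/negP => mk.
  pose D := J k - m; have D0 : 0 < D by rewrite subr_gt0.
  have key d : J k <= J (k + d) + 2 * hnorm k * hnorm d + 2 * (K * hnorm d).
    have h1 := Re_inner_le (- k) d; rewrite innerNl hnormN in h1.
    have h1' : - complex.Re (inner k d) <= hnorm k * hnorm d.
      by move: h1; case: (inner _ _).
    have := rlK d; rewrite ler_norml => /andP[_ h2].
    have := sqr_ge0 (hnorm d); move: h1' h2; rewrite /J hnorm_sqrD rlD.
    move: (complex.Re _) (hnorm k ^+ 2) (hnorm d ^+ 2) (rl k) (rl d) (hnorm k * hnorm d) (K * hnorm d) (mulrA 2 (hnorm k) (hnorm d)) => x1 x2 x3 x4 x5 x6 x7 <-.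
    by clear => *; lra.
  have D2 : 0 < D / 2 by rewrite divr_gt0.
  have [n Hn] := small _ D2.
  pose b := 2 * hnorm k + 2 * `|K| + 1.
  have b0 : 0 < b by rewrite /b; have := hnorm_ge0 k; have := normr_ge0 K; lra.
  have [n' Hn'] := Hk (D / 2 / b) (divr_gt0 D2 b0).
  pose N := maxn n n'.
  have uN := Hu N; have dN := Hn' N (leq_maxr _ _).
  have iN : N.+1%:R^-1 <= n.+1%:R^-1 :> R.
    by rewrite lef_pV2 ?posrE// ler_nat ltnS leq_maxl.
  have := key (u N - k); rewrite addrCA subrr addr0.
  have : b * hnorm (u N - k) < D / 2 by rewrite mulrC -ltr_pdivlMr.
  have : K * hnorm (u N - k) <= `|K| * hnorm (u N - k).
    by rewrite ler_wpM2r ?hnorm_ge0// ler_norm.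
  have := hnorm_ge0 (u N - k).
  move: uN iN Hn; rewrite /b /D.
  move: (J (u N)) (J k) (hnorm (u N - k)) (n.+1%:R^-1 : R) (N.+1%:R^-1 : R).
  clear => *; lra.
have var v : complex.Re (inner k v) = rl v.
  apply/eqP; rewrite eq_le; apply/andP.
  have vt (t : R) : 0 <= 2 * t * (complex.Re (inner k v) - rl v) + t ^+ 2 * hnorm v ^+ 2.
    have := le_trans Jk (mJ (k + t%:C *: v)).
    rewrite /J hnorm_sqrD rlD rlZ hnormZ exprMn innerZr conjc_real.
    have -> : Normc.normc t%:C ^+ 2 = t ^+ 2.
      by rewrite /= expr0n addr0 sqr_sqrtr ?sqr_ge0.
    case: (inner k v) => p q /=; rewrite mul0r subr0; clear; lra.
  have n0 := sqr_ge0 (hnorm v).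
  move: vt; set x := complex.Re _ - _; set s := hnorm v ^+ 2 in n0 * => vt.
  suff x0 : x = 0 by move: x0; rewrite /x; clear; split; lra.
  have s1 : 0 < s + 1 by lra.
  (* This nearly optimal [t] makes the quadratic a negative multiple of [x ^+ 2]; the added 1 covers
     [s = 0]. *)
  have := vt (- x / (s + 1)).
  have -> : 2 * (- x / (s + 1)) * x + (- x / (s + 1)) ^+ 2 * s =
     - (x ^+ 2 * ((s + 2) / (s + 1) ^+ 2)).
    by field; rewrite gt_eqF.
  rewrite oppr_ge0 => h.
  apply/eqP; rewrite -sqrf_eq0 eq_le sqr_ge0 andbT.
  by move: h; rewrite pmulr_lle0// divr_gt0 ?exprn_gt0//; lra.
exists k => v; have h1 := var v; have h2 := var ('i%C *: v).
rewrite inner_conj; move: h1 h2; rewrite /rl lZ innerZr.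
case: (inner k v) => p q; case: (l v) => p' q' /= -> h2.
by apply/eqP; rewrite eq_complex /= eqxx /=; apply/eqP; lra.
Qed.

End HilbertBasics.

(** * Square root of a self-adjoint contraction *)

Section SquareRoot.
Context {R : realType} (V : hilbertType R).
Local Notation C := R[i].

Definition selfadjoint (A : V -> V) : Prop :=
  forall v w, inner (A v) w = inner v (A w).

Definition bounded_by (k : R) (A : V -> V) : Prop :=
  forall v, hnorm (A v) <= k * hnorm v.

(* [poly_cone X A a]: [A = p(X)] and [a = p(1)] for a polynomial [p] with
   nonnegative coefficients. *)
Inductive poly_cone (X : V -> V) : (V -> V) -> R -> Prop :=
| poly_cone0 : poly_cone X (fun=> 0) 0
| poly_cone_id : poly_cone X X 1
| poly_coneZ k A a : 0 <= k -> poly_cone X A a ->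
    poly_cone X (fun v => k%:C *: A v) (k * a)
| poly_coneD A B a b : poly_cone X A a -> poly_cone X B b ->
    poly_cone X (fun v => A v + B v) (a + b)
| poly_coneM A B a b : poly_cone X A a -> poly_cone X B b ->
    poly_cone X (A \o B) (a * b).

Variable X : V -> V.
Hypothesis lX : linear_map X.

Lemma poly_cone_linear A a : poly_cone X A a -> linear_map A.
Proof.
elim=> {A a} [|//|k A a _ _ IH|A B a b _ IHA _ IHB|A B a b _ IHA _ IHB] c v w.
- by rewrite scaler0 addr0.
- by rewrite IH scalerDr !scalerA mulrC.
- by rewrite IHA IHB scalerDr addrACA.
- by rewrite /= IHB IHA.
Qed.

Lemma poly_cone_commute T : linear_map T -> (forall v, T (X v) = X (T v)) ->
  forall A a, poly_cone X A a -> forall v, T (A v) = A (T v).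
Proof.
move=> lT TX A a; elim=> {A a} [|//|k A a _ _ IH|A B a b _ IHA _ IHB|A B a b _ IHA _ IHB] v.
- exact: linear_map0.
- by rewrite (linear_mapZ lT) IH.
- by rewrite (linear_mapD lT) IHA IHB.
- by rewrite /= IHA IHB.
Qed.

(** For a contraction [X] and nonnegative coefficients, the triangle inequality bounds the norm of
    [p(X)] by [p(1)]. *)
Lemma poly_cone_bounded A a : bounded_by 1 X -> poly_cone X A a -> 0 <= a /\ bounded_by a A.
Proof.
move=> bX; elim=> {A a} [|//|k A a k0 _ [a0 IH]|A B a b _ [a0 IHA] _ [b0 IHB]|A B a b _ [a0 IHA] _ [b0 IHB]].
- by split=> // v; rewrite hnorm0 mul0r.
- by split=> [|v]; rewrite ?mulr_ge0// hnormZR// -mulrA ler_wpM2l.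
- by split=> [|v]; rewrite ?addr_ge0// mulrDl (le_trans (hnormD _ _))// lerD.
- split=> [|v]; first by rewrite mulr_ge0.
  by rewrite /= (le_trans (IHA _))// -mulrA ler_wpM2l.
Qed.

Lemma poly_cone_selfadjoint A a : selfadjoint X -> poly_cone X A a -> selfadjoint A.
Proof.
move=> sX; elim=> {A a} [|//|k A a _ _ IH|A B a b _ IHA _ IHB|A B a b cA IHA cB IHB] v w.
- by rewrite inner0l inner0r.
- by rewrite innerZl innerZr conjc_real IH.
- by rewrite innerDl innerDr IHA IHB.
(* The adjoint of [A B] is [B A], so the two polynomials in [X] must be shown to commute. *)
- rewrite /= IHA IHB; congr (inner _ _).
  have XA u : X (A u) = A (X u) := poly_cone_commute lX (fun=> erefl) cA u.
  symmetry; exact: (poly_cone_commute (poly_cone_linear cA) (fun u => esym (XA u)) cB).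
Qed.

(* [y_(n+1) = (X + y_n^2) / 2] converges to [1 - sqrt (1 - X)]; the increments
   [y_(n+1) - y_n] are polynomials in [X] with nonnegative coefficients, so
   their norms are controlled by the scalar iteration at [X = 1]. *)
Fixpoint sqrt_iter (n : nat) : V -> V :=
  if n is n'.+1 then fun v => (2^-1)%:C *: (X v + sqrt_iter n' (sqrt_iter n' v)) else fun=> 0.

Fixpoint sqrt_iter1 (n : nat) : R :=
  if n is n'.+1 then 2^-1 * (1 + sqrt_iter1 n' * sqrt_iter1 n') else 0.

Lemma sqrt_iter_cone n : poly_cone X (sqrt_iter n) (sqrt_iter1 n).
Proof.
elim: n => [|n IH]; first exact: poly_cone0.
apply: (poly_coneZ _ (poly_coneD (poly_cone_id X) (poly_coneM IH IH))).
by rewrite invr_ge0.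
Qed.

(** The factorisation [y_(n+2) - y_(n+1) = (y_(n+1) - y_n) (y_(n+1) + y_n) / 2] keeps the
    coefficients nonnegative; it relies on the commutation of the iterates. *)
Lemma sqrt_iter_diff_cone n :
  poly_cone X (fun v => sqrt_iter n.+1 v - sqrt_iter n v) (sqrt_iter1 n.+1 - sqrt_iter1 n).
Proof.
have h0 : 0 <= 2^-1 :> R by rewrite invr_ge0.
elim: n => [|n IH].
  rewrite /= mul0r addr0 subr0 (_ : (fun _ => _) = fun v => (2^-1)%:C *: X v).
    exact: poly_coneZ (poly_cone_id X).
  by apply/funext => v; rewrite addr0 subr0.
have := poly_coneZ h0 (poly_coneM IH (poly_coneD (sqrt_iter_cone n.+1) (sqrt_iter_cone n))).
have -> : 2^-1 * ((sqrt_iter1 n.+1 - sqrt_iter1 n) * (sqrt_iter1 n.+1 + sqrt_iter1 n)) =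
    sqrt_iter1 n.+2 - sqrt_iter1 n.+1.
  transitivity (2^-1 * (1 + sqrt_iter1 n.+1 * sqrt_iter1 n.+1) -
    2^-1 * (1 + sqrt_iter1 n * sqrt_iter1 n)); last by [].
  by move: (sqrt_iter1 n.+1) (sqrt_iter1 n) => a b; ring.
move=> H; move: H; set F := (fun v => _ *: _); set G := (fun v => _ - _).
suff -> : F = G by [].
rewrite /F /G {F G}; apply/funext => v.
have comm := poly_cone_commute (poly_cone_linear (sqrt_iter_cone n))
  (fun v => esym (poly_cone_commute lX (fun=> erefl) (sqrt_iter_cone n) v)) (sqrt_iter_cone n.+1) v.
have lS1 := poly_cone_linear (sqrt_iter_cone n.+1).
have lS0 := poly_cone_linear (sqrt_iter_cone n).
have E1 : sqrt_iter n.+1 v = (2^-1)%:C *: (X v + sqrt_iter n (sqrt_iter n v)) by [].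
have E2 : sqrt_iter n.+2 v = (2^-1)%:C *: (X v + sqrt_iter n.+1 (sqrt_iter n.+1 v)) by [].
rewrite E2 [in X in _ = _ - X]E1.
move: (sqrt_iter n.+1) (sqrt_iter n) comm lS1 lS0 {IH E1 E2} => S1 S0 comm lS1 lS0 /=.
rewrite (linear_mapD lS1) (linear_mapD lS0) comm -scalerBr; congr (_ *: _).
by rewrite addrKA [X v + S1 _]addrC addrKA.
Qed.

Lemma sqrt_iter1_ge0 n : 0 <= sqrt_iter1 n.
Proof.
elim: n => //= n IH; rewrite mulr_ge0 ?invr_ge0// addr_ge0// mulr_ge0//.
Qed.

Lemma sqrt_iter1_le1 n : sqrt_iter1 n <= 1.
Proof.
elim: n => //= n IH; have := mulr_ile1 (sqrt_iter1_ge0 n) (sqrt_iter1_ge0 n) IH IH.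
lra.
Qed.

Hypothesis bX : bounded_by 1 X.
Hypothesis sX : selfadjoint X.

Lemma sqrt_iter1_mono n m : sqrt_iter1 n <= sqrt_iter1 (n + m).
Proof.
elim: m => [|m IH]; first by rewrite addn0.
rewrite addnS (le_trans IH)// -subr_ge0.
exact: (poly_cone_bounded bX (sqrt_iter_diff_cone _)).1.
Qed.

Lemma sqrt_iter_dist n m v :
  hnorm (sqrt_iter (n + m) v - sqrt_iter n v) <= (sqrt_iter1 (n + m) - sqrt_iter1 n) * hnorm v.
Proof.
elim: m => [|m IH]; first by rewrite addn0 !subrr hnorm0 mul0r.
rewrite addnS -(subrKA (sqrt_iter (n + m) v)) -[sqrt_iter1 _.+1 - _](subrKA (sqrt_iter1 (n + m))).
rewrite mulrDl (le_trans (hnormD _ _))// lerD//.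
exact: (poly_cone_bounded bX (sqrt_iter_diff_cone _)).2.
Qed.

(** The rate [eps] is the distance of the scalar iteration to its supremum. It is independent of
    [v]: the convergence is in operator norm. *)
Lemma sqrt_iter_limit : exists (Y : V -> V) (eps : nat -> R),
  [/\ forall n, 0 <= eps n, forall n, eps n.+1 <= eps n,
      forall e, 0 < e -> exists n, eps n < e &
      forall n v, hnorm (sqrt_iter n v - Y v) <= eps n * hnorm v].
Proof.
pose c := sup (range sqrt_iter1).
have hs : has_sup (range sqrt_iter1).
  by split; [exists 0, 0%N|exists 1 => _ [n _ <-]; exact: sqrt_iter1_le1].
have yc n : sqrt_iter1 n <= c by apply: ub_le_sup; [exact: hs.2|exists n].
have near_c e : 0 < e -> exists n, c - sqrt_iter1 n < e.
  move=> e0; have [_ [n _ <-] h] := sup_adherent e0 hs; exists n.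
  by move: h; rewrite -/c; lra.
have /choice[Y HY] : forall v, exists l, forall e : R, 0 < e ->
    exists n, forall i, (n <= i)%N -> hnorm (sqrt_iter i v - l) < e.
  move=> v; apply: hilbert_complete => e e0.
  have v1 : 0 < hnorm v + 1 by have := hnorm_ge0 v; lra.
  have [n Hn] := near_c (e / 2 / (hnorm v + 1)) (divr_gt0 (divr_gt0 e0 (ltr0n R 2)) v1).
  have cl i : (n <= i)%N -> hnorm (sqrt_iter i v - sqrt_iter n v) < e / 2.
    move=> ni; rewrite -(subnKC ni); apply: le_lt_trans (sqrt_iter_dist _ _ _) _.
    have h := yc (n + (i - n))%N.
    have h2 := sqrt_iter1_mono n (i - n).
    have : (sqrt_iter1 (n + (i - n)) - sqrt_iter1 n) * (hnorm v + 1) < e / 2.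
      by rewrite -ltr_pdivlMr//; lra.
    by move: h2; rewrite -subr_ge0; clear -v1 => h2; rewrite mulrDr mulr1; lra.
  exists n => i j ni nj; rewrite -(subrKA (sqrt_iter n v)).
  apply: le_lt_trans (hnormD _ _) _.
  by have := cl i ni; have := cl j nj; rewrite -(hnormN (sqrt_iter j v - _)) opprB; lra.
exists Y, (fun n => c - sqrt_iter1 n); split.
- by move=> n; rewrite subr_ge0.
- by move=> n; rewrite lerD2l lerN2 -[in leRHS]addn1 sqrt_iter1_mono.
- exact: near_c.
- move=> n v; rewrite leNgt; apply/negP => h.
  pose e := hnorm (sqrt_iter n v - Y v) - (c - sqrt_iter1 n) * hnorm v.
  have e0 : 0 < e by rewrite subr_gt0.
  have [m Hm] := HY v e e0.
  have := Hm (n + m)%N (leq_addl _ _); have := sqrt_iter_dist n m v.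
  have := ler_wpM2r (hnorm_ge0 v) (yc (n + m)%N).
  have := hnormB (sqrt_iter (n + m) v - Y v) (sqrt_iter (n + m) v - sqrt_iter n v).
  rewrite opprB addrC subrKA /e !mulrBl; lra.
Qed.

(** Device for passing to the limit: an identity for [Y] holds once its defect is at most
    [eps n * K] for all [n]. *)
Lemma hnorm_small (x : V) (K : R) (eps : nat -> R) : 0 <= K ->
  (forall e, 0 < e -> exists n, eps n < e) -> (forall n, hnorm x <= eps n * K) -> x = 0.
Proof.
move=> K0 He Hx; apply: hnorm_eq0; apply/eqP; rewrite eq_le hnorm_ge0 andbT leNgt.
apply/negP => x0; have K1 : 0 < K + 1 by lra.
have [n Hn] := He (hnorm x / (K + 1)) (divr_gt0 x0 K1).
move: Hn; rewrite ltr_pdivlMr// => Hn; have := Hx n.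
have [e0|e0] := leP 0 (eps n); first by lra.
have : eps n * K <= 0 by rewrite nmulr_rle0.
lra.
Qed.

(** The equation says [(1 - Y)^2 = 1 - X], and the last clause lets [Y] inherit commutation with the
    group and with [A] in [selfadjoint_intertwiner_sign]. *)
Lemma operator_sqrt : exists Y : V -> V,
  [/\ linear_map Y, selfadjoint Y, bounded_by 1 Y,
      forall v, Y v + Y v = X v + Y (Y v) &
      forall T k, linear_map T -> bounded_by k T -> (forall v, T (X v) = X (T v)) ->
        forall v, T (Y v) = Y (T v)].
Proof.
have [Y [eps [eps0 epsS epsl HY]]] := sqrt_iter_limit.
have lS n := poly_cone_linear (sqrt_iter_cone n).
have bS n v : hnorm (sqrt_iter n v) <= hnorm v.
  have [_ b] := poly_cone_bounded bX (sqrt_iter_cone n); apply: le_trans (b v) _.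
  by rewrite ler_piMl ?hnorm_ge0// sqrt_iter1_le1.
have bY : bounded_by 1 Y.
  move=> v; rewrite mul1r leNgt; apply/negP => h.
  have v1 : 0 < hnorm v + 1 by have := hnorm_ge0 v; lra.
  have h' : 0 < hnorm (Y v) - hnorm v by rewrite subr_gt0.
  have [n Hn] := epsl ((hnorm (Y v) - hnorm v) / (hnorm v + 1)) (divr_gt0 h' v1).
  move: Hn; rewrite ltr_pdivlMr// mulrDr mulr1; have := HY n v; have := bS n v; have := eps0 n.
  have := hnormB (sqrt_iter n v) (sqrt_iter n v - Y v); rewrite opprB addrC subrK; lra.
have lY : linear_map Y.
  move=> a v w; apply/eqP; rewrite -subr_eq0; apply/eqP.
  apply: (@hnorm_small _ (hnorm (a *: v + w) + (Normc.normc a * hnorm v + hnorm w)) eps) => //.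
    by rewrite !addr_ge0 ?mulr_ge0 ?hnorm_ge0 ?sqrtr_ge0//; case: a => ? ?; exact: sqrtr_ge0.
  move=> n; have -> : Y (a *: v + w) - (a *: Y v + Y w) =
     (a *: (sqrt_iter n v - Y v) + (sqrt_iter n w - Y w)) - (sqrt_iter n (a *: v + w) - Y (a *: v + w)).
    by rewrite lS scalerBr addrACA -opprD opprB [RHS]addrC subrKA.
  apply: le_trans (hnormB _ _) _; rewrite addrC mulrDr lerD ?HY//.
  apply: le_trans (hnormD _ _) _; rewrite mulrDr lerD ?HY//.
  rewrite hnormZ mulrCA ler_wpM2l ?HY//; case: a => ? ?; exact: sqrtr_ge0.
have cY T k : linear_map T -> bounded_by k T -> (forall v, T (X v) = X (T v)) ->
        forall v, T (Y v) = Y (T v).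
  move=> lT bT TX v; apply/eqP; rewrite -subr_eq0; apply/eqP.
  apply: (@hnorm_small _ (hnorm (T v) + `|k| * hnorm v) eps) => //.
    by rewrite addr_ge0 ?mulr_ge0 ?hnorm_ge0.
  move=> n; have -> : T (Y v) - Y (T v) = (sqrt_iter n (T v) - Y (T v)) - T (sqrt_iter n v - Y v).
    rewrite (linear_mapB lT) (poly_cone_commute lT TX (sqrt_iter_cone n)).
    by rewrite opprB [RHS]addrC subrKA.
  apply: le_trans (hnormB _ _) _; rewrite mulrDr lerD ?HY//.
  apply: le_trans (bT _) _; apply: (@le_trans _ _ (`|k| * hnorm (sqrt_iter n v - Y v))).
    by rewrite ler_wpM2r ?hnorm_ge0// ler_norm.
  by rewrite mulrCA ler_wpM2l.
exists Y; split=> //.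
- have Re_eq v w : complex.Re (inner (Y v) w) = complex.Re (inner v (Y w)).
    apply/eqP; rewrite -subr_eq0 -normr_le0 leNgt; apply/negP => h.
    pose K := 2 * (hnorm v * hnorm w) + 1.
    have K0 : 0 < K by have := mulr_ge0 (hnorm_ge0 v) (hnorm_ge0 w); rewrite /K; lra.
    have [n Hn] := epsl _ (divr_gt0 h K0).
    move: Hn; rewrite ltr_pdivlMr//; apply/negP; rewrite -leNgt.
    have sn := poly_cone_selfadjoint sX (sqrt_iter_cone n) v w.
    have -> : complex.Re (inner (Y v) w) - complex.Re (inner v (Y w)) =
      complex.Re (inner (Y v - sqrt_iter n v) w) + complex.Re (inner v (sqrt_iter n w - Y w)).
      rewrite innerDl innerDr innerNl innerNr sn.
      by case: (inner (Y v) w); case: (inner v _); case: (inner v _) => ? ? ? ? ? ? /=; ring.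
    have absRe (x y : V) : `|complex.Re (inner x y)| <= hnorm x * hnorm y.
      rewrite ler_norml Re_inner_le andbT.
      have := Re_inner_le (- x) y; rewrite innerNl hnormN; case: (inner x y) => ? ? /=; lra.
    apply: le_trans (ler_normD _ _) _.
    have e1 := absRe (Y v - sqrt_iter n v) w; have e2 := absRe v (sqrt_iter n w - Y w).
    have h1 := ler_wpM2r (hnorm_ge0 w) (HY n v).
    have h2 := ler_wpM2l (hnorm_ge0 v) (HY n w).
    rewrite -(hnormN (_ - Y v)) opprB in h1.
    rewrite -[leRHS]mulrA in h1; rewrite [leRHS]mulrCA in h2.
    by have := eps0 n; rewrite /K mulrDr mulr1; lra.
  move=> v w; have h1 := Re_eq v w; have h2 := Re_eq ('i%C *: v) w.
  move: h1 h2; rewrite (linear_mapZ lY) !innerZl.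
  case: (inner (Y v) w) => p q; case: (inner v _) => p' q' /= -> h2.
  by apply/eqP; rewrite eq_complex /= eqxx /=; apply/eqP; lra.
- move=> v; apply/eqP; rewrite -subr_eq0; apply/eqP.
  (* The defect splits into four differences, each of norm at most [eps n * hnorm v]. *)
  apply: (@hnorm_small _ (4 * hnorm v) eps) => //; first by rewrite mulr_ge0 ?hnorm_ge0.
  move=> n; have -> : Y v + Y v - (X v + Y (Y v)) =
     (sqrt_iter n (sqrt_iter n v - Y v) + (sqrt_iter n (Y v) - Y (Y v))) -
     ((sqrt_iter n.+1 v - Y v) + (sqrt_iter n.+1 v - Y v)).
    have E : sqrt_iter n.+1 v + sqrt_iter n.+1 v = X v + sqrt_iter n (sqrt_iter n v).
      by rewrite /= -scalerDl -rmorphD (_ : 2^-1 + 2^-1 = 1) ?scale1r//; lra.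
    rewrite (linear_mapB (lS n)) subrKA addrACA E -opprD opprB.
    move: (Y v + Y v) (X v) (Y (Y v)) (sqrt_iter n (sqrt_iter n v)) => a b c d.
    by rewrite [RHS]addrC (opprD b d) (addrA a) subrKA opprD addrA.
  apply: le_trans (hnormB _ _) _.
  have h1 := bS n (sqrt_iter n v - Y v); have h2 := HY n v; have h3 := HY n (Y v).
  have h4 := HY n.+1 v; have := ler_wpM2r (hnorm_ge0 v) (epsS n).
  have := ler_wpM2l (eps0 n) (bY v); rewrite mul1r.
  have := hnormD (sqrt_iter n (sqrt_iter n v - Y v)) (sqrt_iter n (Y v) - Y (Y v)).
  have := hnormD (sqrt_iter n.+1 v - Y v) (sqrt_iter n.+1 v - Y v).
  by rewrite (mulrCA (eps n)); clear -h1 h2 h3 h4 => *; lra.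
Qed.

End SquareRoot.

(** * Closedness of common zero sets of Lipschitz functions *)

Section ClosedZeroSets.
Context {R : realType} (V : hilbertType R).

Lemma closed_zero_set (I : Type) (f : I -> V -> R) (k : I -> R) :
  (forall i v w, `|f i v - f i w| <= k i * hnorm (v - w)) ->
  closed [set v | forall i, f i v = 0].
Proof.
move=> fk p clp i /=; apply/eqP; rewrite -normr_eq0 eq_le normr_ge0 andbT leNgt.
apply/negP => fp0.
have k1 : 0 < `|k i| + 1 by rewrite ltr_wpDl.
pose e := `|f i p| / (`|k i| + 1).
have e0 : 0 < e by rewrite divr_gt0.
have [|w [/= w0 pw]] := clp (ball p e%:C); first by apply: nbhsx_ballx; rewrite ltcR.
move: pw; rewrite -ball_normE /= hnormE ltcR => pw.
have := fk i p w; rewrite w0 subr0 leNgt; apply/negP; rewrite negbK.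
apply: (@le_lt_trans _ _ ((`|k i| + 1) * hnorm (p - w))).
  by rewrite ler_wpM2r ?hnorm_ge0// (le_trans (ler_norm _))// lerDl.
by rewrite mulrC -ltr_pdivlMr.
Qed.

Lemma hnorm_dist (v w : V) : `|hnorm v - hnorm w| <= hnorm (v - w).
Proof.
rewrite ler_norml; have := hnormD (v - w) w; rewrite subrK.
have := hnormD (w - v) v; rewrite subrK -opprB hnormN => h1 h2.
by apply/andP; split; lra.
Qed.

End ClosedZeroSets.

(** * Schur's lemma and the central character *)

Section Schur.
Context {R : realType} {N M : nat} {Q : hermitian_map R N M} {V : hilbertType R}.
Variable pi : unitary_rep Q V.
Hypothesis pi_irr : irreducible_rep pi.
Local Notation C := R[i].

Lemma linear_map_scale (k : C) (A : V -> V) :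
  linear_map A -> linear_map (fun v => k *: A v).
Proof. by move=> lA a v w; rewrite lA scalerDr !scalerA mulrC. Qed.

Lemma linear_map_sub (A B : V -> V) :
  linear_map A -> linear_map B -> linear_map (fun v => A v - B v).
Proof. by move=> lA lB a v w; rewrite lA lB scalerBr opprD addrACA. Qed.

Lemma linear_map_add (A B : V -> V) :
  linear_map A -> linear_map B -> linear_map (fun v => A v + B v).
Proof. by move=> lA lB a v w; rewrite lA lB scalerDr addrACA. Qed.

Definition intertwines (A : V -> V) : Prop := forall g v, A (pi g v) = pi g (A v).

Lemma rep_linear_map g : linear_map (pi g).
Proof. by move=> a v w; exact: rep_linear. Qed.

Lemma rep_hnorm g v : hnorm (pi g v) = hnorm v.
Proof.
have := rep_inner pi g v v; rewrite !innerE => /complexI/eqP.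
by rewrite eqrXn2 ?hnorm_ge0// => /eqP.
Qed.

Lemma intertwiner_kernel A k : linear_map A -> bounded_by k A -> intertwines A ->
  (forall v, A v = 0) \/ (forall v, A v = 0 -> v = 0).
Proof.
move=> lA bA cA.
have WE : [set v | A v = 0] = [set v | forall i : unit, hnorm (A v) = 0].
  apply/seteqP; split=> v /= => [Av _|/(_ tt)/hnorm_eq0//]; by rewrite Av hnorm0.
have [||||W0|WT] := pi_irr.2 [set v | A v = 0].
- rewrite WE; apply: (@closed_zero_set _ _ unit (fun _ v => hnorm (A v)) (fun=> k)) => _ v w.
  by rewrite (le_trans (hnorm_dist _ _))// -(linear_mapB lA).
- exact: linear_map0.
- by move=> a v w /= Av Aw; rewrite lA Av Aw scaler0 addr0.
- by move=> g v /= Av; rewrite cA Av (linear_map0 (rep_linear_map g)).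
- by right=> v Av; have : [set v | A v = 0] v by []; rewrite W0.
- by left=> v; have : setT v by []; rewrite -WT.
Qed.

(** Let [B] be the positive square root of [A^2]. Then [(B - A) (B + A) = 0], and [B - A] is an
    intertwiner, so it is zero or injective; hence [A = B] or [A = - B]. *)
Lemma selfadjoint_intertwiner_sign A :
  linear_map A -> selfadjoint A -> bounded_by 1 A -> intertwines A ->
  (forall v, 0 <= complex.Re (inner (A v) v)) \/ (forall v, complex.Re (inner (A v) v) <= 0).
Proof.
move=> lA sA bA cA.
pose X v := v - A (A v).
have lX : linear_map X.
  by apply: linear_map_sub => // a v w; rewrite !lA.
have sX : selfadjoint X.
  by move=> v w; rewrite /X innerDl innerDr innerNl innerNr !sA.
have bX : bounded_by 1 X.
  move=> v; rewrite mul1r -(@ler_pXn2r _ 2%N isT) ?nnegrE ?hnorm_ge0//.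
  rewrite /X hnorm_sqrD hnormN innerNr -sA innerE /=.
  have : hnorm (A (A v)) ^+ 2 <= hnorm (A v) ^+ 2.
    by rewrite (@ler_pXn2r _ 2%N isT) ?nnegrE ?hnorm_ge0//; have := bA (A v); rewrite mul1r.
  by have := sqr_ge0 (hnorm (A v)); lra.
have [Y [lY sY bY YE cY]] := operator_sqrt lX bX sX.
have AY v : A (Y v) = Y (A v).
  by apply: (cY A 1) => // w; rewrite /X (linear_mapB lA).
have piY : intertwines Y.
  move=> g v; symmetry; apply: (cY (pi g) 1).
  - exact: rep_linear_map.
  - by move=> w; rewrite rep_hnorm mul1r.
  - by move=> w; rewrite /X (linear_mapB (rep_linear_map g)) !cA.
(* [B = 1 - Y] is a square root of [A^2]. *)
pose B v := v - Y v.
have BB v : B (B v) = A (A v).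
  have := YE v; rewrite /B /X (linear_mapB lY) => E.
  have -> : Y (Y v) = Y v + Y v - (v - A (A v)) by rewrite E addrC addKr.
  move: (Y v) (A (A v)) => a b.
  have -> : a - (a + a - (v - b)) = v - b - a by rewrite (opprB (a + a)) addrCA opprD (addrA a) subrr add0r.
  by rewrite (opprB (v - b)) subrKA opprB addrC subrK.
have lB : linear_map B by apply: linear_map_sub.
have Bpos v : 0 <= complex.Re (inner (B v) v).
  have := Re_inner_le (Y v) v; have := bY v; rewrite /B innerDl innerNl innerE mul1r => h1 h2.
  have := ler_wpM2r (hnorm_ge0 v) h1; rewrite -expr2.
  by move: h2; case: (inner (Y v) v) => p q /=; lra.
pose E v := B v - A v; pose F v := B v + A v.
have [|||E0|E0] := @intertwiner_kernel E 3.
- exact: linear_map_sub.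
- move=> v; rewrite /E /B; have := hnormB (v - Y v) (A v); have := hnormB v (Y v).
  by have := bY v; have := bA v; lra.
- move=> g v; rewrite /E /B piY cA !(linear_mapB (rep_linear_map g)).
  by [].
- left=> v; have -> : A v = B v by apply/eqP; rewrite eq_sym -subr_eq0; apply/eqP; exact: E0.
  exact: Bpos.
- right=> v; have F0 : F v = 0.
    apply: E0; rewrite /E /F (linear_mapD lB) (linear_mapD lA) BB.
    have -> : B (A v) = A (B v) by rewrite /B (linear_mapB lA) AY.
    by rewrite [A (A v) + _]addrC subrr.
  have -> : A v = - B v by apply/eqP; rewrite -addr_eq0 addrC; apply/eqP.
  by rewrite innerNl; have := Bpos v; case: (inner _ _) => p q /=; rewrite oppr_le0.
Qed.

(** Polarisation: at [v + D v] the cross terms of the form add up to [2 |D v|^2]. *)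
Lemma selfadjoint_form0 (D : V -> V) : linear_map D -> selfadjoint D ->
  (forall v, complex.Re (inner (D v) v) = 0) -> forall v, D v = 0.
Proof.
move=> lD sD D0 v; apply: hnorm_eq0; apply/eqP; rewrite -sqrf_eq0; apply/eqP.
have := D0 (v + D v); rewrite (linear_mapD lD) !innerDl !innerDr (sD (D v) v).
have := D0 v; have := D0 (D v).
have -> : inner (D v) (D v) = (hnorm (D v) ^+ 2)%:C by exact: innerE.
by case: (inner (D v) v) => ? ?; case: (inner _ _) => ? ? /=; lra.
Qed.

(** Let [c] be the Rayleigh quotient at a nonzero [v0]. Each [A - (c + e)] is semidefinite, and its
    value at [v0] decides the sign; so [e] and [- e] squeeze the form of [A - c] to 0. *)
Lemma selfadjoint_intertwiner_scalar A :
  linear_map A -> selfadjoint A -> bounded_by 1 A -> intertwines A ->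
  exists c : R, forall v, A v = c%:C *: v.
Proof.
move=> lA sA bA cA.
have [v0 v00] := pi_irr.1.
pose n0 := hnorm v0 ^+ 2.
have n00 : 0 < n0.
  rewrite exprn_gt0// lt_neqAle hnorm_ge0 andbT eq_sym; apply/eqP => /hnorm_eq0 h.
  by rewrite h eqxx in v00.
pose q v := complex.Re (inner (A v) v).
pose c := q v0 / n0.
have qc : q v0 = c * n0 by rewrite /c divfK// gt_eqF.
have c1 : `|c| <= 1.
  have h1 : q v0 <= n0.
    apply: le_trans (Re_inner_le _ _) _; rewrite /n0 expr2 ler_wpM2r ?hnorm_ge0//.
    by have := bA v0; rewrite mul1r.
  have h2 : - n0 <= q v0.
    have := Re_inner_le (- A v0) v0; rewrite innerNl hnormN.
    have : hnorm (A v0) * hnorm v0 <= n0.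
      by rewrite /n0 expr2 ler_wpM2r ?hnorm_ge0//; have := bA v0; rewrite mul1r.
    by rewrite /q; case: (inner _ _) => ? ? /=; lra.
  by rewrite ler_norml /c ler_pdivlMr// ler_pdivrMr// mulN1r mul1r h1 h2.
exists c => v.
pose D v := A v - c%:C *: v.
have lD : linear_map D by apply: linear_map_sub => //; exact: linear_map_scale.
have sD : selfadjoint D.
  by move=> v1 w; rewrite /D innerDl innerDr innerNl innerNr innerZl innerZr conjc_real sA.
have qD v1 : complex.Re (inner (D v1) v1) = q v1 - c * hnorm v1 ^+ 2.
  rewrite /D innerDl innerNl innerZl innerE /q.
  by case: (inner _ _) => ? ? /=; ring.
have shift (e : R) : `|e| <= 1 ->
    (forall v, c * hnorm v ^+ 2 + e * hnorm v ^+ 2 <= q v) \/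
    (forall v, q v <= c * hnorm v ^+ 2 + e * hnorm v ^+ 2).
  (* Since [|c + e| <= 2], the factor [1 / 3] makes [A'] a contraction. *)
  move=> e1; pose A' v := (3^-1)%:C *: (A v - (c + e)%:C *: v).
  have n3 : 0 <= 3^-1 :> R by rewrite invr_ge0.
  have qA' v1 : complex.Re (inner (A' v1) v1) = 3^-1 * (q v1 - (c + e) * hnorm v1 ^+ 2).
    rewrite /A' innerZl innerDl innerNl innerZl innerE /q.
    by case: (inner _ _) => ? ? /=; ring.
  have [||||H|H] := @selfadjoint_intertwiner_sign A'.
  - by apply: linear_map_scale; apply: linear_map_sub => //; exact: linear_map_scale.
  - move=> v1 w; rewrite /A' innerZl innerZr innerDl innerDr innerNl innerNr innerZl innerZr.
    by rewrite !conjc_real sA.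
  - move=> v1; rewrite /A' hnormZR// mul1r -ler_pdivlMl ?invr_gt0// invrK.
    apply: le_trans (hnormB _ _) _; rewrite hnormZ.
    have -> : Normc.normc (c + e)%:C = `|c + e| by rewrite /= expr0n addr0 sqrtr_sqr.
    have := bA v1; have : `|c + e| * hnorm v1 <= 2 * hnorm v1.
      rewrite ler_wpM2r ?hnorm_ge0//; have := ler_normD c e; lra.
    by lra.
  - by move=> g v1; rewrite /A' cA -(linear_mapZ (rep_linear_map g)) -(linear_mapB (rep_linear_map g)) (linear_mapZ (rep_linear_map g)).
  - by left=> v1; have := H v1; rewrite qA' pmulr_rge0 ?invr_gt0//; lra.
  - by right=> v1; have := H v1; rewrite qA' pmulr_rle0 ?invr_gt0//; lra.
have q0 v1 : q v1 = c * hnorm v1 ^+ 2.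
  have small e : 0 < e -> e <= 1 -> `|q v1 - c * hnorm v1 ^+ 2| <= e * hnorm v1 ^+ 2.
    move=> e0 e1; have en : 0 < e * n0 by rewrite mulr_gt0.
    have [|/(_ v0)|up] := shift e; first by rewrite gtr0_norm.
      by rewrite qc -/n0; lra.
    have [|lo|/(_ v0)] := shift (- e); first by rewrite normrN gtr0_norm.
      by rewrite ler_norml; have := up v1; have := lo v1; lra.
    by rewrite qc -/n0; lra.
  apply/eqP; rewrite -subr_eq0 -normr_le0 leNgt; apply/negP => d0.
  move: small; set d := `|_| in d0 *; set s := hnorm v1 ^+ 2 => small.
  have s0 : 0 <= s by rewrite sqr_ge0.
  have s1 : 0 < s + 1 by lra.
  pose e := Num.min 1 (d / (s + 1)).
  have e0 : 0 < e by rewrite lt_min ltr01 divr_gt0.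
  have := small e e0; rewrite ge_min lexx => /(_ isT) h.
  have : e * s <= d / (s + 1) * s by rewrite ler_wpM2r// ge_min lexx orbT.
  have -> : d / (s + 1) * s = d - d / (s + 1) by field; rewrite gt_eqF.
  by have := divr_gt0 d0 s1; lra.
have D0 v1 : complex.Re (inner (D v1) v1) = 0 by rewrite qD q0 subrr.
have /eqP := selfadjoint_form0 lD sD D0 v.
by rewrite subr_eq0 => /eqP.
Qed.

(** [U'] is the adjoint of [U]; [(U + U') / 2] and [i (U - U') / 2] are self-adjoint, hence scalars
    [c1] and [c2], and [U = c1 - i c2]. *)
Lemma schur (U U' : V -> V) : linear_map U -> linear_map U' ->
  bounded_by 1 U -> bounded_by 1 U' -> intertwines U -> intertwines U' ->
  (forall v w, inner (U v) w = inner v (U' w)) -> exists chi : C, forall v, U v = chi *: v.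
Proof.
move=> lU lU' bU bU' cU cU' adj.
have adj' v w : inner (U' v) w = inner v (U w).
  by rewrite inner_conj -adj -inner_conj.
have n2 : 0 <= 2^-1 :> R by rewrite invr_ge0.
have lp (g : heis Q) := rep_linear_map g.
have [||||c1 H1] := @selfadjoint_intertwiner_scalar (fun v => (2^-1)%:C *: (U v + U' v)).
- by apply: linear_map_scale; exact: linear_map_add.
- by move=> v w; rewrite innerZl innerZr innerDl innerDr adj adj' conjc_real addrC.
- move=> v; rewrite hnormZR// mul1r -ler_pdivlMl ?invr_gt0// invrK.
  by apply: le_trans (hnormD _ _) _; have := bU v; have := bU' v; lra.
- by move=> g v; rewrite (linear_mapZ (lp g)) (linear_mapD (lp g)) cU cU'.
have [||||c2 H2] := @selfadjoint_intertwiner_scalar (fun v => (Complex 0 2^-1) *: (U v - U' v)).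
- by apply: linear_map_scale; exact: linear_map_sub.
- move=> v w; rewrite innerZl innerZr innerDl innerDr innerNl innerNr adj adj'.
  case: (inner _ _) => p q; case: (inner _ _) => p' q'.
  by apply/eqP; rewrite eq_complex /=; apply/andP; split; apply/eqP; ring.
- move=> v; rewrite hnormZ mul1r.
  have -> : Normc.normc (Complex 0 2^-1) = 2^-1 :> R by rewrite /= expr0n add0r sqrtr_sqr ger0_norm.
  rewrite -ler_pdivlMl ?invr_gt0// invrK.
  by apply: le_trans (hnormB _ _) _; have := bU v; have := bU' v; lra.
- by move=> g v; rewrite (linear_mapZ (lp g)) (linear_mapB (lp g)) cU cU'.
exists (Complex c1 (- c2)) => v.
have -> : Complex c1 (- c2) = c1%:C + (- 'i%C) * c2%:C.
  by apply/eqP; rewrite eq_complex /=; apply/andP; split; apply/eqP; ring.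
rewrite scalerDl -scalerA -H1 -H2 scalerA.
have -> : - 'i%C * Complex 0 2^-1 = (2^-1)%:C :> C.
  by apply/eqP; rewrite eq_complex /=; apply/andP; split; apply/eqP; ring.
rewrite -scalerDr addrACA subrr addr0 scalerDr -scalerDl -rmorphD.
by rewrite (_ : 2^-1 + 2^-1 = 1) ?rmorph1 ?scale1r//; lra.
Qed.

Lemma heis_central (x : 'rV[R]_N) (g : heis Q) : (((x, 0) : heis Q) * g = g * ((x, 0) : heis Q))%g.
Proof.
have ImV0 : Defs.ImV (0 : 'rV[C]_N) = 0 by apply/matrixP => i j; rewrite !mxE.
change (heis_mul ((x, 0) : heis Q) g = heis_mul g ((x, 0) : heis Q)).
by rewrite /heis_mul /= hmap0l hmap0r ImV0 scaler0 !addr0 add0r [x + _]addrC.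
Qed.

Lemma central_character (x : 'rV[R]_N) :
  exists chi : C, forall v, pi ((x, 0) : heis Q) v = chi *: v.
Proof.
set z := ((x, 0) : heis Q).
have zV (g : heis Q) : (z^-1 * g = g * z^-1)%g.
  have zE : (z^-1%g : heis Q) = ((- x, 0) : heis Q).
    by change (heis_inv z = ((- x, 0) : heis Q)); rewrite /heis_inv /= oppr0.
  by rewrite zE heis_central.
apply: (@schur (pi z) (pi z^-1%g)).
- exact: rep_linear_map.
- exact: rep_linear_map.
- by move=> v; rewrite rep_hnorm mul1r.
- by move=> v; rewrite rep_hnorm mul1r.
- by move=> g v; rewrite -!repM heis_central.
- by move=> g v; rewrite -!repM zV.
- by move=> v w; rewrite -(rep_inner pi z^-1%g) -repM mulVg rep1.
Qed.

End Schur.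

(** * Vanishing of sections under the group action *)

Section TotalSpaceFacts.
Context {R : realType} {N M : nat} {Omega : set 'rV[R]_N}.
Context {Q : hermitian_map R N M}.
Local Notation D := (siegel Q Omega).
Local Notation C := R[i].

(** Being zero passes along an equality of the total space, without any transport between the
    fibres. *)
Lemma tvec_eq0 (L : line_bundle Omega Q) (t t' : Defs.total L) : t = t' -> tvec t = 0 -> tvec t' = 0.
Proof. by move=> ->. Qed.

Variable L : equivariant_line_bundle Omega Q.
Implicit Types (s t : section L) (g : heis Q).

Lemma bact_eq0 g (x : D) (v : L x) : bact L g x v = 0 -> v = 0.
Proof.
move=> gv; have := bactM (e := L) g^-1%g g v; rewrite mulVg bact1.
by move=> /esym/tvec_eq0; apply; rewrite /= gv linear0.
Qed.

Lemma sact_eq0 g s (x : D) : s x = 0 <-> sact g s (nact g x) = 0.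
Proof.
have xE : nact g^-1%g (nact g x) = x by rewrite -nactM mulVg nact1.
have E : Total (sact g s (nact g x)) = Total (bact L g x (s x)).
  rewrite sactE; move: (nact g^-1%g (nact g x)) xE => y yx.
  by rewrite yx.
split=> [sx|/(tvec_eq0 E)/bact_eq0//].
by apply: (tvec_eq0 (esym E)); rewrite /= sx linear0.
Qed.

Lemma sact_linear g (a : C) s t (x : D) :
  sact g (fun y => a *: s y + t y) x = a *: sact g s x + sact g t x.
Proof.
rewrite /sact linearP; move: (bact L g _ _) (bact L g _ _) (nactVK g x).
by move: (nact g _) => y v w e; case: x / e.
Qed.

Lemma siegelE (p : 'rV[C]_N * 'rV[C]_M) :
  siegel Q Omega p <-> Omega (Defs.ImV p.1 - Defs.ReV (Q p.2 p.2)).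
Proof.
have reQ : Defs.toC (Defs.ReV (Q p.2 p.2)) = Q p.2 p.2.
  have /matrixP h := hmapxx Q p.2; apply/matrixP => i j; have := h i j; rewrite !mxE.
  by case: (Q p.2 p.2 i j) => a b /= [e]; apply/eqP; rewrite eq_complex /= eqxx /=; apply/eqP; lra.
have toCB (x y : 'rV[R]_N) : Defs.toC (x - y) = Defs.toC x - Defs.toC y.
  by apply/matrixP => i j; rewrite !mxE rmorphB.
split=> [[y Oy yE]|O].
  rewrite (_ : _ - _ = y)//; apply: toC_inj.
  by rewrite toCB reQ -yE.
by exists (Defs.ImV p.1 - Defs.ReV (Q p.2 p.2)) => //; rewrite toCB reQ.
Qed.

Lemma mk_siegel (p : 'rV[C]_N * 'rV[C]_M) : siegel Q Omega p -> exists x : D, val x = p.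
Proof. by move=> Dp; exists (SigSub (mem_set Dp)). Qed.

Lemma siegelP (x : D) : siegel Q Omega (val x).
Proof. exact: set_valP. Qed.

Lemma valL_val (f : D -> C) (x : D) : 'valL_(0) f (val x) = f x.
Proof. by have /(congr1 (@^~ x)) := valLK 0 f. Qed.

Lemma nact_translation (a : 'rV[R]_N) (x : D) :
  val (nact ((a, 0) : heis Q) x) = ((val x).1 + Defs.toC a, (val x).2).
Proof. by rewrite /= /naff /= !hmap0r !scaler0 !addr0. Qed.

End TotalSpaceFacts.

(** * Evaluations are bounded functionals *)

Section Trivializations.
Context {R : realType} {N M : nat} {Omega : set 'rV[R]_N}.
Context {Q : hermitian_map R N M}.
Variable L : line_bundle Omega Q.
Local Notation D := (siegel Q Omega).
Local Notation C := R[i].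
Local Notation normc := Normc.normc.

Lemma triv_eq0 i (x : D) (v : L x) : chart i x -> triv i x v = 0 -> v = 0.
Proof.
by move=> ix v0; apply: (bij_inj (triv_bij ix)); rewrite linear0.
Qed.

Lemma holomorphic_on_continuous (W : set D) (f : D -> C) :
  holomorphic_on W f -> forall x, W x -> {for x, continuous f}.
Proof.
move=> hf x Wx.
have -> : f = 'valL_(0) f \o val by apply/funext => y; exact/esym/valL_val.
apply: continuous_comp; first exact: initial_continuous.
exact: differentiable_continuous (hf x Wx).
Qed.

(** The test set through which the compact-open topology yields a bound at a point. *)
Definition small_vectors i : set (Defs.total L) :=
  [set t | chart i (tbase t) /\ `|triv i (tbase t) (tvec t)| < 1].

(** Seen in a chart [j], the set is cut out by [|t x * c| < 1], with [t] the continuous transition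
    function. *)
Lemma open_small_vectors i : open (small_vectors i).
Proof.
move=> j /=; have [t ht tE] := triv_holo (l := L) j i.
rewrite (_ : [set _ | _] = [set p : D * C | (chart j p.1 /\ chart i p.1) /\ `|t p.1 * p.2| < 1]).
  rewrite openE => -[x c] /= [[jx ix] tc].
  have near_chart (k : atlas L) : chart k x -> \forall p \near (x, c), chart k p.1.
    move=> kx; apply: (@cvg_fst _ _ (nbhs x) (nbhs c)); apply: open_nbhs_nbhs.
    by split; [exact: chart_open|].
  have cj := near_chart j jx; have ci := near_chart i ix.
  have ct : {for (x, c), continuous (fun p : D * C => t p.1 * p.2)}.
    apply: cvgM; last exact: cvg_snd.
    apply: (@continuous_comp _ _ _ fst t); first exact: cvg_fst.
    exact: (holomorphic_on_continuous ht).
  have cl : \forall p \near (x, c), `|t p.1 * p.2| < 1.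
    have /cvgrPdist_lt /(_ (1 - `|t x * c|)) := ct; rewrite subr_gt0 => /(_ tc).
    apply: filterS => p; rewrite ltrBrDl; apply: le_lt_trans.
    by rewrite -{1}[_ * p.2](subKr (t x * c)) ler_normB.
  by near=> p; split; [split|]; near: p.
apply/seteqP; split=> -[x c] /=.
  by move=> [jx [v vc [ix vl]]]; rewrite -vc -tE.
move=> [[jx ix] tc]; split=> //; have [f fK Kf] := triv_bij jx.
by exists (f c) => //; split=> //=; rewrite (tE _ jx ix) Kf.
Unshelve. all: by end_near. Qed.

(** Continuity at 0, tested on the compact set [[set x]], controls a ball of radius [e]; homogeneity
    does the rest. Rescaling to norm [e / 2] gives the constant [2 / e]. *)
Lemma pointwise_bounded (V : hilbertType R) (T : V -> section L) (x : D) i :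
  chart i x -> (forall (a : C) v w, T (a *: v + w) x = a *: T v x + T w x) ->
  continuous (fun v => graph (T v)) ->
  exists K : R, forall v, normc (triv i x (T v x)) <= K * hnorm v.
Proof.
move=> ix lT cT.
have lf (a : C) v w : triv i x (T (a *: v + w) x) = a * triv i x (T v x) + triv i x (T w x).
  by rewrite lT linearP.
have T0 : T 0 x = 0.
  have := lT 1 0 0; rewrite !scale1r addr0 => /eqP.
  by rewrite -{1}[T 0 x]addr0 => /eqP/addrI/esym.
have := cT 0; move/compact_open_cvgP => /(_ [set x] (small_vectors i)).
have cx : compact [set x] by exact: compact_set1.
move=> /(_ cx (@open_small_vectors i)).
have im0 : graph (T 0) @` [set x] `<=` small_vectors i.
  by move=> _ [_ -> <-]; split=> //=; rewrite T0 linear0 normr0.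
move=> /(_ im0) /nbhs_ballP[[e e'] /= e0 He].
move: e0; rewrite ltcE /= => /andP[/eqP e'0 e0].
have small v : hnorm v < e -> normc (triv i x (T v x)) < 1.
  move=> ve; have := He v; rewrite -ball_normE /= sub0r normrN hnormE ltcE /= e'0 eqxx => /(_ ve).
  move=> /(_ (Total (T v x))) [|_ /=]; first by exists x.
  by rewrite normcE ltcE /= eqxx.
have lZ (a : C) v : triv i x (T (a *: v) x) = a * triv i x (T v x).
  by have := lf a v 0; rewrite !addr0 T0 linear0 addr0.
exists (2 / e) => v.
have [v0|v0] := eqVneq v 0.
  by rewrite v0 T0 linear0 Normc.normc0 hnorm0 mulr0.
have n0 : 0 < hnorm v.
  by rewrite lt_neqAle hnorm_ge0 andbT eq_sym; apply: contraNneq v0 => /hnorm_eq0 ->.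
pose k := e / (2 * hnorm v).
have k0 : 0 < k by rewrite divr_gt0 ?mulr_gt0.
have tk : normc (triv i x (T (k%:C *: v) x)) = k * normc (triv i x (T v x)).
  by rewrite lZ Normc.normcM /= expr0n addr0 sqrtr_sqr gtr0_norm.
have := small (k%:C *: v); rewrite (hnormZR v (ltW k0)) tk.
have -> : k * hnorm v = e / 2 by rewrite /k; field; rewrite gt_eqF.
have -> : 2 / e * hnorm v = k^-1 by rewrite /k; field; rewrite !gt_eqF.
move=> H; have e2 : e / 2 < e by lra.
by rewrite -[leRHS]mulr1 ler_pdivlMl// ltW// H.
Qed.

End Trivializations.

(** * Propagation of zeros through the Siegel domain *)

Section Continuation.
Context {R : realType} {N M : nat} {Omega : set 'rV[R]_N}.
Context {Q : hermitian_map R N M}.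
Hypothesis Omega_open : open Omega.
Hypothesis Omega_convex : forall (x y : 'rV[R]_N) (t : R), 0 <= t <= 1 ->
  Omega x -> Omega y -> Omega ((1 - t) *: x + t *: y).
Hypothesis Omega_scale : forall (t : R) (x : 'rV[R]_N), 0 < t -> Omega x -> Omega (t *: x).
Local Notation D := (siegel Q Omega).
Local Notation C := R[i].
Local Notation E := ('rV[C]_N * 'rV[C]_M)%type.

(** Connectedness of the segment: a step past the supremum of the good parameters contradicts
    maximality unless the supremum is 1. *)
Lemma locally_constant_segment (P : R -> Prop) :
  (forall T, 0 <= T <= 1 -> exists2 e : R, 0 < e & forall t t', 0 <= t <= 1 -> 0 <= t' <= 1 ->
     `|t - T| < e -> `|t' - T| < e -> P t -> P t') -> P 0 -> P 1.
Proof.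
move=> loc P0.
pose S := [set t | 0 <= t <= 1 /\ P t].
have S0 : S 0 by split; rewrite // lexx ler01.
have hS : has_sup S by split; [exists 0|exists 1 => t [/andP[_ t1] _]].
pose T := sup S.
have T01 : 0 <= T <= 1.
  apply/andP; split; first by apply: ub_le_sup => //; exact: hS.2.
  by apply: ge_sup; [exists 0|move=> t [/andP[_ t1] _]].
have [e e0 He] := loc T T01.
have [t [t01 Pt] Tt] := sup_adherent e0 hS.
have tT : t <= T by apply: ub_le_sup; [exact: hS.2|].
have tTe : `|t - T| < e by rewrite distrC ger0_norm; rewrite -/T in Tt; lra.
pose t' := Num.min 1 (T + e / 2).
have t'01 : 0 <= t' <= 1.
  by rewrite le_min ge_min lexx ler01 andbT /=; move: T01; lra.
have Tt' : T <= t' by rewrite le_min (andP T01).2 lerDl divr_ge0 ?ltW.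
have t'T : `|t' - T| < e.
  rewrite ger0_norm ?subr_ge0//; have : t' <= T + e / 2 by rewrite ge_min lexx orbT.
  by lra.
have Pt' := He _ _ t01 t'01 tTe t'T Pt.
have : t' <= T by apply: ub_le_sup; [exact: hS.2|].
rewrite ge_min => /orP[T1|]; last by lra.
by move: Pt'; rewrite /t' min_l//; lra.
Qed.

Lemma Omega_ball (y : 'rV[R]_N) : Omega y ->
  exists2 e : R, 0 < e & forall v, `|v| < e -> Omega (y + v).
Proof.
move=> Oy; have /nbhs_ballP[e /= e0 He] : nbhs y Omega by exact: open_nbhs_nbhs.
exists e => // v ve; apply: He; rewrite -ball_normE /= opprD addrA subrr sub0r normrN.
exact: ve.
Qed.

Lemma line_in_siegel (p d : E) : siegel Q Omega p ->
  exists2 r : R, 0 < r & forall w, square r w -> siegel Q Omega (p + w *: d).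
Proof.
move=> /siegelE/Omega_ball[e e0 He].
(* [v1], [v2], [v3] are the coefficients of [a], [b] and [a ^+ 2 + b ^+ 2] in [Im z - Q(u, u)] along
   the line at [a + i b]. A radius at most 1 gives [a ^+ 2 <= |a|], and the 1 in [k] makes the bound
   strict. *)
pose v1 := Defs.ImV d.1 - Defs.ReV (Q d.2 p.2 + Q p.2 d.2).
pose v2 := Defs.ReV d.1 - Defs.ReV ('i%C *: (Q d.2 p.2 - Q p.2 d.2)).
pose v3 := - Defs.ReV (Q d.2 d.2).
pose k := `|v1| + `|v2| + 2 * `|v3| + 1.
have k0 : 0 < k by rewrite ltr_wpDl// !addr_ge0// mulr_ge0.
exists (Num.min 1 (e / k)); first by rewrite lt_min ltr01 divr_gt0.
move=> [a b] [/=]; rewrite !lt_min => /andP[a1 ae] /andP[b1 be].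
apply/siegelE.
have -> : Defs.ImV (p + Complex a b *: d).1 - Defs.ReV (Q (p + Complex a b *: d).2 (p + Complex a b *: d).2)
   = Defs.ImV p.1 - Defs.ReV (Q p.2 p.2) + (a *: v1 + b *: v2 + (a ^+ 2 + b ^+ 2) *: v3).
  rewrite /= !(hmapDl, hmapDr).
  have QZl c u v : Q (c *: u) v = c *: Q u v by have := hmapPl Q c u 0 v; rewrite hmap0l !addr0.
  have QZr c u v : Q u (c *: v) = conjc c *: Q u v by have := hmapPr Q c u v 0; rewrite hmap0r !addr0.
  rewrite !QZl !QZr; apply/matrixP => i j; rewrite !mxE.
  case: (p.1 i j) => p1 p1'; case: (d.1 i j) => d1 d1'; case: (Q p.2 p.2 i j) => ? ?.
  case: (Q d.2 p.2 i j) => ? ?; case: (Q p.2 d.2 i j) => ? ?; case: (Q d.2 d.2 i j) => ? ? /=.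
  by ring.
apply: He.
have a0 := normr_ge0 a; have b0 := normr_ge0 b.
have a2 : a ^+ 2 <= `|a| by rewrite -(real_normK (num_real _)) expr2 ler_piMr// ltW.
have b2 : b ^+ 2 <= `|b| by rewrite -(real_normK (num_real _)) expr2 ler_piMr// ltW.
set r := e / k in ae be.
have ek : e = r * k by rewrite /r divfK// gt_eqF.
have r0 : 0 < r by rewrite divr_gt0.
apply: le_lt_trans (ler_normD _ _) _.
apply: (@le_lt_trans _ _ (r * `|v1| + r * `|v2| + 2 * r * `|v3|)).
  apply: lerD.
    apply: le_trans (ler_normD _ _) _; rewrite !normrZ.
    by apply: lerD; rewrite ler_wpM2r// ltW.
  rewrite normrZ ler_wpM2r// ger0_norm ?addr_ge0 ?sqr_ge0//.
  by move: a2 b2 ae be; clear; lra.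
by rewrite ek /k -subr_gt0 (_ : _ - _ = r)//; ring.
Qed.

Lemma square_nbhs0 (A : set C) : nbhs (0 : C) A -> exists2 r : R, 0 < r & forall w, square r w -> A w.
Proof.
move=> /nbhs_ballP[[e e'] /= e0 He]; move: e0; rewrite ltcE /= => /andP[/eqP e'0 e0].
exists (e / 2); first by rewrite divr_gt0.
move=> [a b] [/= ae be]; apply: He.
rewrite -ball_normE; change (`|0 - Complex a b| < Complex e e').
rewrite sub0r normrN normcE ltcE /= e'0 eqxx /=.
by apply: le_lt_trans (normc_le_sum _ _) _; lra.
Qed.

Variable L : line_bundle Omega Q.
Implicit Types s : section L.

Lemma line_differentiable (p d : E) (w : C) : differentiable (fun w : C => p + w *: d) w.
Proof.
apply: differentiableD; first exact: differentiable_cst.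
by apply: differentiableZl; exact: ex_diff.
Qed.

Lemma line_chart (x : D) (d : E) (i : atlas L) : chart i x -> exists2 r : R, 0 < r &
  forall w, square r w -> exists y : D, val y = val x + w *: d /\ chart i y.
Proof.
move=> ix; have [B oB BE] := chart_open i.
have cd : {for 0, continuous (fun w : C => val x + w *: d)}.
  by apply: differentiable_continuous; exact: line_differentiable.
have nB : nbhs (val x + 0 *: d) B.
  rewrite scale0r addr0; apply: open_nbhs_nbhs; split=> //.
  by have : (set_val @^-1` B) x by rewrite BE.
have [r1 r10 H1] := square_nbhs0 (cd _ nB).
have [r2 r20 H2] := line_in_siegel d (siegelP x).
exists (Num.min r1 r2); first by rewrite lt_min r10.
move=> w [wr wi].
have [wr1 wr2] : square r1 w /\ square r2 w.
  by move: wr wi; rewrite /square !lt_min => /andP[? ?] /andP[? ?].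
have [y yE] := mk_siegel (H2 w wr2).
exists y; split; first exact: yE.
rewrite -BE /=.
by have := H1 w wr1; rewrite /= -yE.
Qed.

Definition local_section s (i : atlas L) : E -> C := 'valL_(0) (fun x => triv i x (s x)).

Lemma local_section_eq0 s i (y : D) : chart i y -> local_section s i (val y) = 0 <-> s y = 0.
Proof.
move=> iy; rewrite /local_section valL_val.
by split=> [/(triv_eq0 iy)//|->]; rewrite linear0.
Qed.

Lemma local_section_differentiable s i (y : D) (p d : E) (w : C) :
  holomorphic_section s -> chart i y -> val y = p + w *: d ->
  differentiable (fun w : C => local_section s i (p + w *: d)) w.
Proof.
move=> hs iy yE; apply: (@differentiable_comp _ _ _ _ (fun w : C => p + w *: d) (local_section s i)).
  exact: line_differentiable.
by have := hs i y iy; rewrite yE.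
Qed.

(** Vacuous outside the domain, so points of a line need no membership proof. *)
Definition vanishes s (p : E) : Prop := forall y : D, val y = p -> s y = 0.

(** The property carried along the segment is vanishing on a whole complex neighbourhood of the
    parameter, as unique continuation requires. *)
Lemma vanish_line s (p d : E) : holomorphic_section s ->
  (forall t : R, 0 <= t <= 1 -> siegel Q Omega (p + t%:C *: d)) ->
  (exists2 e : R, 0 < e & forall w, square e w -> vanishes s (p + w *: d)) ->
  vanishes s (p + d).
Proof.
move=> hs pD v0.
pose P (t : R) := exists2 e : R, 0 < e & forall w, square e (w - t%:C) -> vanishes s (p + w *: d).
suff [e e0 He] : P 1.
  by have := He 1; rewrite subrr scale1r; apply; exact: square0.
apply: (@locally_constant_segment P); last first.
  by have [e e0 He] := v0; exists e => // w; rewrite subr0; exact: He.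
move=> T T01; have [yT yTE] := mk_siegel (pD T T01).
have [i iyT] := chart_cover L yT; have [r r0 Hr] := line_chart d iyT.
have near_T w : square r (w - T%:C) -> exists y : D, val y = p + w *: d /\ chart i y.
  move=> /Hr[y [yE iy]]; exists y; split; last exact: iy.
  rewrite yE yTE -addrA -scalerDl [T%:C + _]addrC subrK; reflexivity.
(* For [w] in the [r / 8] square about [t'], [|Re w - t| < 3 r / 8] and [|Im w| < r / 8]; as
   [9 + 1 < 16], [w] lies in the disc of radius [r / 2] about [t]. *)
exists (r / 8); first by rewrite divr_gt0.
move=> t t' _ _ tT t'T [e e0 He].
have shift (w : C) (a c k k' : R) : square k (w - a%:C) -> `|a - c| < k' -> square (k + k') (w - c%:C).
  case: w => x y [/=]; rewrite !subr0 => xa ya ac; split; rewrite /= ?subr0.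
    by rewrite -(subrKA a); apply: le_lt_trans (ler_normD _ _) _; lra.
  by have := normr_ge0 (a - c); lra.
pose f w := local_section s i (p + w *: d).
have e'0 : 0 < Num.min e (r / 2) by rewrite lt_min e0 divr_gt0.
have r20 : 0 < r / 2 by rewrite divr_gt0.
have r2T (w : C) : square (r / 2) (w - t%:C) -> square r (w - T%:C).
  by move/shift => /(_ _ _ tT); apply: square_le; lra.
have F0 := @differentiable_unique_continuation _ f t%:C (r / 2) (Num.min e (r / 2)) r20 e'0.
exists (r / 8); first by rewrite divr_gt0.
move=> w wt' y yE.
have ywT : square r (w - T%:C) by move/shift : wt' => /(_ _ _ t'T); apply: square_le; lra.
have [y' [y'E iy']] := near_T w ywT.
have <- : y' = y by apply: val_inj; exact: etrans y'E (esym yE).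
apply/(local_section_eq0 s iy'); rewrite y'E; apply: F0.
- move=> z zt; have [y1 [y1E iy1]] := near_T z (r2T z zt).
  exact: local_section_differentiable hs iy1 y1E.
- move=> z zt; have [zt1 zt2] : square e (z - t%:C) /\ square (r / 2) (z - t%:C).
    by move: zt; rewrite /square !lt_min => -[/andP[? ?] /andP[? ?]].
  have [y1 [y1E iy1]] := near_T z (r2T z zt2).
  by rewrite /f -y1E; apply/(local_section_eq0 s iy1); exact: (He z zt1).
- move: wt' => [].
  case: (w) => a b /=; rewrite !subr0 => a1 b1.
  have tt' : `|a - t| < 3 * r / 8.
    rewrite -(subrKA t'); apply: le_lt_trans (ler_normD _ _) _.
    have : `|t' - t| <= `|t' - T| + `|T - t| by rewrite -{1}(subrKA T) ler_normD.
    by rewrite [`|T - t|]distrC; lra.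
  have h1 : (a - t) ^+ 2 < (3 * r / 8) ^+ 2.
    rewrite -(real_normK (num_real _)) (@ltr_pXn2r _ 2%N isT) ?nnegrE//.
    by rewrite divr_ge0// mulr_ge0// ltW.
  have h2 : b ^+ 2 < (r / 8) ^+ 2.
    rewrite -(real_normK (num_real _)) (@ltr_pXn2r _ 2%N isT) ?nnegrE//.
    by rewrite divr_ge0// ltW.
  have h3 : 0 < r ^+ 2 by rewrite exprn_gt0.
  by move: h1 h2; rewrite !exprMn !exprVn; move: (r ^+ 2) h3; clear => x *; lra.
Qed.

(** Imaginary multiples of [d] move [Im z] towards its target, within the domain by convexity of
    [Omega]. At each zero, invariance gives zeros along the real direction, and
    [differentiable_vanish_axis] turns them into zeros a little further on. The real part is
    corrected last. *)
Lemma vanishes_translation s (x x' : D) : holomorphic_section s ->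
  (forall (a : 'rV[R]_N) (y y' : D), val y' = val y + (Defs.toC a, 0) -> s y = 0 -> s y' = 0) ->
  (val x).2 = (val x').2 -> s x = 0 -> s x' = 0.
Proof.
move=> hs inv xx' sx.
have lt_half (a r : R) : 0 < r -> a < r / 2 -> a < r by lra.
have lt_12th (a r : R) : 0 < r -> a < r / 12 -> a < r by lra.
have ltD_12th (a b r : R) : 0 < r -> a < r / 2 -> b < r / 12 -> a + b < r by lra.
have ltD_sixth (a b r : R) : a < r / 12 -> b < r / 12 -> a + b < r / 2 / 3 by lra.
pose eta := Defs.ImV (val x').1 - Defs.ImV (val x).1.
pose d : E := (Defs.toC eta, 0).
have /siegelE := siegelP x => Dx; have /siegelE := siegelP x' => Dx'.
have pD (t : R) : 0 <= t <= 1 -> siegel Q Omega (val x + (Complex 0 t) *: d).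
  move=> t01; apply/siegelE.
  have -> : (val x + (Complex 0 t) *: d).2 = (val x).2 by rewrite /= scaler0 addr0.
  have -> : Defs.ImV (val x + (Complex 0 t) *: d).1 - Defs.ReV (Q (val x).2 (val x).2) =
    (1 - t) *: (Defs.ImV (val x).1 - Defs.ReV (Q (val x).2 (val x).2)) +
    t *: (Defs.ImV (val x').1 - Defs.ReV (Q (val x').2 (val x').2)).
    rewrite -xx' /eta; apply/matrixP => i j; rewrite !mxE.
    case: ((val x).1 i j) => ? ?; case: ((val x').1 i j) => ? ?; case: (Q _ _ i j) => ? ? /=.
    by ring.
  exact: Omega_convex.
pose P (t : R) := vanishes s (val x + (Complex 0 t) *: d).
have real_transl (p : E) (t : R) : p + Complex t 0 *: d = p + (Defs.toC (t *: eta), 0).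
  congr (_ + _); congr (_, _); last exact: scaler0.
  by apply/matrixP => i j; rewrite !mxE; apply/eqP; rewrite eq_complex /=; apply/andP; split; apply/eqP; ring.
have P1 : P 1.
  apply: (@locally_constant_segment P); last first.
    move=> y; rewrite (_ : Complex 0 0 = 0 :> C)// scale0r addr0 => yE.
    by rewrite (_ : y = x)//; exact: val_inj.
  move=> T T01; have [yT yTE] := mk_siegel (pD T T01).
  have [i iyT] := chart_cover L yT; have [r r0 Hr] := line_chart d iyT.
  have near_T w : square r w -> exists y : D, val y = val x + (w + Complex 0 T) *: d /\ chart i y.
    move=> /Hr[y [yE iy]]; exists y; split; last exact: iy.
    rewrite yE yTE -addrA -scalerDl [Complex 0 T + _]addrC; reflexivity.
  (* Then [|t' - t| < r / 6], one third of the half side [r / 2]: the reach of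
     [differentiable_vanish_axis]. *)
  exists (r / 12); first by rewrite divr_gt0.
  move=> t t' _ _ tT t'T Pt y yE.
  pose f w := local_section s i (val x + w *: d).
  have r20 : 0 < r / 2 by rewrite divr_gt0.
  have sqT (w : C) : square (r / 2) (w - Complex 0 t) -> square r (w - Complex 0 T).
    case: w => a b [/=]; rewrite !subr0 => a1 b1; split; rewrite /= ?subr0; first exact: lt_half.
    by rewrite -(subrKA t); apply: le_lt_trans (ler_normD _ _) _; exact: ltD_12th.
  have sq0 (a b : R) : `|a| < r -> `|b - T| < r -> square r (Complex a b - Complex 0 T).
    by split; rewrite /= ?subr0.
  have fd (w : C) : square (r / 2) (w - Complex 0 t) -> differentiable f w.
    move=> /sqT/near_T[y1 []]; rewrite subrK => y1E iy1.
    exact: local_section_differentiable hs iy1 y1E.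
  have fz (a : R) : `|a| < r / 2 -> f (Complex a 0 + Complex 0 t) = 0.
    move=> ar; have [|y1 []] := near_T (Complex a t - Complex 0 T).
      by apply: sq0; [exact: lt_half|exact: lt_12th].
    rewrite subrK => y1E iy1.
    have -> : Complex a 0 + Complex 0 t = Complex a t.
      by apply/eqP; rewrite eq_complex /= addr0 add0r !eqxx.
    rewrite /f -y1E; apply/(local_section_eq0 s iy1).
    have [|y2 [y2E _]] := near_T (Complex 0 t - Complex 0 T).
      by apply: sq0; rewrite ?normr0//; exact: lt_12th.
    apply: (inv (a *: eta) y2); last by apply: Pt; rewrite y2E subrK; reflexivity.
    rewrite y1E y2E subrK -real_transl -addrA -scalerDl; congr (_ + _ *: _).
    by apply/eqP; rewrite eq_complex /= addr0 add0r !eqxx.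
  have tt' : `|t' - t| < r / 2 / 3.
    rewrite -(subrKA T); apply: le_lt_trans (ler_normD _ _) _; rewrite [`|T - t|]distrC.
    exact: ltD_sixth.
  have := differentiable_vanish_axis r20 fd fz tt'; have -> : Complex 0 (t' - t) + Complex 0 t = Complex 0 t'.
    by apply/eqP; rewrite eq_complex /= addr0 subrK !eqxx.
  have [|y1 []] := near_T (Complex 0 t' - Complex 0 T).
    by apply: sq0; rewrite ?normr0//; exact: lt_12th.
  rewrite subrK => y1E iy1; rewrite /f -y1E => /(local_section_eq0 s iy1).
  by rewrite (_ : y = y1)//; apply: val_inj; exact: etrans yE (esym y1E).
have one01 : 0 <= (1 : R) <= 1 by rewrite ler01 lexx.
have [y yE] := mk_siegel (pD 1 one01).
apply: (inv (Defs.ReV (val x').1 - Defs.ReV (val x).1) y); last exact: P1.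
rewrite yE; move: xx'; rewrite /d /eta; case: (val x) (val x') => z u [z' u'] /= uu'.
congr (_, _); last by rewrite /= scaler0 !addr0.
rewrite /=; apply/matrixP => i j; rewrite !mxE; case: (z i j) => ? ?; case: (z' i j) => ? ?.
by apply/eqP; rewrite eq_complex /=; apply/andP; split; apply/eqP; ring.
Qed.

(** With [x0 = (z0, 0)], the zeros near [x0] are moved to those above [z0 / e], continued from
    [u = 0] to the [u] of [x], then moved within that slice to [x]. *)
Lemma section_eq0 s (x0 : D) : holomorphic_section s ->
  (forall (a : 'rV[R]_N) (y y' : D), val y' = val y + (Defs.toC a, 0) -> s y = 0 -> s y' = 0) ->
  (val x0).2 = 0 ->
  (forall u : 'rV[C]_M, exists2 e : R, 0 < e & forall w, square e w ->
     vanishes s (val x0 + w *: ((0, u) : E))) ->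
  forall x, s x = 0.
Proof.
move=> hs inv x00 v0 x.
set u := (val x).2; pose q := Defs.ReV (Q u u).
have /siegelE := siegelP x0; rewrite x00 hmap0l.
have -> : Defs.ReV (0 : 'rV[C]_N) = 0 by apply/matrixP => i j; rewrite !mxE.
rewrite subr0; set y0 := Defs.ImV _ => Oy0.
(* Dividing [y0 - e *: q] by [e] shows that an imaginary part [y0 / e] leaves room for the whole
   segment from 0 to [u]. *)
have [e [e0 e1 Oe]] : exists e : R, [/\ 0 < e, e <= 1 & Omega (y0 - e *: q)].
  have [e e0 He] := Omega_ball Oy0.
  have q1 : 0 < `|q| + 1 by rewrite ltr_wpDl.
  exists (Num.min 1 (e / (`|q| + 1))); split.
  - by rewrite lt_min ltr01 divr_gt0.
  - by rewrite ge_min lexx.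
  - have m0 : 0 < Num.min 1 (e / (`|q| + 1)) by rewrite lt_min ltr01 divr_gt0.
    apply: He; rewrite normrN normrZ gtr0_norm//.
    apply: (@lt_le_trans _ _ (Num.min 1 (e / (`|q| + 1)) * (`|q| + 1))).
      by rewrite ltr_pM2l// ltrDl.
    by rewrite -ler_pdivlMr// ge_min lexx orbT.
have e'0 : 0 < e^-1 by rewrite invr_gt0.
pose p : E := (e^-1%:C *: (val x0).1, 0).
pose d : E := (0, u).
have QZ (c : C) : Q (c *: u) (c *: u) = (c * conjc c) *: Q u u.
  have := hmapPl Q c u 0 (c *: u); rewrite hmap0l !addr0 => ->.
  by have := hmapPr Q c u u 0; rewrite hmap0r !addr0 => ->; rewrite scalerA.
have pD (t : R) : 0 <= t <= 1 -> siegel Q Omega (p + t%:C *: d).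
  move=> /andP[t0 t1]; apply/siegelE.
  have -> : (p + t%:C *: d).2 = t%:C *: u by rewrite /= add0r.
  have t2 : 0 <= t ^+ 2 <= 1 by rewrite sqr_ge0 expr_le1.
  have := Omega_scale e'0 (Omega_convex t2 Oy0 Oe); congr Omega.
  rewrite QZ /y0 /q; apply/matrixP => i j; rewrite !mxE.
  case: ((val x0).1 i j) => ? ?; case: (Q u u i j) => ? ? /=.
  by field; rewrite gt_eqF.
have [y yE] : exists y : D, val y = p + d.
  apply: mk_siegel; have := pD 1; rewrite scale1r; apply.
  by rewrite ler01 lexx.
apply: (@vanishes_translation s y x hs inv).
  by rewrite yE /= add0r.
apply: (vanish_line hs pD) yE.
have [r1 r10 H1] := v0 u.
have [r2 r20 H2] := line_in_siegel d (siegelP x0).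
exists (Num.min r1 r2); first by rewrite lt_min r10.
move=> w [wr wi] y1 y1E.
have [w1 w2] : square r1 w /\ square r2 w.
  by move: wr wi; rewrite /square !lt_min => /andP[? ?] /andP[? ?].
have [y2 y2E] := mk_siegel (H2 w w2).
apply: (@vanishes_translation s y2 y1 hs inv); last exact: (H1 w w1).
by rewrite y1E y2E /= x00.
Qed.

End Continuation.

(** * Proportionality of intertwiners into holomorphic sections *)

Section Intertwiners.
Context {R : realType} {N M : nat} {Omega : set 'rV[R]_N}.
Context {Q : hermitian_map R N M} {L : equivariant_line_bundle Omega Q}.
Hypothesis Omega_regular : regular_cone Omega.
Context {V : hilbertType R}.
Variable pi : unitary_rep Q V.
Hypothesis pi_irr : irreducible_rep pi.
Local Notation D := (siegel Q Omega).
Local Notation C := R[i].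
Local Notation E := ('rV[C]_N * 'rV[C]_M)%type.
Local Notation normc := Normc.normc.
Implicit Types (F T S : V -> section L) (v w : V).

(** Bounded evaluations stand for continuity: they pass to linear combinations, and to [A (T v)] for
    a unitary equivalence [A], which comes with no continuity statement for the compact-open
    topology. *)
Record holomorphic_intertwiner F : Prop := {
  hi_linear : forall (a : C) v w x, F (a *: v + w) x = a *: F v x + F w x;
  hi_holo : forall v, holomorphic_section (F v);
  hi_bounded : forall (x : D) i, chart i x ->
    exists K : R, forall v, normc (triv i x (F v x)) <= K * hnorm v;
  hi_act : forall g v, F (pi g v) = sact g (F v) }.

Lemma valL_linear (a : C) (f g : D -> C) :
  'valL_(0) (fun x => a * f x + g x) = (fun p : E => a * 'valL_(0) f p + 'valL_(0) g p) :> (E -> C).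
Proof.
apply/funext => p; have [Dp|Dp] := pselect (siegel Q Omega p).
  by have [x <-] := mk_siegel Dp; rewrite !valL_val.
have out (h : D -> C) : 'valL_(0) h p = 0.
  by rewrite /= oinv_set_val insubN//; apply/negP => /set_mem.
by rewrite !out mulr0 addr0.
Qed.

Lemma holomorphic_section_linear (a : C) (s t : section L) :
  holomorphic_section s -> holomorphic_section t ->
  holomorphic_section (fun x => a *: s x + t x).
Proof.
move=> hs ht i x ix.
have -> : (fun x => triv i x (a *: s x + t x)) = (fun x => a * triv i x (s x) + triv i x (t x)).
  by apply/funext => y; rewrite linearP.
rewrite valL_linear; apply: differentiableD; last exact: ht.
by apply: (@differentiableZ C _ C ('valL_(0) (fun x => triv i x (s x))) a); exact: hs.
Qed.

Section OneIntertwiner.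
Variable F : V -> section L.
Hypothesis hF : holomorphic_intertwiner F.

Lemma hi_zero x : F 0 x = 0.
Proof.
have := hi_linear hF 1 0 0 x; rewrite !scale1r addr0 => /eqP.
by rewrite -{1}[F 0 x]addr0 => /eqP/addrI/esym.
Qed.

Lemma hi_scale (a : C) v x : F (a *: v) x = a *: F v x.
Proof. by have := hi_linear hF a v 0 x; rewrite hi_zero !addr0. Qed.

Lemma hi_nact g v (x : D) : F v x = 0 -> F (pi g v) (nact g x) = 0.
Proof. by move=> Fx; rewrite (hi_act hF); exact: (sact_eq0 g (F v) x).1 Fx. Qed.

Lemma hi_nactV g v (x : D) : F (pi g^-1%g v) x = 0 -> F v (nact g x) = 0.
Proof. by move=> /(hi_nact g); rewrite -repM mulgV rep1. Qed.

Lemma hi_translation v (a : 'rV[R]_N) (y y' : D) :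
  val y' = val y + (Defs.toC a, 0) -> F v y = 0 -> F v y' = 0.
Proof.
move=> yE Fy; have [chi Hchi] := central_character pi_irr a.
have := hi_nact ((a, 0) : heis Q) Fy; rewrite Hchi hi_scale.
have -> : nact ((a, 0) : heis Q) y = y'.
  apply: val_inj; rewrite nact_translation yE.
  by case: (val y) => z u; congr (_, _); rewrite /= addr0.
have [chi0|chi0] := eqVneq chi 0; last first.
  by move=> /eqP; rewrite scaler_eq0 (negbTE chi0) => /eqP.
move=> _; suff -> : v = 0 by exact: hi_zero.
by apply: hnorm_eq0; rewrite -(rep_hnorm pi ((a, 0) : heis Q)) Hchi chi0 scale0r hnorm0.
Qed.

Lemma hi_riesz (x : D) i : chart i x ->
  exists k, forall v, triv i x (F v x) = inner v k.
Proof.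
move=> ix; have [K HK] := hi_bounded hF ix.
apply: (@riesz_representation _ V (fun v => triv i x (F v x)) K) => // a v w.
by rewrite (hi_linear hF) linearP.
Qed.

Lemma hi_kernel v0 : v0 != 0 -> (forall x, F v0 x = 0) -> forall v x, F v x = 0.
Proof.
move=> v00 F0.
have /choice[i Hi] := @chart_cover _ _ _ _ _ L.
have /choice[K HK] : forall x, exists K : R, forall v, normc (triv (i x) x (F v x)) <= K * hnorm v.
  by move=> x; exact: (hi_bounded hF (Hi x)).
have [||||W0|WT] := pi_irr.2 [set v | forall x, F v x = 0].
- rewrite (_ : [set v | _] = [set v | forall x, normc (triv (i x) x (F v x)) = 0]).
    apply: (@closed_zero_set _ _ _ (fun x v => normc (triv (i x) x (F v x))) K) => x v w.
    apply: le_trans (HK x (v - w)).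
    have -> : triv (i x) x (F (v - w) x) = triv (i x) x (F v x) - triv (i x) x (F w x).
      by rewrite [v - w]addrC -scaleN1r (hi_linear hF) linearP scaleN1r [LHS]addrC.
    have nD (a b : C) : normc a <= normc b + normc (a - b).
      have := ler_normD b (a - b); rewrite addrC subrK !normcE -rmorphD lecR.
      by [].
    rewrite ler_norml; set a := triv _ _ _; set b := triv _ _ _.
    have := nD a b; have := nD b a.
    have -> : normc (b - a) = normc (a - b).
      by apply: complexI; rewrite -!normcE distrC.
    by move=> h1 h2; apply/andP; split; lra.
  apply/seteqP; split=> v /= Fv x; first by rewrite Fv linear0 Normc.normc0.
  by apply: (triv_eq0 (Hi x)); apply: Normc.eq0_normc.
- exact: hi_zero.
- by move=> a v w /= Fv Fw x; rewrite (hi_linear hF) Fv Fw scaler0 addr0.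
- by move=> g v /= Fv x; rewrite -(nactVK g x); exact: hi_nact.
- by move: v00; have : [set v | forall x, F v x = 0] v0 by []; rewrite W0 => /= ->; rewrite eqxx.
- by move=> v; have : setT v by []; rewrite -WT.
Qed.

End OneIntertwiner.

Lemma hi_sub T S (r : C) : holomorphic_intertwiner T -> holomorphic_intertwiner S ->
  holomorphic_intertwiner (fun v x => r *: T v x + S v x).
Proof.
move=> hT hS; split.
- move=> a v w x; rewrite (hi_linear hT) (hi_linear hS) !scalerDr !scalerA (mulrC r).
  by rewrite addrACA.
- by move=> v; apply: holomorphic_section_linear; [exact: hi_holo hT _|exact: hi_holo hS _].
- move=> x i ix; have [K HK] := hi_bounded hT ix; have [K' HK'] := hi_bounded hS ix.
  exists (normc r * K + K') => v; rewrite linearP.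
  have := ler_normD (r * triv i x (T v x)) (triv i x (S v x)).
  rewrite !normcE -rmorphD lecR Normc.normcM => /le_trans; apply.
  rewrite mulrDl lerD// -mulrA ler_wpM2l//.
  by case: (r) => ? ?; exact: sqrtr_ge0.
- move=> g v; apply: functional_extensionality_dep => x; rewrite (hi_act hT) (hi_act hS).
  by rewrite -sact_linear.
Qed.

Let Omega_convex (x y : 'rV[R]_N) (t : R) : 0 <= t <= 1 ->
  Omega x -> Omega y -> Omega ((1 - t) *: x + t *: y).
Proof.
move=> /andP[t0 t1] Ox Oy.
have := cone_convex Omega_regular (Itv01 t0 t1) (mem_set Oy) (mem_set Ox).
by move=> /set_mem; rewrite addrC.
Qed.

Lemma intertwiners_proportional T S :
  holomorphic_intertwiner T -> holomorphic_intertwiner S -> injective T ->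
  exists c : C, forall v x, S v x = c *: T v x.
Proof.
move=> hT hS Tinj.
have oO := cone_open Omega_regular.
have sO := @cone_scale _ _ _ Omega_regular.
have [y0 Oy0] := cone_nonempty Omega_regular.
have [x0 x0E] : exists x0 : D, val x0 = ('i%C *: Defs.toC y0, 0).
  apply: mk_siegel; apply/siegelE; rewrite /= hmap0l.
  rewrite (_ : _ - _ = y0)//; apply/matrixP => i j; rewrite !mxE /=; ring.
have x02 : (val x0).2 = 0 by rewrite x0E.
have vt F v x x' : holomorphic_intertwiner F -> (val x).2 = (val x').2 -> F v x = 0 -> F v x' = 0.
  move=> hF; apply: (vanishes_translation oO Omega_convex); first exact: hi_holo hF v.
  by move=> a y y'; exact: hi_translation.
have [i ix0] := chart_cover L x0.
have [K HK] := hi_riesz hT ix0; have [KS HKS] := hi_riesz hS ix0.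
have heis2 (u : 'rV[C]_M) (x : D) : (val (nact ((0, u) : heis Q) x)).2 = (val x).2 + u by [].
(* If [K = 0], every [T w] vanishes at [x0]; an element [n(0, u)] followed by a move in [z] reaches
   any point, so [T] would be zero. *)
have Kn0 : K != 0.
  apply/eqP => K0; have [v v0] := pi_irr.1.
  suff : v = 0 by move=> vz; rewrite vz eqxx in v0.
  apply: Tinj; apply: functional_extensionality_dep => x; rewrite (hi_zero hT).
  have Tx0 w : T w x0 = 0 by apply: (triv_eq0 ix0); rewrite HK K0 inner0r.
  apply: (vt T v (nact ((0, (val x).2) : heis Q) x0) x hT); first by rewrite heis2 x02 add0r.
  by apply: (hi_nactV hT); exact: Tx0.
have TK0 : triv i x0 (T K x0) != 0.
  rewrite HK innerE; apply/eqP => /complexI/eqP; rewrite sqrf_eq0 => /eqP/hnorm_eq0/eqP.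
  by rewrite (negbTE Kn0).
pose c := triv i x0 (S K x0) / triv i x0 (T K x0).
have trivB j (y : D) (a : C) (p q : L y) :
    triv j y (- a *: p + q) = triv j y q - a * triv j y p.
  by rewrite linearP /= scaleNr addrC.
have hU r := hi_sub (- r) hT hS.
suff UK x : - c *: T K x + S K x = 0.
  exists c => v x; have := hi_kernel (hU c) Kn0 UK v x.
  by rewrite scaleNr addrC => /eqP; rewrite subr_eq0 => /eqP.
move: x; apply: (@section_eq0 _ _ _ _ Q oO Omega_convex sO L _ x0) => //.
- exact: hi_holo (hU c) K.
- by move=> a y y'; exact: (hi_translation (hU c)).
move=> u; pose d : E := (0, u).
have [r r0 Hr] := line_chart oO d ix0.
pose ls (s : section L) (w : C) := local_section s i (val x0 + w *: d).
have ls0 s : ls s 0 = triv i x0 (s x0).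
  by rewrite /ls scale0r addr0 /local_section valL_val.
have lsE s (w : C) (y : D) : val y = val x0 + w *: d -> ls s w = triv i y (s y).
  by move=> yE; rewrite /ls -yE /local_section valL_val.
have dls s (w : C) : holomorphic_section s -> square r w -> differentiable (ls s) w.
  move=> hs /Hr[y [yE iy]]; exact: local_section_differentiable hs iy yE.
have [w wr|//||r' r'0 Hr'] := @conj_quotient_constant _ (ls (S K)) (ls (T K)) (ls (T KS)) r r0.
- by split; apply: dls => //; [exact: hi_holo hS _|exact: hi_holo hT _|exact: hi_holo hT _].
- by rewrite ls0.
- move=> w wr gw gNw.
  have [rho rhoE rhoM] : exists2 rho : C, ls (S K) w / ls (T K) w = rho & rho * ls (T K) w = ls (S K) w.
    exists (ls (S K) w / ls (T K) w); first by [].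
    exact: divfK gw _.
  rewrite rhoE.
  have [y [yE iy]] := Hr w wr; have [y' [y'E iy']] := Hr _ (squareN wr).
  (* [g] brings the [u] coordinate of [y] back to 0; [g y] and [x0] may still differ in [z], which
     [vt] absorbs. *)
  pose g := (0, - w *: u) : heis Q.
  have Uy : - rho *: T K y + S K y = 0.
    apply: (triv_eq0 iy); rewrite trivB -(lsE (T K) w y yE) -(lsE (S K) w y yE).
    by rewrite rhoM subrr.
  have := hi_nact (hU rho) g Uy.
  have gy2 : (val (nact g y)).2 = (val x0).2.
    by rewrite heis2 yE /= x02 add0r scaleNr subrr.
  move=> /(vt _ _ _ x0 (hU rho) gy2) /= Ux0.
  have e1 : inner (pi g K) KS - rho * inner (pi g K) K = 0.
    by rewrite -HK -HKS -trivB Ux0 linear0.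
  have e2 : inner KS (pi g K) - conjc rho * inner K (pi g K) = 0.
    have := congr1 (@conjc R) e1; rewrite rmorphB rmorphM rmorph0 /=.
    by rewrite -!inner_conj.
  pose a := - conjc rho *: K + KS.
  have Ta : T a y' = 0.
    apply: (vt _ _ (nact g x0) _ hT); first by rewrite heis2 y'E /= x02.
    apply: (hi_nactV hT); apply: (triv_eq0 ix0); rewrite HK.
    rewrite -(rep_inner pi g) -repM mulgV rep1 /a innerDl innerZl.
    by rewrite mulNr addrC.
  have := congr1 (triv i y') Ta; rewrite /a (hi_linear hT) trivB linear0.
  rewrite -(lsE (T K) (- w) y' y'E) -(lsE (T KS) (- w) y' y'E) => /eqP; rewrite subr_eq0 => /eqP ->.
  by rewrite mulfK.
exists (Num.min r r'); first by rewrite lt_min r0.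
move=> w [wr wi] y yE.
have [w1 w2] : square r w /\ square r' w.
  by move: wr wi; rewrite /square !lt_min => /andP[? ?] /andP[? ?].
have [y' [y'E iy]] := Hr w w1.
have yy' : y' = y by apply: val_inj; exact: etrans y'E (esym yE).
move: iy; rewrite yy' => iy.
apply: (triv_eq0 iy); rewrite trivB -(lsE (T K) w y yE) -(lsE (S K) w y yE) Hr'// !ls0 -/c.
by rewrite subrr.
Qed.

End Intertwiners.

(** * Comparison of equivalent invariant Hilbert subspaces *)

Section MultiplicityFree.
Context {R : realType} {N M : nat} {Omega : set 'rV[R]_N}.
Context {Q : hermitian_map R N M} {L : equivariant_line_bundle Omega Q}.
Hypothesis Omega_regular : regular_cone Omega.
Local Notation C := R[i].
Local Notation normc := Normc.normc.

(** [T] and its composite with [A] are intertwiners from the same [V], hence proportional: [A] is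
    multiplication by some [c] on [H1], and the inner products differ by [|c|^-2]. *)
Lemma unitarily_equivalent_subspaces (H1 : set (section L)) ip1 H2 ip2 :
  irr_inv_hilbert_subspace H1 ip1 -> irr_inv_hilbert_subspace H2 ip2 ->
  unitarily_equivalent H1 ip1 H2 ip2 ->
  H1 = H2 /\ exists2 c : C, 0 < c &
    forall s t, H1 s -> H1 t -> ip2 s t = c * ip1 s t.
Proof.
move=> [V [pi [T [pi_irr [Tlin Tinj Thol Tcont Tact] -> ip1E]]]].
move=> [V2 [pi2 [T2 [_ [T2lin _ T2hol T2cont T2act] H2E ip2E]]]].
move=> [A [[AH Ainj Asurj] Alin Aip Aact]].
have rT v : range T (T v) by exists v.
have TlinE (a : C) v w : T (a *: v + w) = (fun x => a *: T v x + T w x).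
  by apply: functional_extensionality_dep => x; rewrite Tlin.
pose S v := A (T v).
(* The isometric lift through [T2] transfers holomorphy and bounded evaluations from [T2] to [S]. *)
have SE v : exists2 v', hnorm v' = hnorm v & T2 v' = S v.
  have : H2 (S v) by apply: AH; exact: rT.
  rewrite H2E => -[v' _ v'E]; exists v' => //.
  have := Aip _ _ (rT v) (rT v); rewrite -/(S v) -v'E ip1E ip2E.
  rewrite !innerE => /complexI/eqP.
  by rewrite eqrXn2 ?hnorm_ge0// => /eqP.
have hT : holomorphic_intertwiner pi T.
  by split=> // x i ix; exact: (pointwise_bounded ix).
have hS : holomorphic_intertwiner pi S.
  split.
  - by move=> a v w x; rewrite /S TlinE Alin.
  - by move=> v; have [v' _ <-] := SE v.
  - move=> x i ix; have [K HK] := pointwise_bounded ix (fun a v w => T2lin a v w x) T2cont.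
    by exists K => v; have [v' <- <-] := SE v.
  - by move=> g v; rewrite /S Tact Aact.
have [c Sc] := intertwiners_proportional Omega_regular pi_irr hT hS Tinj.
have ST v : S v = T (c *: v).
  by apply: functional_extensionality_dep => x; rewrite Sc (hi_scale hT).
have c0 : c != 0.
  have [v v0] := pi_irr.1; apply/eqP => cz.
  have : T v = T 0.
    apply: Ainj; [exact/mem_set|exact/mem_set|].
    by have := ST v; have := ST 0; rewrite /S cz !scale0r => -> ->.
  by move=> /Tinj vz; rewrite vz eqxx in v0.
have TS v : T v = S (c^-1 *: v) by rewrite ST scalerA divff// scale1r.
have HH : range T = H2.
  apply/seteqP; split=> s.
    by move=> [v _ <-]; rewrite TS; apply: AH; exact: rT.
  by move=> /Asurj[_ [v _ <-] <-]; rewrite -/(S v) ST.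
split=> //.
exists (c^-1 * conjc c^-1); first by rewrite -normCK exprn_gt0// normr_gt0 invr_eq0.
move=> _ _ [v _ <-] [w _ <-]; rewrite {1}(TS v) {1}(TS w) /S Aip// !ip1E.
by rewrite innerZl innerZr mulrA.
Qed.

End MultiplicityFree.

Theorem theorem1p1 (R : realType) (N M : nat) (N_gt0 : (0 < N)%N)
    (M_gt0 : (0 < M)%N) (Omega : set 'rV[R]_N) (Q : hermitian_map R N M)
    (Omega_regular : regular_cone Omega) (Q_positive : cone_positive Omega Q)
    (L : equivariant_line_bundle Omega Q) :
  multiplicity_free L.
Proof.
move=> H1 ip1 H2 ip2 h1 h2.
have [e|] := pselect (unitarily_equivalent H1 ip1 H2 ip2); last by right.
by left; exact: unitarily_equivalent_subspaces e.
Qed.
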